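(* Assume that $r,\psi,k,g,F,\gamma,A$ satisfy the hypotheses $(C_1)$–$(C_8)$ listed in the context, and let $c$, $K_\psi$, $m$, $M(a,b)$, $F^{(-\rho,\rho)}$, $F_{(\rho,\rho/c)}$ be as defined there. For $\rho>0$, say that $(\mathrm I^1_\rho)$ holds if $\rho>\|\psi\|_{[-r,0]}$ and $F^{(-\rho,\rho)}/m<1$, and that $(\mathrm I^0_\rho)$ holds if $F_{(\rho,\rho/c)}/M(a,b)>1$. Consider the integral equation $$u(t)=\psi(t)+\int_0^1k(t,s)g(s)F(s,u_s)\,ds+\gamma(t)\alpha[u],\quad t\in[-r,1].\qquad( * )$$ Equation $( * )$ has at least one nontrivial solution in $K_\psi$ if one of the following holds: $(S_1)$ there exist $\rho_1,\rho_2\in(0,\infty)$ with $\|\psi\|_{[-r,0]}<\rho_2$ and $\rho_1/c<\rho_2$ such that $(\mathrm I^0_{\rho_1})$ and $(\mathrm I^1_{\rho_2})$ hold; $(S_2)$ there exist $\rho_1,\rho_2\in(0,\infty)$ with $\|\psi\|_{[-r,0]}<\rho_1<\rho_2$ such that $(\mathrm I^1_{\rho_1})$ and $(\mathrm I^0_{\rho_2})$ hold. Equation $( * )$ has at least two nontrivial solutions in $K_\psi$ if one of the following holds: $(S_3)$ there exist $\rho_1,\rho_2,\rho_3\in(0,\infty)$ with $\|\psi\|_{[-r,0]}<\rho_2$ and $\rho_1/c<\rho_2<\rho_3$ such that $(\mathrm I^0_{\rho_1})$, $(\mathrm I^1_{\rho_2})$ and $(\mathrm I^0_{\rho_3})$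 hold; $(S_4)$ there exist $\rho_1,\rho_2,\rho_3\in(0,\infty)$ with $\|\psi\|_{[-r,0]}<\rho_1<\rho_2$ and $\rho_2/c<\rho_3$ such that $(\mathrm I^1_{\rho_1})$, $(\mathrm I^0_{\rho_2})$ and $(\mathrm I^1_{\rho_3})$ hold. Equation $( * )$ has at least three nontrivial solutions in $K_\psi$ if one of the following holds: $(S_5)$ there exist $\rho_1,\rho_2,\rho_3,\rho_4\in(0,\infty)$ with $\|\psi\|_{[-r,0]}<\rho_2$, $\rho_1/c<\rho_2<\rho_3$ and $\rho_3/c<\rho_4$ such that $(\mathrm I^0_{\rho_1})$, $(\mathrm I^1_{\rho_2})$, $(\mathrm I^0_{\rho_3})$ and $(\mathrm I^1_{\rho_4})$ hold; $(S_6)$ there exist $\rho_1,\rho_2,\rho_3,\rho_4\in(0,\infty)$ with $\|\psi\|_{[-r,0]}<\rho_1<\rho_2$ and $\rho_2/c<\rho_3<\rho_4$ such that $(\mathrm I^1_{\rho_1})$, $(\mathrm I^0_{\rho_2})$, $(\mathrm I^1_{\rho_3})$ and $(\mathrm I^0_{\rho_4})$ hold.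
   Context: For a compact interval $I$, $C(I,\mathbb R)$ carries the sup norm $\|\cdot\|_I$. For $r>0$, a continuous $u$ and $t$ with $[t-r,t]$ in the domain of $u$, $u_t:[-r,0]\to\mathbb R$ is $u_t(\theta)=u(t+\theta)$. Solutions of $( * )$ are sought in $C([-r,1],\mathbb R)$; a solution is nontrivial if it does not coincide with $\psi$. Here $\alpha[u]=\int_0^1u(s)\,dA(s)$ (Stieltjes integral). Hypotheses: $(C_1)$ $\psi:[-r,1]\to\mathbb R$ is continuous and $\psi(t)=0$ for all $t\in[0,1]$. $(C_2)$ $k:[-r,1]\times[0,1]\to\mathbb R$ is measurable, $k(t,s)=0$ for all $t\in[-r,0]$ and a.e. $s\in[0,1]$, and for every $\bar t\in[0,1]$, $\lim_{t\to\bar t}|k(t,s)-k(\bar t,s)|=0$ for a.e. $s\in[0,1]$. $(C_3)$ There are a subinterval $[a,b]\subseteq(0,1]$, a measurable $\Phi\ge0$ a.e., and a constant $c_1=c_1(a,b)\in(0,1]$ with $|k(t,s)|\le\Phi(s)$ for all $t\in[0,1]$ and a.e. $s\in[0,1]$, and $k(t,s)\ge c_1\Phi(s)$ for all $t\in[a,b]$ and a.e. $s\in[0,1]$. $(C_4)$ $g:[0,1]\to\mathbb R$ is measurable, $g\ge0$ a.e., $g\Phi\in L^1[0,1]$, and $\int_a^b\Phi(s)g(s)\,ds>0$. $(C_5)$ $F:[0,1]\times C([-r,0],\mathbb R)\to[0,\infty)$; for each $\phi$, $t\mapsto F(t,\phi)$ is measurable; for a.e. $t$, $\phi\mapsto F(t,\phi)$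 is continuous; for each $R>0$ there is $\varphi_R\in L^\infty[0,1]$ with $F(t,\phi)\le\varphi_R(t)$ for all $\phi$ with $\|\phi\|_{[-r,0]}\le R$ and a.e. $t\in[0,1]$. $(C_6)$ $A$ is of bounded variation on $[0,1]$ and $\mathcal K_A(s):=\int_0^1k(t,s)\,dA(t)\ge0$ for a.e. $s\in[0,1]$. $(C_7)$ $\gamma:[-r,1]\to\mathbb R$ is continuous, $\gamma\not\equiv0$, $\gamma(t)=0$ for all $t\in[-r,0]$, $0\le\alpha[\gamma]<1$, and there is $c_2\in(0,1]$ with $\gamma(t)\ge c_2\|\gamma\|_{[0,1]}$ for all $t\in[a,b]$. $(C_8)$ $r<b-a$ (with $r>0$ the delay). With $c=\min\{c_1,c_2\}$, $$K_0=\{u\in C([-r,1],\mathbb R):u(t)=0\ \forall t\in[-r,0],\ \min_{t\in[a,b]}u(t)\ge c\|u\|_{[-r,1]},\ \alpha[u]\ge0\},\qquad K_\psi=\psi+K_0.$$ Constants: $$\frac1m=\sup_{t\in[0,1]}\left\{\int_0^1|k(t,s)|g(s)\,ds+\frac{|\gamma(t)|}{1-\alpha[\gamma]}\int_0^1\mathcal K_A(s)g(s)\,ds\right\},$$ $$\frac1{M(a,b)}=\inf_{t\in[a,b]}\left\{\int_{a+r}^bk(t,s)g(s)\,ds+\frac{\gamma(t)}{1-\alpha[\gamma]}\int_{a+r}^b\mathcal K_A(s)g(s)\,ds\right\},$$ $$F^{(-\rho,\rho)}=\sup\left\{\frac{F(t,\phi)}{\rho}:t\in[0,1],\ \phi\in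 C([-r,0],\mathbb R),\ \|\phi\|_{[-r,0]}\le\rho\right\},$$ $$F_{(\rho,\rho/c)}=\inf\left\{\frac{F(t,\phi)}{\rho}:t\in[a,b],\ \phi\in C([-r,0],\mathbb R),\ \phi(\theta)\in[\rho,\rho/c]\ \forall\theta\in[-r,0]\right\}.$$ Quotients by $m$ and $M(a,b)$ mean products with $\frac1m$ and $\frac1{M(a,b)}$. *)

(* Defs.v *)
From HB Require Import structures.
From mathcomp Require Import all_boot all_order all_algebra.
From mathcomp Require Import all_classical all_reals all_analysis.

Set Implicit Arguments.
Unset Strict Implicit.
Unset Printing Implicit Defensive.

Import Order.TTheory GRing.Theory Num.Theory.
Import numFieldNormedType.Exports.
Local Open Scope classical_set_scope.
Local Open Scope ring_scope.

(* [R] with the sigma-algebra of Lebesgue measurable sets; the instances found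
   on [R] itself are the Borel ones. *)
Notation lebesgueR R := (caratheodory_type ((@wlength R idfun)^*)%mu).

Notation lambda := completed_lebesgue_measure.

Definition lebesgue_measurable_fun {R : realType} (D : set R) (f : R -> R) :=
  @measurable_fun _ _ (lebesgueR R) R D f.

Definition integ {R : realType} (a b : R) (f : R -> R) : R :=
  Rintegral lambda (`[a, b]%classic : set R) f.

Definition ae_on {R : realType} (a b : R) (P : R -> Prop) : Prop :=
  {ae (@lambda R), forall s, `[a, b]%classic s -> P s}.

Section RightRegularization.
Variables (R : realType) (h : R -> R).

Definition clamp01 (x : R) : R := Num.min 1 (Num.max 0 x).

(* Right-continuous version of [h] on [0, 1], equal to [h 0] on the left of 0
   and to [h 1] on the right of 1, so that the Stieltjes measure of [h] has the
   atoms h(0+) - h(0) at 0 and h(1) - h(1-) at 1. *)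
Definition right_reg (x : R) : R := inf [set h (clamp01 y) | y in `]x, +oo[].

Hypothesis hnd : {in `[0, 1] &, nondecreasing_fun h}.

Lemma clamp01_itv x : clamp01 x \in `[0, 1].
Proof.
by rewrite in_itv/= /clamp01 ge_min lexx le_min ler01 le_max lexx.
Qed.

Lemma clamp01_nd x y : x <= y -> clamp01 x <= clamp01 y.
Proof.
move=> xy; rewrite /clamp01 le_min !ge_min lexx/=; apply/orP; right.
by rewrite ge_max !le_max lexx xy orbT.
Qed.

Lemma right_reg_has_inf x : has_inf [set h (clamp01 y) | y in `]x, +oo[].
Proof.
split.
  by exists (h (clamp01 (x + 1))), (x + 1) => //=; rewrite in_itv/= andbT ltrDl.
exists (h 0) => _ [y _ <-]; apply: hnd; rewrite ?clamp01_itv//.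
  by rewrite in_itv/= lexx ler01.
by have := clamp01_itv y; rewrite in_itv/= => /andP[].
Qed.

Lemma right_reg_nd : nondecreasing right_reg.
Proof.
move=> x y xy; apply: lb_le_inf; first by have [] := right_reg_has_inf y.
move=> _ [z /= zy <-]; apply: ge_inf; first by have [] := right_reg_has_inf x.
exists z => //=; move: zy; rewrite !in_itv/= !andbT; exact: le_lt_trans.
Qed.

Lemma right_reg_rc : right_continuous right_reg.
Proof.
move=> x; apply/cvgrPdist_lt => e e0.
have [_ [y /= + <-] ye] := inf_adherent e0 (right_reg_has_inf x).
rewrite in_itv/= andbT => xy.
near=> z.
have xz : x <= z by near: z; exact: nbhs_right_ge.
have zy : z < y by near: z; exact: nbhs_right_lt.
rewrite distrC ger0_norm ?subr_ge0; last exact: right_reg_nd.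
rewrite ltrBlDl; apply: le_lt_trans ye.
apply: ge_inf; first by have [] := right_reg_has_inf z.
by exists y => //=; rewrite in_itv/= andbT.
Unshelve. all: by end_near. Qed.

Definition right_reg_cumulative : cumulative R R :=
  HB.pack right_reg (isCumulative.Build R _ R right_reg right_reg_nd right_reg_rc).

End RightRegularization.

Section Stieltjes.
Variables (R : realType) (A : R -> R).
Hypothesis hA : bounded_variation 0 1 A.

Lemma pos_tv_nd : {in `[0, 1] &, nondecreasing_fun (fine \o pos_tv 0 A)}.
Proof. exact/fine_neg_tv_nondecreasing/bounded_variationN. Qed.

Lemma neg_tv_nd : {in `[0, 1] &, nondecreasing_fun (fine \o neg_tv 0 A)}.
Proof. exact: fine_neg_tv_nondecreasing. Qed.

(* Lebesgue-Stieltjes integral of [f] against dA over [0, 1], end points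
   included, through the Jordan decomposition of [A]. It is the
   Riemann-Stieltjes integral when [f] is continuous. *)
Definition stieltjes (f : R -> R) : R :=
  Rintegral (lebesgue_stieltjes_measure (right_reg_cumulative pos_tv_nd))
    (`[0, 1]%classic : set R) f
  - Rintegral (lebesgue_stieltjes_measure (right_reg_cumulative neg_tv_nd))
    (`[0, 1]%classic : set R) f.

End Stieltjes.

Definition sup_norm {R : realType} {T : Type} (D : set T) (f : T -> R) : R :=
  sup [set `|f x| | x in D].

(* Functions on [-r, 0] are functions on the subtype of [R], with the subtype
   topology. *)
Definition delay_itv {R : realType} (r : R) : set R := `[- r, 0]%classic.

Definition history {R : realType} (r : R) (u : R -> R) (t : R) :
    delay_itv r -> R :=
  fun theta => u (t + set_val theta).

Section Equation.
Variables (R : realType) (r : R) (psi : R -> R) (k : R -> R -> R) (g : R -> R).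
Variables (F : R -> (delay_itv r -> R) -> R) (gamma : R -> R).
Variables (A : R -> R) (hA : bounded_variation 0 1 A).
Variables (Phi : R -> R) (a b c1 c2 : R).

Definition kernelA (s : R) : R := stieltjes hA (fun t => k t s).

Definition hypC1 : Prop :=
  {within `[- r, 1], continuous psi} /\
  (forall t, 0 <= t <= 1 -> psi t = 0).

(* Joint measurability is with respect to Borel sets in [t], as integrating
   in [t] against dA requires, and Lebesgue measurable sets in [s]. *)
Definition hypC2 : Prop :=
  [/\ @measurable_fun _ _ (measurableTypeR R * lebesgueR R)%type R
        (`[- r, 1] `*` `[0, 1]) (fun p => k p.1 p.2),
      forall t, - r <= t <= 0 -> ae_on 0 1 (fun s => k t s = 0)
    & forall tb, 0 <= tb <= 1 ->
        ae_on 0 1 (fun s =>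
          `|k t s - k tb s| @[t --> within `[- r, 1] (nbhs tb)] --> (0 : R))].

Definition hypC3 : Prop :=
  [/\ [/\ 0 < a, a <= b & b <= 1],
      lebesgue_measurable_fun `[0, 1] Phi /\ ae_on 0 1 (fun s => 0 <= Phi s),
      0 < c1 <= 1,
      forall t, 0 <= t <= 1 -> ae_on 0 1 (fun s => `|k t s| <= Phi s)
    & forall t, a <= t <= b -> ae_on 0 1 (fun s => c1 * Phi s <= k t s)].

Definition hypC4 : Prop :=
  [/\ lebesgue_measurable_fun `[0, 1] g,
      ae_on 0 1 (fun s => 0 <= g s),
      lambda.-integrable (`[0, 1]%classic : set R)
        (fun s => (g s * Phi s)%:E)
    & 0 < integ a b (fun s => Phi s * g s)].

Definition hypC5 : Prop :=
  [/\ forall (t : R) (phi : delay_itv r -> R),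
        0 <= t <= 1 -> continuous phi -> 0 <= F t phi,
      forall phi : delay_itv r -> R, continuous phi ->
        lebesgue_measurable_fun `[0, 1] (fun t => F t phi),
      ae_on 0 1 (fun t => forall phi : delay_itv r -> R, continuous phi ->
        forall e : R, 0 < e -> exists2 d : R, 0 < d &
          forall phi' : delay_itv r -> R, continuous phi' ->
            sup_norm setT (phi' \- phi) < d -> `|F t phi' - F t phi| < e)
    & forall rho : R, 0 < rho -> exists varphi : R -> R,
        [/\ lebesgue_measurable_fun `[0, 1] varphi,
            exists M : R, ae_on 0 1 (fun t => `|varphi t| <= M)
          & forall phi : delay_itv r -> R,
              continuous phi -> sup_norm setT phi <= rho ->
              ae_on 0 1 (fun t => F t phi <= varphi t)]].

(* That [A] is of bounded variation is [hA]. *)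
Definition hypC6 : Prop := ae_on 0 1 (fun s => 0 <= kernelA s).

Definition hypC7 : Prop :=
  [/\ {within `[- r, 1], continuous gamma} /\
        (exists2 t, - r <= t <= 1 & gamma t != 0),
      forall t, - r <= t <= 0 -> gamma t = 0,
      0 <= stieltjes hA gamma < 1,
      0 < c2 <= 1
    & forall t, a <= t <= b -> c2 * sup_norm `[0, 1] gamma <= gamma t].

Definition hypC8 : Prop := 0 < r < b - a.

Definition cst_c : R := Num.min c1 c2.

Definition K0 : set (R -> R) := [set u |
  [/\ {within `[- r, 1], continuous u},
      forall t, - r <= t <= 0 -> u t = 0,
      forall t, a <= t <= b -> cst_c * sup_norm `[- r, 1] u <= u t
    & 0 <= stieltjes hA u]].

Definition Kpsi : set (R -> R) := [set psi \+ v | v in K0].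

(* [inv_m] and [inv_M] are 1/m and 1/M(a,b); [F_up] and [F_low] are
   F^(-rho,rho) and F_(rho,rho/c). [F_up] may be infinite, but the convention
   +oo * 0 = 0 does no harm in [I1]: [hypC3] and [hypC4] make [inv_m] positive. *)
Definition inv_m : \bar R := ereal_sup [set
  (integ 0 1 (fun s => `|k t s| * g s)
   + `|gamma t| / (1 - stieltjes hA gamma)
     * integ 0 1 (fun s => kernelA s * g s))%:E | t in `[0, 1]].

Definition inv_M : \bar R := ereal_inf [set
  (integ (a + r) b (fun s => k t s * g s)
   + gamma t / (1 - stieltjes hA gamma)
     * integ (a + r) b (fun s => kernelA s * g s))%:E | t in `[a, b]].

Definition F_up (rho : R) : \bar R := ereal_sup [set x |
  exists (t : R) (phi : delay_itv r -> R), [/\ 0 <= t <= 1, continuous phi,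
    sup_norm setT phi <= rho & x = (F t phi / rho)%:E]].

Definition F_low (rho : R) : \bar R := ereal_inf [set x |
  exists (t : R) (phi : delay_itv r -> R), [/\ a <= t <= b, continuous phi,
    forall theta, rho <= phi theta <= rho / cst_c & x = (F t phi / rho)%:E]].

Definition norm_psi : R := sup_norm `[- r, 0] psi.

Definition I1 (rho : R) : Prop :=
  norm_psi < rho /\ (F_up rho * inv_m < 1)%E.

Definition I0 (rho : R) : Prop := (1 < F_low rho * inv_M)%E.

Definition solution (u : R -> R) : Prop :=
  forall t, - r <= t <= 1 ->
    u t = psi t + integ 0 1 (fun s => k t s * g s * F s (history u s))
          + gamma t * stieltjes hA u.

Definition differ (u v : R -> R) : Prop :=
  exists2 t, - r <= t <= 1 & u t != v t.

Definition nontrivial_solution (u : R -> R) : Prop :=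
  [/\ Kpsi u, solution u & differ u psi].

Definition at_least_solutions (n : nat) : Prop :=
  exists u : 'I_n -> R -> R,
    (forall i, nontrivial_solution (u i)) /\
    (forall i j, i != j -> differ (u i) (u j)).

Definition S1 : Prop := exists rho1 rho2 : R,
  [/\ 0 < rho1 /\ 0 < rho2, norm_psi < rho2, rho1 / cst_c < rho2
    & I0 rho1 /\ I1 rho2].

Definition S2 : Prop := exists rho1 rho2 : R,
  [/\ 0 < rho1 /\ 0 < rho2, norm_psi < rho1, rho1 < rho2
    & I1 rho1 /\ I0 rho2].

Definition S3 : Prop := exists rho1 rho2 rho3 : R,
  [/\ [/\ 0 < rho1, 0 < rho2 & 0 < rho3],
      norm_psi < rho2,
      rho1 / cst_c < rho2 /\ rho2 < rho3
    & [/\ I0 rho1, I1 rho2 & I0 rho3]].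

Definition S4 : Prop := exists rho1 rho2 rho3 : R,
  [/\ [/\ 0 < rho1, 0 < rho2 & 0 < rho3],
      norm_psi < rho1 /\ rho1 < rho2,
      rho2 / cst_c < rho3
    & [/\ I1 rho1, I0 rho2 & I1 rho3]].

Definition S5 : Prop := exists rho1 rho2 rho3 rho4 : R,
  [/\ [/\ 0 < rho1, 0 < rho2, 0 < rho3 & 0 < rho4],
      norm_psi < rho2,
      [/\ rho1 / cst_c < rho2, rho2 < rho3 & rho3 / cst_c < rho4]
    & [/\ I0 rho1, I1 rho2, I0 rho3 & I1 rho4]].

Definition S6 : Prop := exists rho1 rho2 rho3 rho4 : R,
  [/\ [/\ 0 < rho1, 0 < rho2, 0 < rho3 & 0 < rho4],
      norm_psi < rho1 /\ rho1 < rho2,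
      rho2 / cst_c < rho3 /\ rho3 < rho4
    & [/\ I1 rho1, I0 rho2, I1 rho3 & I0 rho4]].

End Equation.

(* Main.v *)
(* Write u = psi + v and solve for alpha[u]: the equation becomes v = S v with S
   a compact continuous self-map of the cone K_0. If I^1_rho holds, then
   |S v| < rho whenever |v| <= rho; if I^0_rho holds, then S v > rho on [a, b]
   whenever the minimum of v over [a, b] is rho. Instead of a fixed point index,
   both existence statements come from Schauder's theorem. When the I^0 level is
   below the I^1 level, it is applied to S followed by the least push along gamma
   that lifts the minimum over [a, b] to the I^0 level. When the I^1 level is
   below, S + eps gamma is precomposed with the radial projection onto the shell
   between the levels, the height of the result at a is reflected about the
   height of the projected point, which turns the expansion into a compression,
   and eps tends to 0. Schauder's theorem follows from Scarf's lemma on dominant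
   sets. Solutions are told apart by their norms and by their minima over [a, b]. *)

(* Schauder's theorem needs a convex set, and in a cone the region outside a ball is in general not
   convex. In the compressive case this is harmless, because the lower barrier, [v] at least the
   [I0] level on [a, b], is a convex condition. In the expansive case the map runs instead on
   functions whose height at a lies between two positive constants: since c|v| <= v(a) <= |v|, this
   convex condition keeps the norm bounded and away from 0, and both barriers are recovered
   afterwards from the fixed point equation. Rescaling an image to a prescribed height at a requires
   a positive height there, and S v may vanish; this is the purpose of eps gamma. The delay enters
   twice. The functions [psi] and v are never nonzero at the same time, so |psi + v| is the larger
   of the two norms, whence the condition rho > |psi|. For s in [a + r, b] the window [s - r, s]
   lies in [a, b], where v is pinched between rho and rho/c; this is why 1/M(a,b) integrates over
   [a + r, b] only. *)
From mathcomp Require Import all_boot.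
Set Implicit Arguments.
Unset Strict Implicit.
Unset Printing Implicit Defensive.

(** * Scarf's lemma *)

Section Scarf.
Variables (X I : finType) (h : I -> X -> nat) (x0 : X).
Hypothesis h_inj : forall i, injective (h i).

(** Each injective [h i] stands for a total order on [X]. For nonempty [S], dominance says that no
    point of [X] lies strictly above the lowest points of [S] in all the orders of [T] at once. *)
Definition dominant (S : {set X}) (T : {set I}) : bool :=
  [forall x, [exists i in T, [forall y in S, h i x <= h i y]]].

Lemma dominantP (S : {set X}) (T : {set I}) :
  reflect (forall x, exists2 i, i \in T & forall y, y \in S -> h i x <= h i y)
          (dominant S T).
Proof.
apply: (iffP forallP) => [H x|H x].
  by have /exists_inP[i iT /forall_inP iS] := H x; exists i.
by have [i iT iS] := H x; apply/exists_inP; exists i => //; apply/forall_inP.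
Qed.

Lemma dominant_sub (S S' : {set X}) (T T' : {set I}) :
  S' \subset S -> T \subset T' -> dominant S T -> dominant S' T'.
Proof.
move=> sS sT /dominantP H; apply/dominantP => x; have [i iT iS] := H x.
exists i; first exact: (subsetP sT).
by move=> y yS; apply: iS; exact: (subsetP sS).
Qed.

Definition lowest (S : {set X}) (i : I) : X :=
  odflt x0 [pick y in S | [forall z in S, h i y <= h i z]].

Lemma lowestP (S : {set X}) (i : I) : S != set0 ->
  lowest S i \in S /\ forall z, z \in S -> h i (lowest S i) <= h i z.
Proof.
case/set0Pn => y yS; rewrite /lowest; case: pickP => [z /andP[zS /forall_inP]//|].
case: (@arg_minnP _ y (fun z => z \in S) (h i) yS) => z zS zmin /(_ z) /=.
by rewrite zS/= => /negP[]; apply/forall_inP => w wS; exact: zmin.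
Qed.

Lemma lowest_eq (S : {set X}) (i : I) (x : X) : x \in S ->
  (forall z, z \in S -> h i x <= h i z) -> lowest S i = x.
Proof.
move=> xS xmin; have S0 : S != set0 by apply/set0Pn; exists x.
have [mS mmin] := lowestP i S0.
by apply: (@h_inj i); apply/eqP; rewrite eqn_leq mmin// xmin.
Qed.

(** A point of [S] can only satisfy dominance by being the lowest of [S] for some index of [T].
    Hence #|S| <= #|T|; rooms and doors are the cases of defect 0 and 1. *)
Lemma dominant_lowest (S : {set X}) (T : {set I}) : S != set0 -> dominant S T ->
  lowest S @: T = S.
Proof.
move=> S0 /dominantP D; apply/eqP; rewrite eqEsubset; apply/andP; split.
  by apply/subsetP => _ /imsetP[i iT ->]; have [] := lowestP i S0.
apply/subsetP => x xS; have [i iT ixS] := D x.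
by apply/imsetP; exists i => //; rewrite (lowest_eq xS ixS).
Qed.

Lemma lowestU1 (S : {set X}) (i : I) (x : X) : S != set0 ->
  lowest (x |: S) i != x -> lowest (x |: S) i = lowest S i.
Proof.
move=> S0 nx; have S0' : x |: S != set0 by apply/set0Pn; exists x; rewrite setU11.
have [mS mmin] := lowestP i S0'.
symmetry; apply: lowest_eq; first by move: mS; rewrite in_setU1 (negbTE nx).
by move=> z zS; apply: mmin; rewrite in_setU1 zS orbT.
Qed.

Definition room (p : {set X} * {set I}) : bool :=
  dominant p.1 p.2 && (#|p.1| == #|p.2|).

Definition door (p : {set X} * {set I}) : bool :=
  dominant p.1 p.2 && (#|p.1|.+1 == #|p.2|).

(** Rooms are the cells and doors their facets; a facet arises either by losing a point or by
    gaining an index. *)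
Definition adj (d p : {set X} * {set I}) : bool :=
  [exists x in p.1, d == (p.1 :\ x, p.2)] ||
  [exists i, (i \notin p.2) && (d == (p.1, i |: p.2))].

Section Door.
Variables (S : {set X}) (T : {set I}).
Hypotheses (S0 : S != set0) (domST : dominant S T) (cST : #|S|.+1 = #|T|).

(* The rooms reached from the door [(S, T)] by dropping the index [l], or by
   adding a point that is the lowest one for [l]. *)
Definition pivot (l : I) : {set {set X} * {set I}} :=
  [set p | room p & (p == (S, T :\ l)) ||
    [exists x, [&& x \notin S, p == (x |: S, T) & lowest (x |: S) l == x]]].

Lemma room_lowest_inj (S' : {set X}) (T' : {set I}) : S' != set0 ->
  room (S', T') -> {in T' &, injective (lowest S')}.
Proof.
move=> S0' /andP[/= D /eqP c]; apply/imset_injP.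
by rewrite (dominant_lowest S0' D) c.
Qed.

Lemma pivot_card1 (l : I) : l \in T ->
  {in T :\ l &, injective (lowest S)} -> #|pivot l| = 1.
Proof.
move=> lT inj.
have cT : #|T :\ l| = #|S| by have := cST; rewrite (cardsD1 l T) lT => -[].
have above x : x \notin S -> room (x |: S, T) -> lowest (x |: S) l = x ->
    forall l', l' \in T :\ l ->
    lowest (x |: S) l' = lowest S l' /\ h l' (lowest S l') < h l' x.
  move=> xS rx lx l'; rewrite in_setD1 => /andP[l'l l'T].
  have S0' : x |: S != set0 by apply/set0Pn; exists x; rewrite setU11.
  have nx : lowest (x |: S) l' != x.
    apply: contra l'l => /eqP e; apply/eqP.
    by apply: (room_lowest_inj S0' rx) => //; rewrite e.
  have e := lowestU1 S0 nx; split => //.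
  have [_ /(_ x (setU11 _ _))] := lowestP l' S0'.
  rewrite e leq_eqVlt => /orP[/eqP /h_inj e'|//].
  by move: nx; rewrite e e' eqxx.
pose M := [set x | [forall l' in T :\ l, h l' (lowest S l') < h l' x]].
have dM : dominant S (T :\ l) = (M == set0).
  apply/idP/eqP => [/dominantP D|M0].
    apply/setP => x; rewrite !inE; apply/negP => /forall_inP xM.
    have [l' l'T] := D x; have [mS _] := lowestP l' S0.
    by move=> /(_ _ mS); rewrite leqNgt xM.
  apply/dominantP => x; have /negbT : x \in M = false by rewrite M0 inE.
  rewrite inE negb_forall => /existsP[l']; rewrite negb_imply => /andP[l'T].
  rewrite -leqNgt => xl'; exists l' => // y yS; apply: (leq_trans xl').
  by have [_] := lowestP l' S0; apply.
have [M0|/set0Pn[y yM]] := boolP (M == set0).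
  suff -> : pivot l = [set (S, T :\ l)] by rewrite cards1.
  apply/setP => p; rewrite !inE; apply/andP/eqP => [[rp /orP[/eqP//|]]|->].
    move=> /existsP[x /and3P[xS /eqP ep /eqP lx]]; rewrite ep in rp.
    have: x \in M.
      by rewrite inE; apply/forall_inP => l' l'T; have [] := above x xS rp lx l' l'T.
    by rewrite (eqP M0) inE.
  by rewrite eqxx /room/= dM M0 cT eqxx.
have [x xM xmax] := @arg_maxnP _ y (fun z => z \in M) (h l) yM.
have /forall_inP xl : [forall l' in T :\ l, h l' (lowest S l') < h l' x].
  by move: xM; rewrite /= inE.
have xS : x \notin S.
  apply/negP => xS.
  have : x \in lowest S @: (T :\ l).
    suff -> : lowest S @: (T :\ l) = S by [].
    apply/eqP; rewrite eqEcard card_in_imset// cT leqnn andbT.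
    by apply/subsetP => _ /imsetP[l' _ ->]; have [] := lowestP l' S0.
  by case/imsetP => l' l'T e; have := xl l' l'T; rewrite e ltnn.
have S0' : x |: S != set0 by apply/set0Pn; exists x; rewrite setU11.
(* The door is dominant and [x] is above [S] for every other index, so only [l] can witness
   dominance at [x]. *)
have xlow : h l x <= h l (lowest S l).
  have [l' l'T xl'] := dominantP _ _ domST x; have [mS _] := lowestP l' S0.
  have [e|ne] := eqVneq l' l; first by rewrite -e; exact: xl'.
  by have := xl l' (introT setD1P (conj ne l'T)); rewrite ltnNge xl'.
have lx : lowest (x |: S) l = x.
  apply: lowest_eq; first exact: setU11.
  move=> z; rewrite in_setU1 => /orP[/eqP->//|zS]; apply: (leq_trans xlow).
  by have [_] := lowestP l S0; apply.
have l'x l' : l' \in T :\ l -> lowest (x |: S) l' = lowest S l'.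
  move=> l'T; apply: lowest_eq.
    by rewrite in_setU1; have [->] := lowestP l' S0; rewrite orbT.
  move=> z; rewrite in_setU1 => /orP[/eqP->|zS]; first exact/ltnW/xl.
  by have [_] := lowestP l' S0; apply.
have rx : room (x |: S, T).
  rewrite /room/= cardsU1 xS add1n cST eqxx andbT; apply/dominantP => z.
  have [zM|] := boolP (z \in M).
    exists l => // w wS; apply: (leq_trans (xmax z zM)).
    by rewrite -{1}lx; have [_] := lowestP l S0'; apply.
  rewrite inE negb_forall => /existsP[l']; rewrite negb_imply => /andP[l'T].
  rewrite -leqNgt => zl'; exists l'; first by case/setD1P: l'T.
  move=> w wS; apply: (leq_trans zl'); rewrite -l'x//.
  by have [_] := lowestP l' S0'; apply.
suff -> : pivot l = [set (x |: S, T)] by rewrite cards1.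
apply/setP => p; rewrite !inE; apply/andP/eqP => [[rp /orP[/eqP ep|]]|->].
    by move: rp; rewrite ep /room/= dM => /andP[/eqP M0]; move: yM; rewrite M0 inE.
  move=> /existsP[x' /and3P[x'S /eqP ep /eqP lx']]; rewrite ep; rewrite ep in rp.
  suff -> : x' = x by [].
  have ab := above x' x'S rp lx'.
  have S0'' : x' |: S != set0 by apply/set0Pn; exists x'; rewrite setU11.
  apply: (@h_inj l); apply/eqP; rewrite eqn_leq; apply/andP; split.
    by apply: xmax; rewrite /= inE; apply/forall_inP => l' /ab[].
  have /andP[/= /dominantP D _] := rp.
  have [l' l'T xl'] := D x; have [e|ne] := eqVneq l' l.
    by rewrite -e; apply: xl'; exact: setU11.
  have l'T' := introT setD1P (conj ne l'T).
  have [e _] := ab _ l'T'; have := xl _ l'T'; have [+ _] := lowestP l' S0''.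
  by move=> /xl'; rewrite e leqNgt => /negbTE ->.
by split=> //; apply/orP; right; apply/existsP; exists x; rewrite xS eqxx lx eqxx.
Qed.

(** [lowest S] maps #|S| + 1 indices onto [S], so exactly one pair of indices collides. A room must
    resolve the collision, by a pivot on one index of the pair or on the other. *)
Lemma door_card_rooms : #|[set p | room p & adj (S, T) p]| = 2.
Proof.
have imS := dominant_lowest S0 domST.
have /dinjectivePn[i iT [j /andP[/= ji jT] eij]] : ~~ dinjectiveb (lowest S) (mem T).
  apply/negP => /dinjectiveP/card_in_imset; rewrite imS -cST => /eqP.
  by rewrite -[#|S|]addn0 -addnS eqn_add2l.
have rem_inj l l' : l \in T -> l' \in T -> l' != l -> lowest S l = lowest S l' ->
    {in T :\ l &, injective (lowest S)}.
  move=> lT l'T ll' e; apply/imset_injP.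
  have -> : #|T :\ l| = #|S| by have := cST; rewrite (cardsD1 l T) lT => -[].
  suff -> : lowest S @: (T :\ l) = S by [].
  rewrite -{2}imS; apply/eqP; rewrite eqEsubset imsetS ?subsetDl//=.
  apply/subsetP => _ /imsetP[q qT ->].
  have [eq|nq] := eqVneq q l; last by apply: imset_f; rewrite in_setD1 nq.
  by rewrite eq e; apply: imset_f; rewrite in_setD1 ll'.
have injli := rem_inj i j iT jT ji eij.
have injlj : {in T :\ j &, injective (lowest S)}.
  by apply: (rem_inj j i) => //; rewrite eq_sym.
have twoP l l' : l \in T -> l' \in T -> l' != l -> lowest S l = lowest S l' ->
    (l == i) || (l == j).
  move=> lT l'T ll' e; apply/negPn/negP; rewrite negb_or => /andP[li lj].
  have [e'|l'i] := eqVneq l' i.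
    have : l = j by apply: injli; rewrite ?inE ?li ?ji// e e' eij.
    by apply/eqP.
  have : l = l' by apply: injli; rewrite ?inE ?li ?l'i.
  by move/eqP; rewrite eq_sym (negbTE ll').
have -> : [set p | room p & adj (S, T) p] = pivot i :|: pivot j.
  apply/setP => p; rewrite !inE -andb_orr; apply/andb_id2l => rp.
  apply/idP/idP.
    move=> /orP[/exists_inP[x xp /eqP[eS eT]]|/existsP[l /andP[lp /eqP[eS eT]]]].
      have ep : p = (x |: S, T) by rewrite eS eT setD1K//; case: (p).
      have xS : x \notin S by rewrite eS setD11.
      have S0' : x |: S != set0 by apply/set0Pn; exists x; rewrite setU11.
      rewrite ep in rp; have /andP[/= /dominantP D _] := rp.
      have [l lT lx] := D x; have lox := lowest_eq (setU11 _ _) lx.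
      suff: (l == i) || (l == j).
        by case/orP => /eqP e; rewrite -e; apply/orP; [left|right]; apply/orP;
          right; apply/existsP; exists x; rewrite xS ep eqxx lox eqxx.
      apply/negPn/negP; rewrite negb_or => /andP[li lj].
      have nl q : q \in T -> l != q -> lowest (x |: S) q = lowest S q.
        move=> qT lq; apply: lowestU1 => //; apply: contra lq => /eqP e.
        by apply/eqP; apply: (room_lowest_inj S0' rp) => //; rewrite e.
      have : i = j by apply: (room_lowest_inj S0' rp) => //; rewrite !nl.
      by move/eqP; rewrite eq_sym (negbTE ji).
    have ep : p = (S, T :\ l) by rewrite eS eT setU1K//; case: (p).
    have lT : l \in T by rewrite eT setU11.
    rewrite ep in rp; have /andP[/= D _] := rp.
    have [l' l'T e] : exists2 l', l' \in T :\ l & lowest S l = lowest S l'.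
      have : lowest S l \in lowest S @: (T :\ l).
        by rewrite (dominant_lowest S0 D); have [] := lowestP l S0.
      by case/imsetP => l' ? ?; exists l'.
    case/setD1P: l'T => l'l l'T.
    by case/orP: (twoP l l' lT l'T l'l e) => /eqP <-; rewrite ep eqxx ?orbT.
  move=> H; have : exists2 l, l \in T & (p == (S, T :\ l)) ||
    [exists x, [&& x \notin S, p == (x |: S, T) & lowest (x |: S) l == x]].
    by case/orP: H; [exists i|exists j].
  case=> l lT /orP[/eqP ->|/existsP[x /and3P[xS /eqP -> _]]].
    apply/orP; right; apply/existsP; exists l.
    by rewrite /= setD11 setD1K// eqxx.
  apply/orP; left; apply/exists_inP; exists x; first exact: setU11.
  by rewrite /= setU1K.
have dis : pivot i :&: pivot j = set0.
  apply/setP => p; rewrite !inE; apply/negbTE/negP => /andP[/andP[rp +] /andP[_]].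
  have ne l (x : X) : x \notin S -> (S, T :\ l) <> (x |: S, T) :> {set X} * {set I}.
    by move=> xS [] /setP/(_ x); rewrite setU11 (negbTE xS).
  move=> /orP[/eqP ->|/existsP[x /and3P[xS /eqP ep /eqP lx]]].
    case/orP => [/eqP[] /setP/(_ i)|/existsP[x /and3P[xS /eqP /(ne _ _ xS)//]]].
    by rewrite !inE eqxx/= eq_sym ji iT.
  rewrite {}ep in rp *; case/orP => [/eqP/esym/(ne _ _ xS)//|].
  case/existsP => y /and3P[yS /eqP[] exy /eqP ly].
  have S0' : x |: S != set0 by apply/set0Pn; exists x; rewrite setU11.
  have exy' : x = y.
    by apply/eqP; have := setU11 x S; rewrite exy !inE (negbTE xS) orbF.
  have : i = j.
    by apply: (room_lowest_inj S0' rp) => //; rewrite lx exy' ly.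
  by move/eqP; rewrite eq_sym (negbTE ji).
by rewrite cardsU dis cards0 subn0 !pivot_card1.
Qed.

End Door.

(** A door without points opens on one side only, towards the highest point for [i]; adding an index
    to reach it would mean starting from no index, which is never dominant. *)
Lemma outer_door_card_rooms (i : I) :
  #|[set p | room p & adj (set0, [set i]) p]| = 1.
Proof.
have [x _ xmax] := @arg_maxnP _ x0 predT (h i) isT.
suff -> : [set p | room p & adj (set0, [set i]) p] = [set ([set x], [set i])].
  by rewrite cards1.
apply/setP => -[S T]; rewrite !inE; apply/andP/eqP => [[rp /orP[|]]|[-> ->]].
- case/exists_inP => y /= yS /eqP[eS eT].
  have eS' : S = [set y] by rewrite -(setD1K yS) -eS setU0.
  move: rp; rewrite eS' -eT => /andP[/= /dominantP D _]; have [l] := D x.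
  rewrite inE => /eqP -> /(_ y (set11 _)) xy.
  suff -> : y = x by [].
  by apply: (@h_inj i); apply/eqP; rewrite eqn_leq xy andbT; exact: xmax.
- case/existsP => j /andP[/= jT /eqP[eS eT]].
  have T0 : T = set0.
    apply/setP => l; rewrite inE; apply/negP => lT.
    have : l \in j |: T by rewrite setU1r.
    rewrite -eT inE => /eqP li; have : j \in [set i] by rewrite eT setU11.
    by rewrite inE => /eqP ji; move: jT; rewrite ji -li lT.
  move: rp => /andP[/= /dominantP D _]; have [l] := D x.
  by rewrite T0 inE.
- split; last first.
    apply/orP; left; apply/exists_inP; exists x => /=; first exact: set11.
    by rewrite setDv.
  rewrite /room/= !cards1 eqxx andbT; apply/dominantP => y.
  by exists i; rewrite ?set11// => z; rewrite inE => /eqP ->; exact: xmax.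
Qed.

(** * Colourful doors and the parity argument *)

Variables (col : X -> I) (i0 : I).

Definition colourful_door (d : {set X} * {set I}) : bool :=
  (i0 \in d.2) && (col @: d.1 == d.2 :\ i0).

Lemma card_adj (p : {set X} * {set I}) :
  #|[set d | adj d p & colourful_door d]| =
  #|[set x in p.1 | colourful_door (p.1 :\ x, p.2)]| +
  #|[set i | i \notin p.2 & colourful_door (p.1, i |: p.2)]|.
Proof.
set U := [set x in _ | _]; set V := [set i | (_ \notin _) && _].
have -> : [set d | adj d p & colourful_door d] =
    [set (p.1 :\ x, p.2) | x in U] :|: [set (p.1, i |: p.2) | i in V].
  apply/setP => d; rewrite !inE; apply/idP/idP.
    case/andP => /orP[/exists_inP[x xp /eqP ed]|/existsP[i /andP[ip /eqP ed]]] cd.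
      by apply/orP; left; apply/imsetP; exists x => //; rewrite inE xp -ed.
    by apply/orP; right; apply/imsetP; exists i => //; rewrite inE ip -ed.
  case/orP => /imsetP[q]; rewrite inE => /andP[qp cq] ->; rewrite cq andbT.
    by apply/orP; left; apply/exists_inP; exists q.
  by apply/orP; right; apply/existsP; exists q; rewrite qp eqxx.
rewrite cardsU (_ : _ :&: _ = set0) ?cards0 ?subn0; last first.
  apply/setP => d; rewrite !inE; apply/negbTE/negP => /andP[].
  move=> /imsetP[x + ->] /imsetP[i + [+ _]]; rewrite !inE => /andP[xp _] _.
  by move/setP/(_ x); rewrite !inE eqxx xp.
congr (_ + _); apply: card_in_imset => q q'; rewrite !inE.
  move=> /andP[qp _] /andP[q'p _] [] /setP/(_ q); rewrite !inE eqxx qp andbT/=.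
  by rewrite andbT => /esym/negbFE/eqP.
move=> /andP[qp _] /andP[q'p _] [] /setP/(_ q); rewrite !inE eqxx (negbTE qp) orbF.
by rewrite orbF => /esym/eqP.
Qed.

Lemma imset_col_D1 (S : {set X}) (x : X) : x \in S -> {in S &, injective col} ->
  col @: (S :\ x) = (col @: S) :\ col x.
Proof.
move=> xS inj; apply/setP => i; rewrite in_setD1; apply/imsetP/andP.
  case=> y /setD1P[yx yS] ->; split; last exact: imset_f.
  by apply: contra yx => /eqP /inj ->.
case=> ix /imsetP[y yS e]; exists y => //; apply/setD1P; split=> //.
by apply: contra ix => /eqP <-; rewrite e.
Qed.

(** A room coloured exactly by its indices has one colourful door: drop the point coloured [i0], or
    add [i0] if it is not an index. Any other room has none or two: either one colour lies outside
    [T], to be added as an index or lost with its point, or two points share a colour and either of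
    them may go. *)
Lemma room_odd_doors (p : {set X} * {set I}) : room p ->
  odd #|[set d | adj d p & colourful_door d]| = (col @: p.1 == p.2).
Proof.
case: p => S T /andP[_ /= /eqP cST]; rewrite card_adj /=.
set U := [set x in _ | _]; set V := [set i | _ & _].
have V0 : i0 \notin T -> U = set0 /\ V = if col @: S == T then [set i0] else set0.
  move=> i0T; split.
    by apply/setP => x; rewrite !inE /colourful_door/= (negbTE i0T)/= andbF.
  apply/setP => i; have [->|ni] := eqVneq i i0.
    rewrite !inE /colourful_door/= i0T setU11/= setU1K//.
    by case: ifP => _; rewrite inE ?eqxx.
  rewrite !inE /colourful_door/= in_setU1 (negbTE i0T) orbF eq_sym (negbTE ni)/= andbF.
  by case: ifP => _; rewrite !inE ?(negbTE ni).
have [i0T|/V0[-> ->]] := boolP (i0 \in T); last first.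
  by case: ifP => _; rewrite !cards0 ?cards1.
have cT : #|T| = #|T :\ i0|.+1 by rewrite (cardsD1 i0 T) i0T.
have UE x : (x \in U) = (x \in S) && (col @: (S :\ x) == T :\ i0).
  by rewrite inE /colourful_door/= i0T.
have VE i : (i \in V) = (i \notin T) && (col @: S == i |: (T :\ i0)).
  rewrite inE /colourful_door/= setU1r//; case: (boolP (i \in T)) => //= iT.
  congr (_ == _); apply/setP => j; rewrite !inE.
  have [->|] := eqVneq j i; rewrite ?orbT//= andbT.
  by apply/eqP => e; move: iT; rewrite e i0T.
have inj_of (B : {set I}) : col @: S = B -> #|B| = #|S| -> {in S &, injective col}.
  by move=> e c; apply/imset_injP; rewrite e c.
have [eST|neST] := eqVneq (col @: S) T.
  have inj := inj_of _ eST (esym cST).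
  have -> : V = set0.
    apply/setP => i; rewrite VE inE; apply/negbTE/negP => /andP[iT /eqP e].
    by move: iT; rewrite -eST e setU11.
  have := i0T; rewrite -{1}eST => /imsetP[x xS ex].
  suff -> : U = [set x] by rewrite cards1 cards0.
  apply/setP => y; rewrite UE inE; apply/andP/eqP => [[yS]|->]; last first.
    by rewrite imset_col_D1// eST ex.
  rewrite imset_col_D1// eST => /eqP /setP/(_ i0); rewrite !inE eqxx i0T/= andbT.
  by move/negbT; rewrite negbK => /eqP e; apply: inj => //; rewrite -e.
have [/set0Pn[i iV]|] := boolP (V != set0).
  move: (iV); rewrite VE => /andP[iT /eqP e].
  have cc : #|i |: T :\ i0| = #|S|.
    by rewrite cardsU1 !inE (negbTE iT) andbF/= cST cT.
  have inj := inj_of _ e cc.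
  have -> : V = [set i].
    apply/setP => j; rewrite VE inE; apply/andP/eqP => [[jT]|->]; last by rewrite e eqxx.
    rewrite e => /eqP /setP/(_ j); rewrite !inE eqxx (negbTE jT) andbF !orbF.
    by move/eqP.
  have : i \in col @: S by rewrite e setU11.
  case/imsetP => x xS ex.
  suff -> : U = [set x] by rewrite !cards1.
  have iTi : i \notin T :\ i0 by rewrite !inE (negbTE iT) andbF.
  apply/setP => y; rewrite UE inE; apply/andP/eqP => [[yS]|->]; last first.
    by rewrite imset_col_D1// e -ex setU1K.
  rewrite imset_col_D1// e => /eqP /setP/(_ i); rewrite !inE eqxx (negbTE iT)/= !andbF andbT.
  by move/negbT; rewrite negbK => /eqP e'; apply: inj => //; rewrite -e'.
rewrite negbK => /eqP V0'; rewrite V0' cards0 addn0.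
have [->|/set0Pn[x]] := eqVneq U set0; first by rewrite cards0.
rewrite UE => /andP[xS /eqP ex].
have eS : col @: S = col x |: (T :\ i0).
  by rewrite -{1}(setD1K xS) imsetU1 ex.
have cxT : col x \in T :\ i0.
  rewrite !inE; apply/andP; split.
    by apply: contra neST => /eqP e; rewrite eS e setD1K.
  apply/negPn/negP => cxT; suff: col x \in V by rewrite V0' inE.
  by rewrite VE cxT eS eqxx.
have injx : {in S :\ x &, injective col}.
  apply/imset_injP; rewrite ex -eqSS -cT -cST.
  by rewrite (cardsD1 x S) xS.
move: (cxT); rewrite -ex => /imsetP[x' /setD1P[x'x x'S] ex'].
suff -> : U = [set x; x'] by rewrite cards2 eq_sym x'x.
apply/setP => z; rewrite UE !inE; apply/idP/idP.
  case/andP => zS /eqP ez; apply/negPn/negP; rewrite negb_or => /andP[zx zx'].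
  have : col z \in col @: (S :\ z).
    by rewrite ez -ex imset_f// in_setD1 zx.
  case/imsetP => w /setD1P[wz wS] ew.
  have [wx|wx] := eqVneq w x.
    move: zx' => /eqP; apply; apply: injx; rewrite ?inE ?zx ?x'x//.
    by rewrite ew wx ex'.
  move: wz => /eqP; apply; apply: injx; rewrite ?inE ?zx ?wx//.
case/orP => /eqP ->; rewrite ?xS ?x'S/= ?ex//.
rewrite eqEcard; apply/andP; split; last first.
  rewrite -ex (card_in_imset injx).
  have -> : #|S :\ x| = #|S :\ x'|.
    by have := cardsD1 x S; rewrite xS (cardsD1 x' S) x'S !add1n => -[].
  have inj' : {in S :\ x' &, injective col}.
    move=> u v /setD1P[ux' uS] /setD1P[vx' vS] e.
    have [ux|ux] := eqVneq u x; have [vx|vx] := eqVneq v x; first by rewrite ux vx.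
    - move: vx' => /eqP; case; apply: injx; rewrite ?inE ?vx ?x'x//.
      by rewrite -e ux ex'.
    - move: ux' => /eqP; case; apply: injx; rewrite ?inE ?ux ?x'x//.
      by rewrite e vx ex'.
    - by apply: injx; rewrite ?inE ?ux ?vx.
  by rewrite (card_in_imset inj').
apply/subsetP => _ /imsetP[w /setD1P[wx' wS] ->].
have [->|wx] := eqVneq w x; first by [].
by rewrite -ex imset_f// in_setD1 wx.
Qed.

(** Incidences between rooms and colourful doors are counted in two ways. Every colourful door has
    two rooms except [(set0, [set i0])], which has one; the total is odd, so some room has an odd
    number of colourful doors. *)
Lemma scarf : exists S T, [/\ T != set0, dominant S T & col @: S = T].
Proof.
pose D := [set d | door d & colourful_door d].
pose N := \sum_(p | room p) #|[set d | adj d p & colourful_door d]|.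
have NE : N = \sum_(d in D) #|[set p | room p & adj d p]|.
  rewrite /N; under eq_bigr do rewrite -sum1_card.
  under [RHS]eq_bigr do rewrite -sum1_card.
  rewrite (exchange_big_dep (mem D)) /=; last first.
    move=> [S T] [S' T'] /andP[/= D' /eqP c]; rewrite !inE => /andP[+ ->]; rewrite andbT.
    case/orP => [/exists_inP[x /= xS /eqP[-> ->]]|/existsP[i /andP[/= iT /eqP[-> ->]]]].
      rewrite /door/= (dominant_sub _ _ D') ?subsetDl//=.
      by rewrite -c [in X in _ == X](cardsD1 x S) xS.
    rewrite /door/= (dominant_sub _ _ D') ?subsetU1//=.
    by rewrite cardsU1 iT c.
  apply: eq_bigr => d; rewrite inE => /andP[_ cd]; apply: eq_bigl => p.
  by rewrite !inE cd andbT.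
have oddN : odd N.
  have d0 : (set0, [set i0]) \in D.
    rewrite inE /door /colourful_door /= cards0 cards1 imset0 set11 setDv !eqxx !andbT.
    by apply/dominantP => x; exists i0; rewrite ?set11// => y; rewrite inE.
  rewrite NE (bigD1 (set0, [set i0]))//= outer_door_card_rooms.
  rewrite (eq_bigr (fun=> 2)) ?sum_nat_const ?oddD ?oddM ?andbF//.
  move=> [S T]; rewrite inE => /andP[/andP[/andP[/= D' /eqP c] /andP[/= i0T /eqP e]] ne].
  apply: door_card_rooms => //; apply: contra ne => /eqP S0.
  rewrite S0 imset0 in e; apply/eqP; congr (_, _) => //.
  by rewrite -(setD1K i0T) -e setU0.
have [p /andP[/andP[Dp /eqP c] /eqP e]] : exists p, room p && (col @: p.1 == p.2).
  apply/existsP; apply: contraT; rewrite negb_exists => /forallP H.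
  move: oddN; rewrite /N; elim/big_ind: _ => //.
    by move=> m n; rewrite oddD; case: (odd m); case: (odd n) => // _ /(_ isT).
  by move=> p rp; rewrite room_odd_doors// => e; have := H p; rewrite rp e.
exists p.1, p.2; split => //.
by move: Dp => /dominantP/(_ x0)[i ip _]; apply/set0Pn; exists i.
Qed.

End Scarf.

Require Import Defs.
From mathcomp Require Import all_order all_algebra.
From mathcomp Require Import all_classical all_reals all_analysis.
From mathcomp Require Import measurable_realfun ring lra zify.
Import Order.TTheory GRing.Theory Num.Theory.
Import numFieldNormedType.Exports.
Local Open Scope classical_set_scope.
Local Open Scope ring_scope.

(** * Schauder's fixed point theorem *)

Section Grid.
Variables (m N : nat).

Definition grid := {x : {ffun 'I_m.+1 -> 'I_N.+1} | (\sum_i (x i : nat) == N)%N}.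

Definition gcoord (x : grid) (i : 'I_m.+1) : nat := sval x i.

Lemma gcoord_sum (x : grid) : (\sum_i gcoord x i = N)%N.
Proof. exact/eqP/(svalP x). Qed.

Lemma grid_of (f : 'I_m.+1 -> nat) : (\sum_i f i = N)%N ->
  exists x : grid, forall i, gcoord x i = f i.
Proof.
move=> fN; have fi i : (f i < N.+1)%N by rewrite ltnS -fN (bigD1 i)//= leq_addr.
pose x := [ffun i => Ordinal (fi i)].
have xN : (\sum_i (x i : nat) == N)%N.
  by apply/eqP; rewrite -[RHS]fN; apply: eq_bigr => i _; rewrite ffunE.
by exists (exist _ x xN) => i; rewrite /gcoord/= ffunE.
Qed.

(** The corner [b] collects the lower bounds set by a dominant [S]. If its coordinates summed to
    less than N - (m + 1), raising those of [T] by one and putting the remainder on one index of [T]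
    would give a grid point strictly above all bounds, against dominance. So [S] lies in a simplex
    with at most m + 1 units to distribute above [b]. *)
Lemma grid_scarf (col : grid -> 'I_m.+1) :
  exists (S : {set grid}) (T : {set 'I_m.+1}) (b : 'I_m.+1 -> nat),
  [/\ S != finset.set0, (fun x => col x) @: S = T,
      (forall x i, x \in S -> b i <= gcoord x i)%N,
      (forall i, i \notin T -> b i = 0%N)
    & (N <= \sum_i b i + m.+1)%N].
Proof.
have [x0 _] : exists x : grid, forall i, gcoord x i = if i == ord0 then N else 0%N.
  by apply: grid_of; rewrite -big_mkcond big_pred1_eq.
(* The coordinate decides the order; the rank only breaks ties, to make the height injective. *)
pose h (i : 'I_m.+1) (x : grid) := (gcoord x i * #|{: grid}| + enum_rank x)%N.
have h_inj i : injective (h i).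
  move=> x y /(congr1 (modn^~ #|{: grid}|)); rewrite /h !modnMDl !modn_small//.
  by move/ord_inj/enum_rank_inj.
have hlt i x y : (gcoord x i < gcoord y i)%N -> (h i x < h i y)%N.
  move=> xy; rewrite /h; apply: (@leq_trans ((gcoord x i).+1 * #|{: grid}|)%N).
    by rewrite mulSn addnC ltn_add2r.
  by apply: leq_trans (leq_addr _ _); rewrite leq_mul2r xy orbT.
have [S [T [T0 D e]]] := scarf x0 h_inj col ord0.
have S0 : S != finset.set0.
  by apply: contra T0 => /eqP S0; rewrite -e S0 imset0.
pose b i := if i \in T then gcoord (lowest h x0 S i) i else 0%N.
exists S, T, b; split => //; last 2 first.
- by move=> i iT; rewrite /b (negbTE iT).
- rewrite leqNgt; apply/negP => bN.
  case/set0Pn: (T0) => i1 i1T.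
  have cT : (\sum_i (i \in T : nat) <= m.+1)%N.
    by rewrite -[leqRHS]card_ord -sum1_card; apply: leq_sum => i _; case: (i \in T).
  pose s := (\sum_i (b i + (i \in T)))%N.
  have sN : (s <= N)%N.
    by rewrite /s big_split/=; apply: ltnW; apply: leq_ltn_trans bN; rewrite leq_add2l.
  have [z zE] : exists z : grid, forall i,
      gcoord z i = (b i + (i \in T) + (if i == i1 then N - s else 0))%N.
    by apply: grid_of; rewrite big_split/= -big_mkcond big_pred1_eq subnKC.
  have [i iT] := dominantP _ _ _ D z.
  have [lS _] := lowestP h x0 i S0.
  move=> /(_ _ lS); rewrite leqNgt hlt// zE iT /b iT addn1.
  exact: leq_addr.
- move=> x i xS; rewrite /b; case: ifP => // iT.
  have [_ /(_ _ xS)] := lowestP h x0 i S0.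
  by rewrite leqNgt => ?; rewrite leqNgt; apply/negP => /hlt; apply/negP.
Qed.

End Grid.

(** * From finite nets to fixed points *)

Section Schauder.
Variables (R : realType) (T : Type) (D : set T).
Implicit Types (u v : T -> R) (C : set (T -> R)).

Definition close_on (e : R) u v := forall t, D t -> `|u t - v t| <= e.

Lemma close_onC e u v : close_on e u v -> close_on e v u.
Proof. by move=> H t Dt; rewrite distrC; exact: H. Qed.

Lemma close_on_trans e1 e2 u v w :
  close_on e1 u v -> close_on e2 v w -> close_on (e1 + e2) u w.
Proof.
by move=> H1 H2 t Dt; apply: le_trans (ler_distD (v t) _ _) _; apply: lerD; auto.
Qed.

Lemma close_on_le e1 e2 u v : e1 <= e2 -> close_on e1 u v -> close_on e2 u v.
Proof. by move=> ee H t Dt; apply: le_trans ee; exact: H. Qed.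

(** Sequential compactness for the uniform distance on [D], stated with cluster points so that
    subsequences need not be carried along. *)
Definition cluster_compact C := forall u_ : nat -> T -> R, (forall n, C (u_ n)) ->
  exists2 v, C v & forall e, 0 < e -> forall N, exists2 n, (N <= n)%N &
    close_on e (u_ n) v.

(** Continuity for the uniform distance on [D]; the radius [d] may depend on [v]. *)
Definition unif_continuous_on C (G : (T -> R) -> T -> R) :=
  forall v, C v -> forall e, 0 < e -> exists2 d, 0 < d &
    forall u, C u -> close_on d u v -> close_on e (G u) (G v).

Definition convex_fun_set C := forall u v (l : R), C u -> C v -> 0 <= l <= 1 ->
  C (fun t => l * u t + (1 - l) * v t).

Lemma convex_fun_set_sum C n (y : 'I_n.+1 -> T -> R) (w : 'I_n.+1 -> R) :
  convex_fun_set C -> (forall i, C (y i)) -> (forall i, 0 <= w i) ->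
  \sum_i w i = 1 -> C (fun t => \sum_i w i * y i t).
Proof.
move=> cvx; elim: n y w => [|n IH] y w Cy w0 w1.
  move: w1; rewrite big_ord1 => w1.
  suff -> : (fun t => \sum_i w i * y i t) = y ord0 by [].
  by apply/funext => t; rewrite big_ord1 w1 mul1r.
pose l := w ord0.
have lE : \sum_(i < n.+1) w (lift ord0 i) = 1 - l.
  by rewrite -w1 [X in _ = X - _]big_ord_recl /l addrAC subrr add0r.
have l01 : 0 <= l <= 1.
  by rewrite w0/= -subr_ge0 -lE sumr_ge0.
have [l1|l1] := eqVneq l 1.
  suff -> : (fun t => \sum_i w i * y i t) = y ord0 by [].
  apply/funext => t; rewrite big_ord_recl -/l l1 mul1r big1 ?addr0// => i _.
  move: lE; rewrite l1 subrr => /eqP; rewrite psumr_eq0// => /allP/(_ i).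
  by rewrite mem_index_enum => /(_ isT)/eqP ->; rewrite mul0r.
have l1' : 1 - l != 0 by rewrite subr_eq0 eq_sym.
have lp : 0 < 1 - l.
  by rewrite lt_neqAle eq_sym l1' subr_ge0; case/andP: l01.
have C' : C (fun t => \sum_i w (lift ord0 i) / (1 - l) * y (lift ord0 i) t).
  apply: IH => [i|i|]; first exact: Cy.
    by rewrite divr_ge0// ltW.
  by rewrite -mulr_suml lE divff.
have := cvx _ _ l (Cy ord0) C' l01; congr (C _).
apply/funext => t; rewrite [RHS]big_ord_recl -/l; congr (_ + _).
rewrite mulr_sumr; apply: eq_bigr => i _; rewrite !mulrA; congr (_ * _).
by rewrite mulrAC divff// mul1r.
Qed.

Variables (C : set (T -> R)) (K : R) (G : (T -> R) -> T -> R).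
Hypotheses (C0 : C !=set0) (Cconv : convex_fun_set C) (Ccomp : cluster_compact C).
Hypothesis Cbd : forall u, C u -> forall t, D t -> `|u t| <= K.
Hypotheses (CG : forall u, C u -> C (G u)) (Gcont : unif_continuous_on C G).

(** Otherwise a greedy choice produces a sequence whose terms are pairwise more than [e] apart
    somewhere on [D], and such a sequence has no cluster point. *)
Lemma cluster_compact_net e : 0 < e ->
  exists n (y : 'I_n.+1 -> T -> R), (forall i, C (y i)) /\
    forall u, C u -> exists i, close_on e u (y i).
Proof.
move=> e0; apply: contrapT => H.
have {}H (s : seq (T -> R)) : exists u, (forall v, List.In v s -> C v) ->
    C u /\ forall v, List.In v s -> ~ close_on e u v.
  case: (pselect (forall v, List.In v s -> C v)) => [Cs|?]; last by exists (fun=> 0).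
  case: s Cs => [|v0 s] Cs; first by have [u Cu] := C0; exists u.
  apply: contrapT => H'; apply: H.
  have inN (s' : seq (T -> R)) i : (i < size s')%N -> List.In (nth v0 s' i) s'.
    by elim: s' i => // w l IH [|i] /=; [left|rewrite ltnS => /IH ?; right].
  have Nin v : List.In v (v0 :: s) -> exists i : 'I_(size s).+1, v = nth v0 (v0 :: s) i.
    move=> vs; suff [i il ->] : exists2 i, (i < size (v0 :: s))%N & v = nth v0 (v0 :: s) i.
      by exists (Ordinal il).
    elim: (v0 :: s) vs => // w l IH /= [<-|/IH[i il ->]]; first by exists 0%N.
    by exists i.+1.
  exists (size s), (fun i => nth v0 (v0 :: s) i); split=> [i|u Cu]; first exact/Cs/inN.
  apply: contrapT => H''; apply: H'; exists u => _; split => // v /Nin[i ->] cl.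
  by apply: H''; exists i.
have [f fP] := choice H.
pose L := fix L n := if n is n'.+1 then f (L n') :: L n' else [::].
have CL n v : List.In v (L n) -> C v.
  by elim: n v => //= n IH v [<-|/IH//]; have [] := fP (L n) IH.
have Lf n p : (n < p)%N -> List.In (f (L n)) (L p).
  elim: p => // p IH; rewrite ltnS leq_eqVlt => /orP[/eqP ->|/IH ?] /=; first by left.
  by right.
have fC n : C (f (L n)) by have [] := fP _ (@CL n).
have [v Cv vcl] := Ccomp fC.
have e2 : 0 < e / 2 by lra.
have [n1 _ H1] := vcl _ e2 0%N; have [n2 n12 H2] := vcl _ e2 n1.+1.
have [_ /(_ _ (Lf _ _ n12))] := fP _ (@CL n2); apply.
rewrite [e]splitr; apply: close_on_trans H2 _; exact: close_onC.
Qed.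

Lemma K_ge0 : D !=set0 -> 0 <= K.
Proof. by move=> [t Dt]; have [u /Cbd/(_ t Dt)] := C0; exact: le_trans. Qed.

(** A grid point [x] stands for the convex combination [p N x] of a finite net, and its colour is a
    net point near the image of [p N x]. Scarf's lemma gives neighbouring grid points whose colours
    are the indices that carry nearly all the weight. The combination is then nearly an average of
    net points that are all near one image. *)
Lemma schauder_approx e : 0 < e -> exists2 v, C v & close_on e (G v) v.
Proof.
move=> e0; have [D0|/set0P D0] := eqVneq D set0.
  by have [u Cu] := C0; exists u => // t; rewrite D0.
have K0 := K_ge0 D0.
pose e4 := e / 4; have e40 : 0 < e4 by rewrite /e4; lra.
have [m [y [Cy net]]] := cluster_compact_net e40.
pose p N (x : grid m N.+1) := fun t => \sum_i ((gcoord x i)%:R / N.+1%:R) * y i t.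
have Cp N (x : grid m N.+1) : C (p N x).
  apply: convex_fun_set_sum => //.
  by rewrite -mulr_suml -natr_sum gcoord_sum divff ?pnatr_eq0.
have Hc N (x : grid m N.+1) : exists i, close_on e4 (G (p N x)) (y i).
  exact/net/CG.
pose c N x := projT1 (cid (Hc N x)).
have cP N x : close_on e4 (G (p N x)) (y (c N x)) by rewrite /c; case: cid.
(* Points of [S] have at most m + 1 units of weight above the corner [b]. Two of them thus give
   functions at distance at most [del N], and moving the weight outside [Q] costs at most [del N] as
   well. *)
pose del N : R := 2 * K * m.+1%:R / N.+1%:R.
(* [w] stands for the image of a cluster point not yet known: the radius in which [G] is controlled
   depends on that point, so it can only be chosen after the sequence. *)
have step N : exists v : T -> R, C v /\
    forall w, C w -> (forall u, C u -> close_on (del N) u v -> close_on e4 (G u) w) ->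
    close_on (2 * e4 + del N) v w.
  have [S [Q [b [S0 SQ bS bQ bN]]]] := grid_scarf (c N).
  have sb x : x \in S -> (\sum_i (gcoord x i - b i) <= m.+1)%N.
    move=> xS; rewrite -(leq_add2l (\sum_i b i)) -big_split/=.
    under eq_bigr do rewrite subnKC ?bS//.
    by rewrite gcoord_sum.
  have sbR x : x \in S -> \sum_i ((gcoord x i)%:R - (b i)%:R) <= m.+1%:R :> R.
    move=> xS; have := sb _ xS; rewrite -(ler_nat R) natr_sum.
    by under eq_bigr do rewrite natrB ?bS//.
  case/set0Pn: S0 => x1 x1S; exists (p N x1); split=> // w Cw Hw.
  have near x : x \in S -> close_on (del N) (p N x) (p N x1).
    move=> xS t Dt; rewrite /p -sumrB.
    apply: (@le_trans _ _ (\sum_i (((gcoord x i)%:R - (b i)%:R) / N.+1%:R * K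
       + ((gcoord x1 i)%:R - (b i)%:R) / N.+1%:R * K))).
      apply: le_trans (ler_norm_sum _ _ _) _; apply: ler_sum => i _.
      rewrite -mulrBl -mulrBl -mulrDl normrM; apply: ler_pM => //; last exact: Cbd.
      rewrite -mulrDl normrM [ `|_^-1|]ger0_norm// ler_wpM2r//.
      have := bS x i xS; have := bS x1 i x1S; rewrite -!(ler_nat R) => ? ?.
      by rewrite ler_norml; apply/andP; split; lra.
    rewrite big_split/= -!mulr_suml /del.
    rewrite [leRHS](_ : _ = m.+1%:R / N.+1%:R * K + m.+1%:R / N.+1%:R * K); last ring.
    by apply: lerD; apply: ler_wpM2r => //; apply: ler_wpM2r => //; exact: sbR.
  have yw i : i \in Q -> close_on (2 * e4) (y i) w.
    rewrite -SQ => /imsetP[x xS ->].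
    have -> : 2 * e4 = e4 + e4 by ring.
    apply: (@close_on_trans _ _ _ (G (p N x))); first exact/close_onC/cP.
    by apply: Hw => //; exact: near.
  move=> t Dt.
  have -> : p N x1 t - w t = \sum_i (gcoord x1 i)%:R / N.+1%:R * (y i t - w t).
    under [RHS]eq_bigr do rewrite mulrBr.
    rewrite sumrB; congr (_ - _); rewrite -mulr_suml -mulr_suml -natr_sum gcoord_sum.
    by rewrite divff ?pnatr_eq0// mul1r.
  apply: (@le_trans _ _ (\sum_i ((gcoord x1 i)%:R / N.+1%:R * (2 * e4)
       + ((gcoord x1 i)%:R - (b i)%:R) / N.+1%:R * (2 * K)))).
    apply: le_trans (ler_norm_sum _ _ _) _; apply: ler_sum => i _.
    rewrite normrM [X in X * _]ger0_norm ?divr_ge0//.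
    have bx := bS x1 i x1S; have bx' : (b i)%:R <= (gcoord x1 i)%:R :> R by rewrite ler_nat.
    have [iQ|iQ] := boolP (i \in Q).
      apply: (@le_trans _ _ ((gcoord x1 i)%:R / N.+1%:R * (2 * e4))).
        by apply: ler_wpM2l; [rewrite divr_ge0|exact: yw].
      by rewrite lerDl mulr_ge0 ?divr_ge0 ?subr_ge0// mulr_ge0.
    (* Outside [Q] the corner is 0, so the whole weight counts as excess over the corner. *)
    apply: (@le_trans _ _ ((gcoord x1 i)%:R / N.+1%:R * (2 * K))).
      apply: ler_wpM2l; first by rewrite divr_ge0.
      rewrite (_ : 2 * K = K + K); last ring.
      by apply: le_trans (ler_normB _ _) _; apply: lerD; exact: Cbd.
    by rewrite bQ// subr0 lerDr mulr_ge0 ?divr_ge0// mulr_ge0// ltW.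
  rewrite big_split/= -!mulr_suml -natr_sum gcoord_sum divff ?pnatr_eq0// mul1r lerD2l /del.
  rewrite [leRHS](_ : _ = m.+1%:R / N.+1%:R * (2 * K)); last ring.
  by apply: ler_wpM2r; [rewrite mulr_ge0|apply: ler_wpM2r => //; exact: sbR].
have [v_ /all_and2[Cv vP]] := choice step.
have [v Cv' vcl] := Ccomp Cv.
exists v => //.
have [d d0 dP] := Gcont Cv' e40.
pose d' := Num.min (d / 2) e4.
have d'0 : 0 < d' by rewrite lt_min e40 andbT; lra.
have [d'd d'e] : d' <= d / 2 /\ d' <= e4 by split; rewrite ge_min lexx ?orbT.
pose N0 := Num.bound (2 * K * m.+1%:R / d').
have N0P N : (N0 <= N)%N -> del N <= d'.
  move=> NN; rewrite /del ler_pdivrMr// [leRHS]mulrC -ler_pdivrMr//.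
  have X0 : 0 <= 2 * K * m.+1%:R / d' by rewrite divr_ge0 ?mulr_ge0// ltW.
  apply: le_trans (ltW (archi_boundP X0)) _.
  by rewrite ler_nat; apply: leq_trans NN _.
have [N NN vN] := vcl _ d'0 N0.
have dN := N0P _ NN.
have /vP : C (G v) by exact: CG.
move=> /(_ N) H.
have {}H : close_on (2 * e4 + del N) (v_ N) (G v).
  apply: H => u Cu uv; apply: dP => //.
  have := close_on_trans uv vN; apply: close_on_le; lra.
apply: close_on_le (close_on_trans (close_onC H) vN).
by move: d'e dN; rewrite /e4; lra.
Qed.

Lemma schauder : exists2 v, C v & forall t, D t -> G v t = v t.
Proof.
have H n : exists v, C v /\ close_on n.+1%:R^-1 (G v) v.
  by have [|v] := @schauder_approx n.+1%:R^-1; first rewrite invr_gt0//; exists v.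
have [v_ /all_and2[Cv vP]] := choice H.
have [v Cv' vcl] := Ccomp Cv.
exists v => // t Dt; apply/eqP; rewrite -subr_eq0 -normr_le0.
apply/ler_addgt0Pr => e e0; rewrite add0r.
have e3 : 0 < e / 3 by lra.
have [d d0 dP] := Gcont Cv' e3.
pose d' := Num.min d (e / 3).
have d'0 : 0 < d' by rewrite lt_min e3 andbT.
have [d'd d'e] : d' <= d /\ d' <= e / 3 by split; rewrite ge_min lexx ?orbT.
have [n nN vn] := vcl _ d'0 (Num.bound (e / 3)^-1).
have n3 : n.+1%:R^-1 <= e / 3.
  have X0 : 0 <= (e / 3)^-1 by rewrite invr_ge0 ltW.
  rewrite invf_ple ?posrE//; apply: le_trans (ltW (archi_boundP X0)) _.
  by rewrite ler_nat; exact: leq_trans nN _.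
have H1 : close_on (e / 3) (G (v_ n)) (G v) by apply: dP => //; exact: close_on_le vn.
have := close_on_trans (close_on_trans (close_onC H1) (vP n)) vn.
move=> /(_ t Dt) /le_trans; apply; move: n3 d'e; set q := n.+1%:R^-1; lra.
Qed.

End Schauder.

(** * Uniform convergence and the Arzela-Ascoli theorem *)

Section SupOn.
Variables (R : realType) (T : Type).
Implicit Types (A : set T) (f g : T -> R).

(** A real supremum, with the default value 0 on unbounded sets; hence the bounds [M] in the lemmas
    below. *)
Definition sup_on A f : R := sup [set f t | t in A].

Lemma sup_on_ub A f t M : (forall s, A s -> f s <= M) -> A t -> f t <= sup_on A f.
Proof.
move=> fM At; apply: sup_ubound; last by exists t.
by exists M => _ [s As <-]; exact: fM.
Qed.

Lemma sup_on_le A f M : A !=set0 -> (forall s, A s -> f s <= M) -> sup_on A f <= M.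
Proof.
move=> [t At] fM; apply: ge_sup; first by exists (f t), t.
by move=> _ [s As <-]; exact: fM.
Qed.

Lemma sup_on_gt A f m : A !=set0 -> m < sup_on A f -> exists2 t, A t & m < f t.
Proof.
move=> [t At] mf; have ne : [set f t | t in A] !=set0 by exists (f t), t.
by have [_ [s As <-] ms] := sup_gt ne mf; exists s.
Qed.

Lemma sup_on_close A f g e M : A !=set0 -> (forall s, A s -> f s <= M) ->
  close_on A e f g -> `|sup_on A f - sup_on A g| <= e.
Proof.
move=> A0 fM fg; have gM s : A s -> g s <= M + e.
  move=> As; have := fg s As; have := fM s As.
  by rewrite ler_norml => ? /andP[]; lra.
have H1 : sup_on A f <= sup_on A g + e.
  apply: sup_on_le => // s As; have := sup_on_ub gM As; have := fg s As.
  by rewrite ler_norml => /andP[]; lra.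
have H2 : sup_on A g <= sup_on A f + e.
  apply: sup_on_le => // s As; have := sup_on_ub fM As; have := fg s As.
  by rewrite ler_norml => /andP[]; lra.
by rewrite ler_norml; lra.
Qed.

End SupOn.

Section UniformSeq.
Variables (R : realType) (T : Type) (D : set T).
Implicit Types u v : T -> R.

Definition ucvg (u_ : nat -> T -> R) v := forall e : R, 0 < e -> \forall n \near \oo, close_on D e (u_ n) v.

Lemma ucvg_cst v : ucvg (fun=> v) v.
Proof. by move=> e e0; near=> n => t Dt; rewrite subrr normr0 ltW. Unshelve. all: by end_near. Qed.

Lemma ucvgD (u_ v_ : nat -> T -> R) u v : ucvg u_ u -> ucvg v_ v ->
  ucvg (fun n t => u_ n t + v_ n t) (fun t => u t + v t).
Proof.
move=> uu vv e e0; have e2 : 0 < e / 2 by lra.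
have := uu _ e2; have := vv _ e2; apply: filterS2 => n Hv Hu t Dt.
rewrite opprD addrACA [e]splitr; apply: le_trans (ler_normD _ _) _.
by apply: lerD; [exact: Hu|exact: Hv].
Qed.

Lemma ucvgM (a_ : nat -> R) (l : R) (u_ : nat -> T -> R) u (K : R) : (forall t, D t -> `|u t| <= K) ->
  a_ @ \oo --> l -> ucvg u_ u ->
  ucvg (fun n t => a_ n * u_ n t) (fun t => l * u t).
Proof.
move=> uK al uu e e0.
pose K1 := `|K| + 1; have K10 : 0 < K1 by rewrite /K1 ltr_wpDl.
have e2 : 0 < e / 2 by lra.
have l1 : 0 < `|l| + 1 by rewrite ltr_wpDl.
move/cvgrPdist_le : al => al.
have H1 := al _ (divr_gt0 e2 K10).
have H2 := uu _ (divr_gt0 e2 l1).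
have H3 : \forall n \near \oo, `|a_ n| <= `|l| + 1.
  have := al _ ltr01; apply: filterS => n.
  by move=> H; have := ler_distD 0 (a_ n) l; have := lerB_dist (a_ n) l; rewrite distrC in H; lra.
apply: filterS3 H1 H2 H3 => n A {}H2 B t Dt.
have -> : a_ n * u_ n t - l * u t = a_ n * (u_ n t - u t) - (l - a_ n) * u t by ring.
apply: le_trans (ler_normB _ _) _; rewrite [e]splitr !normrM; apply: lerD.
  rewrite -[leRHS](divfK (lt0r_neq0 l1)) mulrC.
  by apply: ler_pM => //; exact: H2.
have {}B : `|u t| <= K1 by have := uK t Dt; have := ler_norm K; rewrite /K1; lra.
rewrite -[leRHS](divfK (lt0r_neq0 K10)).
by apply: ler_pM.
Qed.

Lemma ucvg_at (u_ : nat -> T -> R) u t : D t -> ucvg u_ u -> (fun n => u_ n t) @ \oo --> u t.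
Proof.
move=> Dt uu; apply/cvgrPdist_le => e e0; apply: filterS (uu _ e0) => n /(_ t Dt).
by rewrite distrC.
Qed.

Lemma ucvg_sup_on (A : set T) (f : T -> R -> R) (L : R) (u_ : nat -> T -> R) u M :
  A !=set0 -> A `<=` D -> 0 < L ->
  (forall t x y, A t -> `|f t x - f t y| <= L * `|x - y|) ->
  (forall t, A t -> f t (u t) <= M) -> ucvg u_ u ->
  (fun n => sup_on A (fun t => f t (u_ n t))) @ \oo --> sup_on A (fun t => f t (u t)).
Proof.
move=> A0 AD L0 lip fM uu; apply/cvgrPdist_le => e e0.
apply: filterS (uu _ (divr_gt0 e0 L0)) => n un; apply: (sup_on_close A0 fM) => t At.
apply: le_trans (lip _ _ _ At) _; rewrite mulrC -ler_pdivlMr// distrC.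
by apply: un; exact: AD.
Qed.

Lemma close_cvg_ucvg (u_ : nat -> T -> R) u : (forall n, close_on D n.+1%:R^-1 (u_ n) u) -> ucvg u_ u.
Proof.
move=> H e e0; have := near_infty_natSinv_lt (PosNum e0); apply: filterS => n /= ne.
by apply: close_on_le (H n); exact: ltW.
Qed.

Lemma seq_unif_continuous (C : set (T -> R)) (G : (T -> R) -> T -> R) :
  (forall (u_ : nat -> T -> R) u, (forall n, C (u_ n)) -> C u -> ucvg u_ u -> ucvg (G \o u_) (G u)) ->
  unif_continuous_on D C G.
Proof.
move=> H v Cv e e0; apply: contrapT => H'.
have {}H' n : exists u, [/\ C u, close_on D n.+1%:R^-1 u v & ~ close_on D e (G u) (G v)].
  apply: contrapT => H''; apply: H'; exists n.+1%:R^-1; first by rewrite invr_gt0.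
  move=> u Cu uv; apply: contrapT => ?; apply: H''; by exists u.
have [u_ /all_and3[Cu uv ne]] := choice H'.
have := H _ _ Cu Cv (close_cvg_ucvg uv) _ e0.
by move=> [N _ /(_ N (leqnn _))] /ne.
Qed.

End UniformSeq.

Section Ascoli.
Variables (R : realType) (T : topologicalType) (D : set T).
Hypothesis Dcomp : compact D.
Variables (P : set (T -> R)) (K : R) (w : T -> T -> R).
Hypothesis Pclosed : forall v, (forall e : R, 0 < e -> exists2 u, P u & close_on D e u v) -> P v.
Hypothesis wcont : forall t, D t -> forall e : R, 0 < e ->
  \forall s \near t, D s -> w t s <= e.

(** The modulus [w] depends on both points and is small only near each [t], as an integral of
    differences of the kernel will be. [P] carries the closed side conditions. *)
Definition equibounded : set (T -> R) := [set u | [/\ P u,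
  (forall t, D t -> `|u t| <= K) &
  (forall t s, D t -> D s -> `|u t - u s| <= w t s)]].

(** Tychonoff's theorem gives a pointwise cluster point. The bound and the modulus pass to it, and
    compactness of [D] then turns pointwise closeness into uniform closeness. *)
Lemma ascoli : cluster_compact D equibounded.
Proof.
move=> u_ Cu.
(* Nothing bounds [u_ n] outside [D]; the cut-off puts the sequence into a product of segments. *)
pose z_ n : {ptws T -> R} := fun t => if pselect (D t) then u_ n t else 0.
have zE n t : D t -> z_ n t = u_ n t by rewrite /z_; case: pselect.
pose B := [set f : {ptws T -> R} | forall t, `[- `|K|, `|K|]%classic (f t)].
have cB : compact B.
  have := @tychonoff T (fun=> R) (fun=> `[- `|K|, `|K|]%classic) (fun=> @segment_compact R _ _).
  exact.
have zB n : B (z_ n).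
  move=> t /=; rewrite in_itv/= -ler_norml /z_; case: pselect => Dt.
    by have [_ /(_ t Dt) H _] := Cu n; apply: le_trans H (ler_norm _).
  by rewrite normr0.
have [v [Bv vcl]] : B `&` cluster (z_ @ \oo) !=set0.
  by apply: cB; exists 0%N => // n _; exact: zB.
have evalN (t : T) (e : R) : 0 < e -> \forall f \near (v : {ptws T -> R}), `|f t - v t| < e.
  move=> e0; have H : {ptws, nbhs v --> v} by [].
  have Ht : (fun f : {ptws T -> R} => f t : R^o) @ nbhs (v : {ptws T -> R}) --> (v t : R^o).
    exact: (iffLR (@pointwise_cvgP _ _ _ v _) H t).
  by apply: (iffLR (cvgrPdistC_lt _ _) Ht).
pose E := [set f : {ptws T -> R} | (forall t, D t -> `|f t| <= K) /\
   (forall t s, D t -> D s -> `|f t - f s| <= w t s)].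
have zE' n : E (z_ n).
  have [_ H1 H2] := Cu n; split=> [t Dt|t s Dt Ds]; rewrite !zE//; auto.
have Ez : (z_ @ \oo) E by exists 0%N => // n _; exact: zE'.
have Ev : E v.
  split=> [t Dt|t s Dt Ds]; apply/ler_addgt0Pr => e e0.
    have [f [[Hf _] fv]] := vcl _ _ Ez (evalN t e e0).
    have := Hf t Dt; have := ler_distD 0 (v t) (f t); rewrite !(subr0, sub0r, normrN).
    by rewrite distrC; move: fv; have := lerB_dist (v t) (f t); rewrite distrC; lra.
  have e2 : 0 < e / 2 by lra.
  have N2 := @filterI _ _ (nbhs_filter (v : {ptws T -> R})) _ _ (evalN t _ e2) (evalN s _ e2).
  have [f [[_ Hf] [ft fs]]] := vcl _ _ Ez N2.
  have := Hf t s Dt Ds; rewrite distrC in ft.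
  have := ler_distD (f t) (v t) (v s); have := ler_distD (f s) (f t) (v s).
  lra.
have cov (e : R) : 0 < e -> \forall f \near within E (nbhs (v : {ptws T -> R})), D `<=` (fun t => `|f t - v t| <= e).
  move=> e0; have e3 : 0 < e / 3 by lra.
  move/compact_near_coveringP/near_covering_withinP : (Dcomp); apply => t Dt.
  have H1 := wcont Dt e3.
  have H2 : \forall f \near within E (nbhs (v : {ptws T -> R})), E f /\ `|f t - v t| < e / 3.
    by apply: (@filterS _ _ (nbhs_filter (v : {ptws T -> R})) _ _ _ (evalN t _ e3)) => f.
  exists ([set s | D s -> w t s <= e / 3], [set f | E f /\ `|f t - v t| < e / 3]) => //=.
  move=> [s f] /= [Hs [Ef ft]] Ds.
  have [_ /(_ t s Dt Ds) A1] := Ef; have [_ /(_ t s Dt Ds) A2] := Ev.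
  have := Hs Ds; rewrite distrC in A1.
  have := ler_distD (f t) (f s) (v s); have := ler_distD (v t) (f t) (v s).
  lra.
have vclose (e : R) : 0 < e -> forall N, exists2 n, (N <= n)%N & close_on D e (u_ n) v.
  move=> e0 N; have FN : (z_ @ \oo) [set f | exists2 n, (N <= n)%N & f = z_ n].
    by exists N => // n /= Nn; exists n.
  have [f [[n Nn ->] H]] := vcl _ _ FN (cov e e0).
  by exists n => // t Dt; rewrite -zE//; exact: (H (zE' n)).
exists v => //; have [Ev1 Ev2] := Ev; split => //.
apply: Pclosed => e e0; have [n _ H] := vclose e e0 0%N.
by exists (u_ n) => //; have [] := Cu n.
Unshelve. all: by end_near. Qed.

End Ascoli.

(** * Compression and expansion in a cone of functions *)

Lemma cvg_maxr_seq (R : realType) (x_ y_ : nat -> R) (x y : R) :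
  x_ @ \oo --> x -> y_ @ \oo --> y ->
  (fun n => Num.max (x_ n) (y_ n)) @ \oo --> Num.max x y.
Proof.
move=> /cvgrPdist_le Hx /cvgrPdist_le Hy; apply/cvgrPdist_le => e e0.
apply: filterS2 (Hx _ e0) (Hy _ e0) => n; rewrite !ler_norml.
by move=> /andP[? ?] /andP[? ?]; rewrite !maxEle; case: (leP x y) => ?; case: (leP (x_ n) (y_ n)) => ?; lra.
Qed.

Lemma cvg_minr_seq (R : realType) (x_ y_ : nat -> R) (x y : R) :
  x_ @ \oo --> x -> y_ @ \oo --> y ->
  (fun n => Num.min (x_ n) (y_ n)) @ \oo --> Num.min x y.
Proof.
move=> /cvgrPdist_le Hx /cvgrPdist_le Hy; apply/cvgrPdist_le => e e0.
apply: filterS2 (Hx _ e0) (Hy _ e0) => n; rewrite !ler_norml.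
by move=> /andP[? ?] /andP[? ?]; rewrite !minEle; case: (leP x y) => ?; case: (leP (x_ n) (y_ n)) => ?; lra.
Qed.

Lemma dist_max0 (R : realType) (x y : R) : `|Num.max 0 x - Num.max 0 y| <= `|x - y|.
Proof.
rewrite ler_norml !maxEle; case: (leP 0 x) => ?; case: (leP 0 y) => ?;
  case: (lerP x y) => ?; lra.
Qed.

Section Cone.
Variables (R : realType) (T : topologicalType) (D Q : set T) (q0 : T) (c : R).
Hypotheses (Dcomp : compact D) (QD : Q `<=` D) (Qq0 : Q q0) (c01 : 0 < c <= 1).
Variable P : set (T -> R).
Hypothesis Pcone : forall u v (l m : R), P u -> P v -> 0 <= l -> 0 <= m ->
  P (fun t => l * u t + m * v t).
Hypothesis Pclosed : forall v,
  (forall e : R, 0 < e -> exists2 u, P u & close_on D e u v) -> P v.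
Hypothesis Pbd : forall u, P u -> exists K : R, forall t, D t -> `|u t| <= K.

Definition nrm (u : T -> R) : R := sup_on D (fun t => `|u t|).
Definition low (u : T -> R) : R := - sup_on Q (fun t => - u t).

Hypothesis Pc : forall u t, P u -> Q t -> c * nrm u <= u t.

Let D0 : D !=set0. Proof. by exists q0; exact: QD. Qed.
Let Q0 : Q !=set0. Proof. by exists q0. Qed.
Let c0 : 0 < c. Proof. by case/andP: c01. Qed.

Lemma nrm_ub u t : P u -> D t -> `|u t| <= nrm u.
Proof. by move=> /Pbd[K uK]; exact: (sup_on_ub uK). Qed.

Lemma nrm_le u M : (forall t, D t -> `|u t| <= M) -> nrm u <= M.
Proof. exact: sup_on_le. Qed.

Lemma nrm_ge0 u : P u -> 0 <= nrm u.
Proof. by move=> /nrm_ub/(_ (QD Qq0)); exact: le_trans. Qed.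

Lemma cone_ge0 u t : P u -> Q t -> 0 <= u t.
Proof.
by move=> Pu Qt; apply: le_trans (Pc Pu Qt); rewrite mulr_ge0 ?nrm_ge0// ltW.
Qed.

Lemma low_le u t : P u -> Q t -> low u <= u t.
Proof.
move=> Pu Qt; rewrite /low lerNl; apply: (@sup_on_ub _ _ _ (fun t => - u t) _ 0) => // s Qs.
by rewrite oppr_le0 cone_ge0.
Qed.

Lemma low_ge u m : (forall t, Q t -> m <= u t) -> m <= low u.
Proof.
by move=> H; rewrite /low lerNr; apply: sup_on_le => // s Qs; rewrite lerN2; exact: H.
Qed.

Lemma low_nrm u : P u -> low u <= nrm u.
Proof.
move=> Pu; apply: le_trans (low_le Pu Qq0) _; apply: le_trans (ler_norm _) _.
by apply: nrm_ub => //; exact: QD.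
Qed.

Lemma nrm_low u : P u -> c * nrm u <= low u.
Proof. by move=> Pu; apply: low_ge => t; exact: Pc. Qed.

Lemma nrm_eq u v : (forall t, D t -> u t = v t) -> nrm u = nrm v.
Proof.
move=> H; rewrite /nrm /sup_on; congr (sup _); apply/seteqP.
by split=> _ [t Dt <-]; exists t => //; rewrite H.
Qed.

Lemma low_eq u v : (forall t, D t -> u t = v t) -> low u = low v.
Proof.
move=> H; rewrite /low /sup_on; congr (- sup _); apply/seteqP.
by split=> _ [t Qt <-]; exists t => //; rewrite H//; exact: QD.
Qed.

Lemma coneZ u (l : R) : P u -> 0 <= l -> P (fun t => l * u t).
Proof.
move=> Pu l0; have := Pcone Pu Pu l0 (lexx 0); congr (P _).
by apply/funext => t; rewrite mul0r addr0.
Qed.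

Lemma coneD u v : P u -> P v -> P (fun t => u t + v t).
Proof.
move=> Pu Pv; have := Pcone Pu Pv ler01 ler01; congr (P _).
by apply/funext => t; rewrite !mul1r.
Qed.

Lemma nrmZ u (l : R) : P u -> 0 < l -> nrm (fun t => l * u t) = l * nrm u.
Proof.
move=> Pu l0; have Plu := coneZ Pu (ltW l0).
apply/eqP; rewrite eq_le; apply/andP; split.
  apply: nrm_le => t Dt; rewrite normrM gtr0_norm//.
  by rewrite ler_pM2l//; exact: nrm_ub.
rewrite -ler_pdivlMl//; apply: nrm_le => t Dt.
rewrite ler_pdivlMl// -{1}(gtr0_norm l0) -normrM.
exact: (nrm_ub Plu).
Qed.

Lemma lowZ u (l : R) : P u -> 0 < l -> low (fun t => l * u t) = l * low u.
Proof.
move=> Pu l0; have Plu := coneZ Pu (ltW l0).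
apply/eqP; rewrite eq_le; apply/andP; split; last first.
  by apply: low_ge => t Qt; rewrite ler_pM2l//; exact: low_le.
rewrite -ler_pdivrMl//; apply: low_ge => t Qt.
by rewrite ler_pdivrMl//; exact: (low_le Plu).
Qed.

Lemma nrm_cvg (u_ : nat -> T -> R) u : P u -> ucvg D u_ u ->
  (fun n => nrm (u_ n)) @ \oo --> nrm u.
Proof.
move=> /Pbd[K uK] uu; rewrite /nrm.
apply: (@ucvg_sup_on _ _ D D (fun _ => Num.norm) 1 u_ u K) => // t x y _.
by rewrite mul1r; exact: ler_dist_dist.
Qed.

Lemma low_cvg (u_ : nat -> T -> R) u : P u -> ucvg D u_ u ->
  (fun n => low (u_ n)) @ \oo --> low u.
Proof.
move=> Pu uu; rewrite /low; apply: cvgN.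
apply: (@ucvg_sup_on _ _ D Q (fun _ x => - x) 1 u_ u 0) => // [t x y _|t Qt].
  by rewrite mul1r -opprD normrN.
by rewrite oppr_le0 cone_ge0.
Qed.

(** The cone inequality turns a minimum [rho] into a norm at most [rho / c]: this is the origin of
    the band in the outer condition. *)
Lemma low_band (rho : R) u t : P u -> low u = rho -> Q t -> rho <= u t <= rho / c.
Proof.
move=> Pu lu Qt; rewrite -{1}lu low_le//= ler_pdivlMr//.
apply: le_trans (_ : nrm u * c <= _); last by rewrite mulrC -lu nrm_low.
rewrite ler_pM2r//; apply: le_trans (ler_norm _) _.
by apply: nrm_ub => //; exact: QD.
Qed.

Variables (e : T -> R) (S : (T -> R) -> T -> R).
Hypotheses (Pe : P e) (e_gt0 : 0 < nrm e).
Hypothesis econt : forall t, D t -> forall eps : R, 0 < eps ->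
  \forall s \near t, D s -> `|e t - e s| <= eps.
Hypothesis PS : forall u, P u -> P (S u).
Hypothesis Scont : forall (K : R) (u_ : nat -> T -> R) u,
  (forall n, P (u_ n) /\ nrm (u_ n) <= K) -> P u -> ucvg D u_ u ->
  ucvg D (S \o u_) (S u).
Hypothesis Sequi : forall K : R, exists w : T -> T -> R,
  [/\ forall t s, 0 <= w t s,
      (forall t, D t -> forall eps : R, 0 < eps -> \forall s \near t, D s -> w t s <= eps) &
      forall u, P u -> nrm u <= K ->
        forall t s, D t -> D s -> `|S u t - S u s| <= w t s].

(** The gap [d] is uniform in [v], because strictness has to survive suprema, infima, the
    perturbation and a limit. *)
Definition inner_cond (rho : R) := exists2 d, d < rho &
  forall v, P v -> nrm v <= rho -> nrm (S v) <= d.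
Definition outer_cond (rho : R) := exists2 d, rho < d &
  forall v, P v -> (forall t, Q t -> rho <= v t <= rho / c) -> forall t, Q t -> d <= S v t.

Let eta := c * nrm e.
Let eta0 : 0 < eta. Proof. by rewrite /eta mulr_gt0. Qed.
Let eta_le t : Q t -> eta <= e t. Proof. exact: Pc. Qed.
Let e_pos t : Q t -> 0 < e t.
Proof. by move=> /eta_le; exact: lt_le_trans. Qed.

Lemma modulus_add (w : T -> T -> R) (l m : R) : 0 <= l -> 0 <= m ->
  (forall t, D t -> forall eps : R, 0 < eps -> \forall s \near t, D s -> w t s <= eps) ->
  forall t, D t -> forall eps : R, 0 < eps ->
    \forall s \near t, D s -> l * w t s + m * `|e t - e s| <= eps.
Proof.
move=> l0 m0 wc t Dt eps eps0.
have p (x : R) : 0 <= x -> 0 < eps / 2 / (x + 1).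
  by move=> x0; rewrite !divr_gt0// ltr_wpDl.
have q (x y : R) : 0 <= x -> y <= eps / 2 / (x + 1) -> x * y <= eps / 2.
  move=> x0 yx; have x1 : 0 < x + 1 by rewrite ltr_wpDl.
  apply: le_trans (ler_wpM2l x0 yx) _.
  rewrite mulrA ler_pdivrMr// mulrC ler_wpM2l// ?divr_ge0 ?ltW//.
  by rewrite ltrDl.
apply: filterS2 (wc t Dt _ (p l l0)) (econt Dt (p m m0)) => s H1 H2 Ds.
by rewrite [eps]splitr; apply: lerD; apply: q; auto.
Qed.

Lemma equibounded_convex (P' : set (T -> R)) (K : R) w :
  convex_fun_set P' -> convex_fun_set (equibounded D P' K w).
Proof.
move=> cP u v l [Pu uK uw] [Pv vK vw] l01; have /andP[l0 l1] := l01.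
have l1' : 0 <= 1 - l by rewrite subr_ge0.
split; first exact: cP.
  move=> t Dt; apply: le_trans (ler_normD _ _) _; rewrite !normrM (ger0_norm l0) (ger0_norm l1').
  have := ler_wpM2l l0 (uK t Dt); have := ler_wpM2l l1' (vK t Dt); lra.
move=> t s Dt Ds.
have -> : l * u t + (1 - l) * v t - (l * u s + (1 - l) * v s) =
  l * (u t - u s) + (1 - l) * (v t - v s) by ring.
apply: le_trans (ler_normD _ _) _; rewrite !normrM (ger0_norm l0) (ger0_norm l1').
have := ler_wpM2l l0 (uw t s Dt Ds); have := ler_wpM2l l1' (vw t s Dt Ds); lra.
Qed.

(** * Compression: the outer condition holds at the lower level *)

Section Compression.
Variables (rho1 rho2 : R).
Hypotheses (rho1_gt0 : 0 < rho1) (rho12 : rho1 / c < rho2).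
Hypotheses (I0 : outer_cond rho1) (I1 : inner_cond rho2).

Definition lack (u : T -> R) : R := sup_on Q (fun t => Num.max 0 ((rho1 - u t) / e t)).
Definition push (u : T -> R) : T -> R := fun t => u t + lack u * e t.

Let lack_bd u t : P u -> Q t -> Num.max 0 ((rho1 - u t) / e t) <= rho1 / eta.
Proof.
move=> Pu Qt; have r0 : 0 <= rho1 / eta by apply: divr_ge0; exact: ltW.
rewrite ge_max r0/=.
apply: le_trans (_ : rho1 / e t <= _).
  by rewrite ler_pM2r ?invr_gt0 ?e_pos// gerBl cone_ge0.
by rewrite ler_pM2l// lef_pV2 ?posrE ?e_pos//; exact: eta_le.
Qed.

Lemma lack_ub u t : P u -> Q t -> Num.max 0 ((rho1 - u t) / e t) <= lack u.
Proof. by move=> Pu Qt; apply: (sup_on_ub (fun s => lack_bd Pu) Qt). Qed.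

Lemma lack_ge0 u : P u -> 0 <= lack u.
Proof. by move=> Pu; apply: le_trans (lack_ub Pu Qq0); rewrite le_max lexx. Qed.

Lemma lack_le u : P u -> lack u <= rho1 / eta.
Proof. by move=> Pu; apply: sup_on_le => // t; exact: lack_bd. Qed.

Lemma push_cone u : P u -> P (push u).
Proof. by move=> Pu; apply: coneD => //; apply: coneZ => //; exact: lack_ge0. Qed.

Lemma push_ge u t : P u -> Q t -> rho1 <= push u t.
Proof.
move=> Pu Qt; have := lack_ub Pu Qt; rewrite ge_max => /andP[_].
by rewrite ler_pdivrMr ?e_pos// /push; lra.
Qed.

Lemma lack_eq0 u : P u -> (forall t, Q t -> rho1 <= u t) -> lack u = 0.
Proof.
move=> Pu H; apply/eqP; rewrite eq_le lack_ge0// andbT.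
apply: sup_on_le => // t Qt; rewrite ge_max lexx/=.
by rewrite pmulr_lle0 ?invr_gt0 ?e_pos// subr_le0 H.
Qed.

(** Since the push is minimal, the lifted function comes arbitrarily close to [rho1] at points of
    [Q] that nearly realise the supremum [lack u]. *)
Lemma push_low u : P u -> lack u != 0 -> low (push u) = rho1.
Proof.
move=> Pu l0; apply/eqP; rewrite eq_le; apply/andP; split; last first.
  by apply: low_ge => t; exact: push_ge.
apply/ler_addgt0Pr => d d0.
have lp : 0 < lack u by rewrite lt_neqAle eq_sym l0 lack_ge0.
pose d' := Num.min (d / nrm e) (lack u).
have d'0 : 0 < d' by rewrite lt_min lp divr_gt0.
have [d'd d'l] : d' <= d / nrm e /\ d' <= lack u by split; rewrite ge_min lexx ?orbT.
have [t Qt] : exists2 t, Q t & lack u - d' < Num.max 0 ((rho1 - u t) / e t).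
  by apply: sup_on_gt => //; rewrite ltrBlDr ltrDl.
rewrite lt_max => /orP[|]; first by rewrite subr_lt0 ltNge d'l.
rewrite ltr_pdivlMr ?e_pos// => H.
apply: le_trans (low_le (push_cone Pu) Qt) _; rewrite /push.
have : d' * e t <= d.
  apply: le_trans (_ : d / nrm e * nrm e <= _); last by rewrite divfK// lt0r_neq0.
  apply: ler_pM; rewrite ?(ltW d'0) ?(ltW (e_pos Qt))//.
  by apply: le_trans (ler_norm _) _; apply: nrm_ub => //; exact: QD.
by move: H; lra.
Qed.

(** A genuine push ends with minimum [rho1], hence with norm at most [rho1 / c]; the hypothesis
    [rho1 / c < rho2] is what keeps it in the ball. *)
Lemma push_nrm u : P u -> nrm u <= rho2 -> nrm (push u) <= rho2.
Proof.
move=> Pu u2; have [l0|/(push_low Pu) lu] := eqVneq (lack u) 0.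
  suff -> : push u = u by [].
  by apply/funext => t; rewrite /push l0 mul0r addr0.
have := nrm_low (push_cone Pu); rewrite lu mulrC -ler_pdivlMr// => H.
by apply: le_trans H _; exact: ltW.
Qed.

(** Let v be a fixed point of the pushed map. A genuine push would make its minimum equal to [rho1],
    so v would lie in the band and the outer condition would put S v above [rho1] already, leaving
    nothing to push. Thus v = S v, and the gaps of the two conditions make the bounds strict. *)
Lemma compression : exists2 v, P v &
  [/\ forall t, D t -> v t = S v t, rho1 < low v & nrm v < rho2].
Proof.
have [d1 d1r H1] := I1; have [d0 d0r H0] := I0.
have rho2_gt0 : 0 < rho2 by apply: lt_trans rho12; rewrite divr_gt0.
have [w [w0 wc wS]] := Sequi rho2.
(* [rho1 / eta] bounds [lack], so all pushed images share this modulus. *)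
pose w' t s := 1 * w t s + rho1 / eta * `|e t - e s|.
pose P' := [set u | P u /\ forall t, Q t -> rho1 <= u t].
pose C := equibounded D P' rho2 w'.
have w'c := @modulus_add w 1 (rho1 / eta) ler01 (ltW (divr_gt0 rho1_gt0 eta0)) wc.
have CP u : C u -> P u by case=> -[].
have Cnrm u : C u -> nrm u <= rho2 by case=> _ uK _; exact: nrm_le.
have Cpush u : P u -> nrm u <= rho2 ->
    (forall t s, D t -> D s -> `|u t - u s| <= w t s) -> C (push u).
  move=> Pu u2 uw; split.
  - by split; [exact: push_cone|move=> t; exact: push_ge].
  - move=> t Dt; apply: le_trans (nrm_ub (push_cone Pu) Dt) _; exact: push_nrm.
  - move=> t s Dt Ds.
    have -> : push u t - push u s = (u t - u s) + lack u * (e t - e s) by rewrite /push; ring.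
    apply: le_trans (ler_normD _ _) _; rewrite /w' mul1r; apply: lerD; first exact: uw.
    by rewrite normrM ger0_norm ?lack_ge0// ler_wpM2r// lack_le.
have P'closed v : (forall eps : R, 0 < eps -> exists2 u, P' u & close_on D eps u v) -> P' v.
  move=> H; split.
    by apply: Pclosed => eps /H[u [Pu _] uv]; exists u.
  move=> t Qt; apply/ler_addgt0Pr => eps /H[u [_ /(_ t Qt) u1] /(_ t (QD Qt))].
  by rewrite ler_norml => /andP[]; lra.
have [||||u Cu||v Cv vE] := @schauder R T D C rho2 (fun u => push (S u)).
- exists (push (fun t => 0 * e t)); apply: Cpush; first exact: coneZ.
    by apply: nrm_le => t _; rewrite mul0r normr0 ltW.
  by move=> t s _ _; rewrite !mul0r subrr normr0.
- apply: equibounded_convex => u v l [Pu u1] [Pv v1] /andP[l0 l1].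
  have l1' : 0 <= 1 - l by rewrite subr_ge0.
  split; first exact: Pcone.
  move=> t Qt; have := ler_wpM2l l0 (u1 t Qt); have := ler_wpM2l l1' (v1 t Qt); lra.
- exact: ascoli.
- by move=> u [].
- apply: Cpush; first exact/PS/CP.
    by apply: le_trans (H1 _ (CP _ Cu) (Cnrm _ Cu)) _; exact: ltW.
  exact: wS (CP _ Cu) (Cnrm _ Cu).
- apply: seq_unif_continuous => u_ u Cu_ Cu uu.
  have SS : ucvg D (S \o u_) (S u).
    apply: (@Scont rho2) => //; last exact: CP.
    by move=> n; split; [exact: CP|exact: Cnrm].
  apply: ucvgD => //; have [K eK] := Pbd Pe; apply: (@ucvgM _ _ _ _ _ _ _ K) => //.
    apply: (@ucvg_sup_on _ _ D Q (fun t x => Num.max 0 ((rho1 - x) / e t)) eta^-1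
      _ _ (rho1 / eta)) => //.
    + by rewrite invr_gt0.
    + move=> t x y Qt; apply: le_trans (_ : `|(rho1 - x) / e t - (rho1 - y) / e t| <= _).
        exact: dist_max0.
      rewrite -mulrBl normrM mulrC (_ : rho1 - x - (rho1 - y) = y - x); last ring.
      rewrite distrC gtr0_norm ?invr_gt0 ?e_pos// ler_wpM2r// lef_pV2 ?posrE ?e_pos//.
      exact: eta_le.
    + move=> t Qt; exact: lack_bd (PS (CP _ Cu)) Qt.
  exact: ucvg_cst.
have Pv := CP _ Cv; have PSv := PS Pv; have nv := Cnrm _ Cv.
have [[_ v1] _ _] := Cv.
have lv1 : rho1 <= low v by exact: low_ge.
have lowv : low v = rho1 -> rho1 < low (S v).
  move=> lv; apply: (lt_le_trans d0r); apply: low_ge => t Qt; apply: H0 => // s Qs.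
  exact: low_band.
have l0 : lack (S v) = 0.
  have [//|l0] := eqVneq (lack (S v)) 0.
  apply: lack_eq0 => // t Qt; apply: le_trans (low_le PSv Qt); apply/ltW/lowv.
  by rewrite -(low_eq vE); exact: push_low.
have vS t : D t -> v t = S v t.
  by move=> Dt; rewrite -{1}vE// /push l0 mul0r addr0.
exists v => //; split=> //.
  rewrite lt_neqAle lv1 andbT; apply/eqP => /esym lv.
  by have := lowv lv; rewrite -(low_eq vS) lv ltxx.
by rewrite (nrm_eq vS); apply: le_lt_trans d1r; exact: H1.
Qed.

End Compression.

(** * Expansion: the inner condition holds at the lower level *)

Section Expansion.
Variables (rho1 rho2 : R).
Hypotheses (rho1_gt0 : 0 < rho1) (rho12 : rho1 < rho2).
Hypotheses (I1 : inner_cond rho1) (I0 : outer_cond rho2).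

Let rho2_gt0 : 0 < rho2. Proof. exact: lt_trans rho12. Qed.

(* [radial v *: v] is the point of the ray of [v] closest to [v] in the shell
   [nrm >= rho1], [low <= rho2]. *)
Definition radial (v : T -> R) : R := Num.max (rho1 / nrm v) (Num.min 1 (rho2 / low v)).
Definition to_shell (v : T -> R) : T -> R := fun t => radial v * v t.

Let low_gt0 u : P u -> 0 < nrm u -> 0 < low u.
Proof. by move=> Pu u0; apply: lt_le_trans (nrm_low Pu); rewrite mulr_gt0. Qed.

Lemma radial_gt0 v : P v -> 0 < nrm v -> 0 < radial v.
Proof. by move=> Pv v0; rewrite lt_max divr_gt0. Qed.

Lemma radial_gt1 v : P v -> 0 < nrm v -> nrm v < rho1 ->
  radial v = rho1 / nrm v /\ 1 < radial v.
Proof.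
move=> Pv v0 v1; have r1 : 1 < rho1 / nrm v by rewrite ltr_pdivlMr// mul1r.
suff -> : radial v = rho1 / nrm v by [].
by apply/max_idPl; rewrite ge_min (ltW r1).
Qed.

Lemma radial_lt1 v : P v -> 0 < nrm v -> rho2 < low v ->
  radial v = rho2 / low v /\ radial v < 1.
Proof.
move=> Pv v0 v2; have l0 := low_gt0 Pv v0.
have r1 : rho2 / low v < 1 by rewrite ltr_pdivrMr// mul1r.
suff -> : radial v = rho2 / low v by [].
rewrite /radial (min_idPr (ltW r1)); apply/max_idPr.
apply: ler_pM; [exact: ltW|by rewrite invr_ge0 ltW|exact: ltW|].
by rewrite lef_pV2 ?posrE// low_nrm.
Qed.

Lemma radial_eq1 v : P v -> 0 < nrm v -> rho1 <= nrm v -> low v <= rho2 -> radial v = 1.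
Proof.
move=> Pv v0 v1 v2; have l0 := low_gt0 Pv v0.
rewrite /radial (min_idPl _) ?ler_pdivlMr ?mul1r//.
by apply/max_idPr; rewrite ler_pdivrMr ?mul1r.
Qed.

Lemma to_shell_cone v : P v -> 0 < nrm v -> P (to_shell v).
Proof. by move=> Pv v0; apply: coneZ => //; exact/ltW/radial_gt0. Qed.

Lemma to_shell_nrm v : P v -> 0 < nrm v -> nrm (to_shell v) <= rho2 / c.
Proof.
move=> Pv v0; have l0 := low_gt0 Pv v0.
rewrite /to_shell nrmZ ?radial_gt0// -ler_pdivlMr// ge_max; apply/andP; split.
  rewrite ler_pM2r ?invr_gt0// ler_pdivlMr//; apply: le_trans (_ : rho1 * 1 <= _).
    by rewrite ler_pM2l//; case/andP: c01.
  by rewrite mulr1 ltW.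
rewrite ge_min; apply/orP; right.
rewrite -mulrA ler_pM2l// -invfM lef_pV2 ?posrE ?mulr_gt0//.
exact: nrm_low.
Qed.

Lemma to_shell_cvg (u_ : nat -> T -> R) u : P u -> 0 < nrm u -> ucvg D u_ u ->
  ucvg D (fun n => to_shell (u_ n)) (to_shell u).
Proof.
move=> Pu u0 uu; have l0 := low_gt0 Pu u0; have [K uK] := Pbd Pu.
apply: (@ucvgM _ _ _ _ _ _ _ K) => //; apply: cvg_maxr_seq.
  apply: cvgM; first exact: cvg_cst.
  by apply: cvgV; [exact: lt0r_neq0|exact: nrm_cvg].
apply: cvg_minr_seq; first exact: cvg_cst.
apply: cvgM; first exact: cvg_cst.
by apply: cvgV; [exact: lt0r_neq0|exact: low_cvg].
Qed.

Section Perturbed.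
Variable eps : R.
Hypotheses (eps_gt0 : 0 < eps).
Hypothesis eps_small : forall v, P v -> nrm v <= rho1 -> nrm (S v) + eps * nrm e < rho1.

Definition perturbed (v : T -> R) : T -> R := fun t => S v t + eps * e t.
(** A point of the shell has height at [q0] between [c * rho1] and [rho2 / c]. The bounds [lo] and
    [hi] lie strictly outside this range, so the clamp in [reflect] is inactive at a fixed point. *)
Let lo := c * rho1 / 2.
Let hi := 2 * (rho2 / c).

(* The reflected height [2 * v q0 - w q0] turns the expansion into a compression. *)
Definition reflect (v : T -> R) : T -> R :=
  let w := perturbed (to_shell v) in
  fun t => (Num.max lo (Num.min hi (2 * to_shell v q0 - w q0)) / w q0) * w t.

Let lo0 : 0 < lo. Proof. by rewrite /lo divr_gt0// mulr_gt0. Qed.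
Let rc : rho1 < rho2 / c.
Proof.
apply: lt_le_trans rho12 _; rewrite ler_pdivlMr//.
by rewrite -[leRHS]mulr1 ler_pM2l//; case/andP: c01.
Qed.
Let lohi : lo < hi.
Proof.
apply: lt_trans (_ : rho1 < _); last by rewrite /hi; move: rc rho1_gt0; lra.
rewrite /lo ltr_pdivrMr//; apply: le_lt_trans (_ : 1 * rho1 < _).
  by rewrite ler_pM2r//; case/andP: c01.
by rewrite mul1r; move: rho1_gt0; lra.
Qed.

Lemma perturbed_cone v : P v -> P (perturbed v).
Proof. by move=> Pv; apply: coneD; [exact: PS|apply: coneZ => //; exact: ltW]. Qed.

Lemma perturbed_ge v t : P v -> Q t -> eps * eta <= perturbed v t.
Proof.
move=> Pv Qt; apply: le_trans (_ : eps * e t <= _); first by rewrite ler_pM2l ?eta_le.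
by rewrite lerDr; apply: cone_ge0 => //; exact: PS.
Qed.

Lemma perturbed_nrm v : P v -> nrm v <= rho1 -> nrm (perturbed v) < rho1.
Proof.
move=> Pv v1; apply: le_lt_trans (eps_small Pv v1); apply: nrm_le => t Dt.
apply: le_trans (ler_normD _ _) _; rewrite normrM gtr0_norm//; apply: lerD.
  by apply: nrm_ub => //; exact: PS.
by rewrite ler_pM2l// nrm_ub.
Qed.

Let clampP x : let y := Num.max lo (Num.min hi x) in
  [/\ lo <= y, y <= hi, x <= hi -> x <= y & lo <= x -> y <= x].
Proof.
move: lohi => lh /=; split.
- by rewrite le_max lexx.
- by rewrite ge_max (ltW lh)/= ge_min lexx.
- by move=> xh; rewrite le_max le_min xh lexx orbT.
- by move=> lx; rewrite ge_max lx/= ge_min lexx orbT.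
Qed.

(** A fixed point satisfies v = k w, where w is the perturbed image of z = r v and r = [radial v].
    If nrm v < [rho1], then r > 1 and nrm w < nrm z, so r k > 1 and w is below z at [q0]. The
    reflected height is then above that of z, so v(q0) >= z(q0) = r v(q0) > v(q0), absurd. If low v
    > [rho2], every inequality is reversed. Hence r = 1 and z = v, and a height equal to its own
    reflection gives k = 1. *)
Lemma reflect_fixed v : P v -> 0 < nrm v -> (forall t, D t -> reflect v t = v t) ->
  [/\ forall t, D t -> v t = perturbed v t, rho1 <= nrm v & low v <= rho2].
Proof.
move=> Pv v0 vE; pose z := to_shell v; pose w := perturbed z.
have Pz := to_shell_cone Pv v0; have Pw := perturbed_cone Pz.
have r0 := radial_gt0 Pv v0.
have w0 : 0 < w q0 by apply: lt_le_trans (perturbed_ge Pz Qq0); rewrite mulr_gt0.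
pose y := Num.max lo (Num.min hi (2 * z q0 - w q0)).
have [y1 y2 y3 y4] := clampP (2 * z q0 - w q0); rewrite -/y in y1 y2 y3 y4.
have y0 : 0 < y by exact: lt_le_trans y1.
pose k := y / w q0.
have k0 : 0 < k by rewrite divr_gt0.
have vk t : D t -> v t = k * w t by move=> Dt; rewrite -vE.
have vy : v q0 = y by rewrite vk ?divfK ?lt0r_neq0//; exact: QD.
have nv : nrm v = k * nrm w by rewrite (nrm_eq vk) nrmZ.
have lv : low v = k * low w by rewrite (low_eq vk) lowZ.
have nz : nrm z = radial v * nrm v by rewrite /z /to_shell nrmZ.
have lz : low z = radial v * low v by rewrite /z /to_shell lowZ.
have zq : z q0 = radial v * y by rewrite /z /to_shell vy.
have zhi : z q0 < hi.
  apply: le_lt_trans (_ : rho2 / c < _); last by rewrite /hi; move: rc rho1_gt0; lra.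
  apply: le_trans (ler_norm _) _; apply: le_trans (to_shell_nrm Pv v0).
  by apply: nrm_ub => //; exact: QD.
have nw0 : 0 < nrm w by move: v0; rewrite nv pmulr_rgt0.
have yk : y = k * w q0 by rewrite /k divfK ?lt0r_neq0.
have v1 : rho1 <= nrm v.
  rewrite leNgt; apply/negP => v1; have [re r1] := radial_gt1 Pv v0 v1.
  have nz1 : nrm z = rho1 by rewrite nz re divfK// lt0r_neq0.
  have nw : nrm w < nrm z by rewrite nz1; apply: perturbed_nrm => //; rewrite nz1.
  have rk : 1 < radial v * k.
    by rewrite -(ltr_pM2r nw0) mul1r -mulrA -nv -nz.
  have wz : w q0 < z q0 by rewrite zq yk mulrA -[ltLHS]mul1r ltr_pM2r.
  have : z q0 <= y.
    rewrite /y le_max; apply/orP; right; rewrite le_min (ltW zhi)/=.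
    by move: wz; lra.
  by rewrite zq leNgt -[ltLHS]mul1r ltr_pM2r// r1.
have lz_lo : lo < z q0.
  apply: lt_le_trans (low_le Pz Qq0); apply: lt_le_trans (nrm_low Pz).
  apply: lt_le_trans (_ : c * rho1 <= _).
    by rewrite /lo; have := mulr_gt0 c0 rho1_gt0; lra.
  rewrite ler_pM2l// nz -ler_pdivrMr//.
  by rewrite le_max lexx.
have v2 : low v <= rho2.
  rewrite leNgt; apply/negP => v2; have [re r1] := radial_lt1 Pv v0 v2.
  have lv0 : 0 < low v by exact: low_gt0.
  have lz2 : low z = rho2 by rewrite lz re divfK// lt0r_neq0.
  have [d d2 H] := I0.
  have lw : low z < low w.
    rewrite lz2; apply: (lt_le_trans d2); apply: low_ge => t Qt.
    apply: le_trans (H z Pz _ t Qt) _; first by move=> s Qs; exact: low_band.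
    by rewrite /w /perturbed lerDl mulr_ge0// ?ltW// e_pos.
  have lw0 : 0 < low w by rewrite -(pmulr_rgt0 _ k0) -lv.
  have rk : radial v * k < 1.
    by rewrite -(ltr_pM2r lw0) mul1r -mulrA -lv -lz.
  have wz : z q0 < w q0 by rewrite zq yk mulrA -[ltRHS]mul1r ltr_pM2r.
  have : y <= z q0.
    rewrite /y ge_max (ltW lz_lo)/= ge_min; apply/orP; right.
    by move: wz; lra.
  by rewrite zq leNgt -[ltRHS]mul1r ltr_pM2r// r1.
have r1 := radial_eq1 Pv v0 v1 v2.
have zv : z = v by apply/funext => t; rewrite /z /to_shell r1 mul1r.
have ylo : lo < y by rewrite -vy -zv.
have yhi : y < hi by rewrite -vy -zv.
have [x1 x2] : lo < 2 * z q0 - w q0 /\ 2 * z q0 - w q0 < hi.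
  move: ylo yhi; rewrite /y lt_max ltxx/= lt_min => /andP[_ x1].
  by rewrite gt_max => /andP[_]; rewrite gt_min ltxx.
have yE : y = 2 * z q0 - w q0.
  by rewrite /y (min_idPr (ltW x2)) (max_idPr (ltW x1)).
have zqy : z q0 = y by rewrite zv vy.
have yw : y = w q0 by move: yE; rewrite zqy; lra.
split=> // t Dt; rewrite vk// /k yw divff ?lt0r_neq0// mul1r /w zv.
by [].
Qed.

Lemma perturbed_expansion : exists2 v, P v &
  [/\ forall t, D t -> v t = perturbed v t, rho1 <= nrm v & low v <= rho2].
Proof.
have [w [w0 wc wS]] := Sequi (rho2 / c).
have ee : 0 < eps * eta by rewrite mulr_gt0.
have hi0 : 0 < hi by exact: lt_trans lohi.
(* The rescaling factor is a height at most [hi] divided by a value at least [eps * eta]. *)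
pose l := hi / (eps * eta).
have l0 : 0 < l by rewrite divr_gt0.
pose w' t s := l * w t s + (l * eps) * `|e t - e s|.
pose P' := [set u | P u /\ lo <= u q0 <= hi].
pose C := equibounded D P' (hi / c) w'.
have w'c := @modulus_add w l (l * eps) (ltW l0) (ltW (mulr_gt0 l0 eps_gt0)) wc.
have CP u : C u -> P u by case=> -[].
have Cnrm u : C u -> 0 < nrm u.
  move=> Cu; have [[Pu /andP[u1 _]] _ _] := Cu; apply: lt_le_trans lo0 _.
  apply: le_trans u1 _; apply: le_trans (ler_norm _) _; apply: nrm_ub => //; exact: QD.
have bd u : P u -> u q0 <= hi -> forall t, D t -> `|u t| <= hi / c.
  move=> Pu uh t Dt; apply: le_trans (nrm_ub Pu Dt) _.
  by rewrite ler_pdivlMr// mulrC; apply: le_trans (Pc Pu Qq0) _.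
have P'closed v : (forall d : R, 0 < d -> exists2 u, P' u & close_on D d u v) -> P' v.
  move=> H; split.
    by apply: Pclosed => d /H[u [Pu _] uv]; exists u.
  apply/andP; split; apply/ler_addgt0Pr => d /H[u [_ /andP[u1 u2]] /(_ _ (QD Qq0))];
  by rewrite ler_norml => /andP[]; lra.
have pz u : C u -> P (perturbed (to_shell u)).
  by move=> Cu; apply/perturbed_cone/to_shell_cone; [exact: CP|exact: Cnrm].
have pq u : C u -> eps * eta <= perturbed (to_shell u) q0.
  by move=> Cu; apply: perturbed_ge => //; apply/to_shell_cone; [exact: CP|exact: Cnrm].
have pq0 u : C u -> 0 < perturbed (to_shell u) q0.
  by move=> /pq; exact: lt_le_trans.
have coef u : C u ->
    0 <= Num.max lo (Num.min hi (2 * to_shell u q0 - perturbed (to_shell u) q0)) /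
      perturbed (to_shell u) q0 <= l.
  move=> Cu; have [y1 y2 _ _] := clampP (2 * to_shell u q0 - perturbed (to_shell u) q0).
  have y0 := le_trans (ltW lo0) y1.
  rewrite divr_ge0 ?(ltW (pq0 _ Cu))//=; apply: ler_pM => //.
    by rewrite invr_ge0 ltW// pq0.
  by rewrite lef_pV2 ?posrE ?pq0// pq.
have ucv (u_ : nat -> T -> R) u : (forall n, C (u_ n)) -> C u -> ucvg D u_ u ->
    ucvg D (fun n => perturbed (to_shell (u_ n))) (perturbed (to_shell u)).
  move=> Cu_ Cu uu; apply: ucvgD; last exact: ucvg_cst.
  apply: (@Scont (rho2 / c) (fun n => to_shell (u_ n))).
  - move=> n; split.
      by apply: to_shell_cone; [exact: CP|exact: Cnrm].
    by apply: to_shell_nrm; [exact: CP|exact: Cnrm].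
  - by apply: to_shell_cone; [exact: CP|exact: Cnrm].
  - by apply: to_shell_cvg => //; [exact: CP|exact: Cnrm].
have [||||u Cu||v Cv vE] := @schauder R T D C (hi / c) reflect.
- exists (fun t => (hi / e q0) * e t).
  have eq0 : 0 < e q0 by exact: e_pos.
  have Pu : P (fun t => (hi / e q0) * e t) by apply: coneZ => //; rewrite divr_ge0 ?ltW.
  have uq : (hi / e q0) * e q0 = hi by rewrite divfK// lt0r_neq0.
  split.
  - by split => //; rewrite uq lexx (ltW lohi).
  - by apply: bd => //; rewrite uq.
  - move=> t s Dt Ds; rewrite -mulrBr normrM gtr0_norm ?divr_gt0//.
    rewrite -[leLHS]add0r; apply: lerD; first by rewrite mulr_ge0// ltW.
    rewrite ler_wpM2r// /l invfM [_^-1 * _^-1]mulrC mulrA divfK ?lt0r_neq0//.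
    by rewrite ler_pM2l// lef_pV2 ?posrE ?eta_le.
- apply: equibounded_convex => u v k [Pu /andP[u1 u2]] [Pv /andP[v1 v2]] /andP[k0 k1].
  have k1' : 0 <= 1 - k by rewrite subr_ge0.
  split; first exact: Pcone.
  have := ler_wpM2l k0 u1; have := ler_wpM2l k1' v1.
  have := ler_wpM2l k0 u2; have := ler_wpM2l k1' v2; lra.
- exact: ascoli.
- by move=> u [].
- have /andP[k0 k1] := coef u Cu; have [y1 y2 _ _] :=
    clampP (2 * to_shell u q0 - perturbed (to_shell u) q0).
  have Pr : P (reflect u) by apply: coneZ => //; exact: pz.
  have rq : reflect u q0 = Num.max lo (Num.min hi (2 * to_shell u q0 - perturbed (to_shell u) q0)).
    by rewrite /reflect divfK// lt0r_neq0// pq0.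
  split.
  - by split => //; rewrite rq y1.
  - by apply: bd => //; rewrite rq.
  - move=> t s Dt Ds; rewrite /reflect -mulrBr normrM ger0_norm//.
    apply: le_trans (_ : l * (w t s + eps * `|e t - e s|) <= _).
      apply: ler_pM => //; rewrite /perturbed.
      rewrite opprD addrACA -mulrBr; apply: le_trans (ler_normD _ _) _.
      rewrite normrM (gtr0_norm eps_gt0) lerD2r; apply: wS => //.
        by apply: to_shell_cone; [exact: CP|exact: Cnrm].
      by apply: to_shell_nrm; [exact: CP|exact: Cnrm].
    by rewrite mulrDr mulrA.
- apply: seq_unif_continuous => u_ u Cu_ Cu uu.
  have H := ucv _ _ Cu_ Cu uu; have [K pK] := Pbd (pz _ Cu).
  apply: (@ucvgM _ _ _ _ _ _ _ K) => //.
  have Hq := ucvg_at (QD Qq0) H.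
  have Pu := CP _ Cu; have u0 := Cnrm _ Cu.
  have Hz := ucvg_at (QD Qq0) (to_shell_cvg Pu u0 uu).
  apply: cvgM.
    apply: cvg_maxr_seq; first exact: cvg_cst.
    apply: cvg_minr_seq; first exact: cvg_cst.
    by apply: cvgB => //; apply: cvgM => //; exact: cvg_cst.
  by apply: cvgV => //; rewrite lt0r_neq0// pq0.
by exists v; [exact: CP|apply: reflect_fixed => //; [exact: CP|exact: Cnrm]].
Qed.

End Perturbed.

Lemma expansion : exists2 v, P v &
  [/\ forall t, D t -> v t = S v t, rho1 < nrm v & low v < rho2].
Proof.
have [d1 d1r H1] := I1; have [d2 d2r H2] := I0.
(* Half of the inner gap, so that adding [eps0 * e] does not destroy the inner condition. *)
pose eps0 := (rho1 - d1) / 2 / nrm e.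
have eps00 : 0 < eps0 by rewrite !divr_gt0// subr_gt0.
pose ep n := eps0 / n.+1%:R.
have ep0 n : 0 < ep n by rewrite divr_gt0.
have epe n : ep n <= eps0.
  by rewrite ler_pdivrMr//; apply: ler_peMr; rewrite ?ler1n// ltW.
have /choice[v_ vP] n : exists v, P v /\
    [/\ forall t, D t -> v t = perturbed (ep n) v t, rho1 <= nrm v & low v <= rho2].
  have [|v Pv H] := @perturbed_expansion (ep n) (ep0 n); last by exists v.
  move=> v Pv v1; apply: le_lt_trans (_ : d1 + eps0 * nrm e < _).
    by apply: lerD; [exact: H1|rewrite ler_pM2r].
  by rewrite /eps0 divfK ?lt0r_neq0//; move: d1r; lra.
have Pv_ n : P (v_ n) by have [] := vP n.
have nv_ n : nrm (v_ n) <= rho2 / c.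
  have [_ [_ _ l2]] := vP n; rewrite ler_pdivlMr// mulrC.
  exact: le_trans (nrm_low (Pv_ n)) _.
have [w [w0 wc wS]] := Sequi (rho2 / c).
(* The modulus used to find [v_ n] blows up as eps tends to 0; the equation v = S v + eps e supplies
   one that is uniform in n. *)
pose w' t s := 1 * w t s + eps0 * `|e t - e s|.
have w'c := @modulus_add w 1 eps0 ler01 (ltW eps00) wc.
have [n|v [Pv _ _] vcl] := @ascoli R T D Dcomp P (rho2 / c) w' Pclosed w'c v_.
  split=> // [t Dt|t s Dt Ds]; first by apply: le_trans (nv_ n); exact: nrm_ub.
  have [_ [vE _ _]] := vP n; rewrite !vE// /perturbed opprD addrACA -mulrBr.
  apply: le_trans (ler_normD _ _) _; rewrite /w' mul1r normrM (gtr0_norm (ep0 n)).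
  by apply: lerD; [exact: wS|rewrite ler_wpM2r].
have /choice[f fP] n : exists p, (n <= p)%N /\ close_on D n.+1%:R^-1 (v_ p) v.
  have i0 : 0 < n.+1%:R^-1 :> R by rewrite invr_gt0.
  by have [p np cl] := vcl _ i0 n; exists p.
have vv : ucvg D (v_ \o f) v by apply: close_cvg_ucvg => n; have [] := fP n.
have Svv : ucvg D (S \o (v_ \o f)) (S v) by apply: (@Scont (rho2 / c)) => //= n.
have epf : (fun n => ep (f n)) @ \oo --> (0 : R).
  apply/cvgrPdist_le => d d0; have := near_infty_natSinv_lt (PosNum (divr_gt0 d0 eps00)).
  apply: filterS => n /= nd; rewrite sub0r normrN gtr0_norm//.
  have [nf _] := fP n; rewrite /ep mulrC -ler_pdivlMr//; apply: le_trans (ltW nd).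
  by rewrite lef_pV2 ?posrE// ler_nat ltnS.
have vS t : D t -> v t = S v t.
  move=> Dt; have A := ucvg_at Dt vv; have B := ucvg_at Dt Svv.
  have B' : (fun n => S (v_ (f n)) t + ep (f n) * e t) @ \oo --> S v t + 0 * e t.
    by apply: cvgD => //; apply: cvgM => //; exact: cvg_cst.
  rewrite mul0r addr0 in B'.
  have AB : (fun n => S (v_ (f n)) t + ep (f n) * e t) = (fun n => (v_ \o f) n t).
    by apply/funext => n /=; have [_ [vE _ _]] := vP (f n); rewrite [RHS]vE.
  by rewrite AB in B'; exact: (cvg_unique _ A B').
have n1 : rho1 <= nrm v.
  by apply: (cvgr_to_ge (nrm_cvg Pv vv)); near=> n => /=; have [_ []] := vP (f n).
have l2 : low v <= rho2.
  by apply: (cvgr_to_le (low_cvg Pv vv)); near=> n => /=; have [_ []] := vP (f n).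
(* The limit only keeps weak inequalities; the gaps [d1] and [d2], applied to v = S v, make them
   strict. *)
exists v => //; split=> //.
  rewrite lt_neqAle n1 andbT; apply/eqP => n1'.
  have := H1 v Pv; rewrite -(nrm_eq vS) -n1' => /(_ (lexx _)).
  by rewrite leNgt d1r.
rewrite lt_neqAle l2 andbT; apply/eqP => l2'.
have : d2 <= low (S v).
  by apply: low_ge => t Qt; apply: H2 => // s Qs; exact: low_band.
by rewrite -(low_eq vS) l2' leNgt d2r.
Unshelve. all: by end_near. Qed.

End Expansion.

End Cone.

(** * Integration *)

Section RealIntegral.
Context d (T : measurableType d) (R : realType) (mu : {measure set T -> \bar R}).
Variables (D : set T) (mD : measurable D).
Implicit Types f g h : T -> R.

Notation intb f := (mu.-integrable D (EFin \o f)).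
Notation Rint f := (Rintegral mu D f).

Lemma intb_meas f : intb f -> measurable_fun D f.
Proof. by move=> /integrableP[/measurable_EFinP]. Qed.

Lemma intb_norm f : intb f -> intb (fun x => `|f x|).
Proof. exact: integrable_norm. Qed.

Lemma intb_le f g : measurable_fun D f -> intb g ->
  {ae mu, forall x, D x -> `|f x| <= g x} -> intb f.
Proof.
move=> mf ig fg; have mg := intb_meas ig; have /integrableP[_] := intb_norm ig.
move=> /(le_lt_trans _) H; apply/integrableP; split; first exact/measurable_EFinP.
apply: H; apply: ae_ge0_le_integral => //.
- by apply: measurableT_comp => //; exact/measurable_EFinP.
- by apply: measurableT_comp => //; apply/measurable_EFinP; apply: measurableT_comp.
- apply: filterS fg => x H Dx /=; rewrite lee_fin; have := H Dx.
  by have := ler_norm (g x); rewrite normr_id; lra.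
Qed.

Lemma intbD f g : intb f -> intb g -> intb (fun x => f x + g x).
Proof. by move=> If Ig; have := integrableD mD If Ig. Qed.

Lemma intbB f g : intb f -> intb g -> intb (fun x => f x - g x).
Proof. by move=> If Ig; have := integrableB mD If Ig. Qed.

Lemma intbZ (l : R) f : intb f -> intb (fun x => l * f x).
Proof. by move=> If; have := integrableZl mD l If. Qed.

Lemma intbM_bd f h (M : R) : intb f -> measurable_fun D h ->
  {ae mu, forall x, D x -> `|h x| <= M} -> intb (fun x => f x * h x).
Proof.
move=> If mh hM; apply: (@intb_le _ (fun x => M * `|f x|)).
- by apply: measurable_funM => //; exact: intb_meas.
- exact/intbZ/intb_norm.
- by apply: filterS hM => x H Dx; rewrite normrM mulrC ler_wpM2r// H.
Qed.

Lemma Rint_ae_eq f g : measurable_fun D f -> measurable_fun D g ->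
  {ae mu, forall x, D x -> f x = g x} -> Rint f = Rint g.
Proof.
move=> mf mg fg; congr fine; apply: ae_eq_integral => //; try exact/measurable_EFinP.
by apply: filterS fg => x H Dx; rewrite H.
Qed.

(** The minimum of [f] and [g] equals [f] almost everywhere and is at most [g] everywhere. *)
Lemma Rint_ae_le f g : intb f -> intb g -> {ae mu, forall x, D x -> f x <= g x} ->
  Rint f <= Rint g.
Proof.
move=> If Ig fg; have mf := intb_meas If; have mg := intb_meas Ig.
have mm : measurable_fun D (fun x => Num.min (f x) (g x)) by exact: measurable_minr.
rewrite (@Rint_ae_eq f (fun x => Num.min (f x) (g x)))//; last first.
  by apply: filterS fg => x H Dx; rewrite (min_idPl _)// H.
apply: le_Rintegral => //; last by move=> x _; rewrite ge_min lexx orbT.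
apply: intb_le mm (intbD (intb_norm If) (intb_norm Ig)) _.
apply: aeW => x _; rewrite minEle; case: ifP => _.
  by rewrite lerDl.
by rewrite lerDr.
Qed.

Lemma Rint_ae_ge0 f : intb f -> {ae mu, forall x, D x -> 0 <= f x} -> 0 <= Rint f.
Proof.
move=> If f0; have <- : Rint (fun=> 0) = 0 by rewrite /Rintegral integral0.
by apply: Rint_ae_le => //; exact: integrable0.
Qed.

Lemma Rint_norm_le f g : intb f -> intb g -> {ae mu, forall x, D x -> `|f x| <= g x} ->
  `|Rint f| <= Rint g.
Proof.
move=> If Ig fg; apply: le_trans (le_normr_Rintegral mD If) _.
exact: Rint_ae_le (intb_norm If) Ig fg.
Qed.

Lemma Rint_dct (f_ : nat -> T -> R) f g :
  (forall n, measurable_fun D (f_ n)) -> measurable_fun D f -> intb g ->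
  {ae mu, forall x, D x -> f_ ^~ x @ \oo --> f x} ->
  (forall n, {ae mu, forall x, D x -> `|f_ n x| <= g x}) ->
  (fun n => Rint (fun x => `|f_ n x - f x|)) @ \oo --> 0.
Proof.
move=> mf_ mf Ig ff fg.
have mE (h : T -> R) : measurable_fun D h -> measurable_fun D (EFin \o h).
  by move=> ?; exact/measurable_EFinP.
have [| | | | |_ H _] := @dominated_convergence _ _ _ mu D mD
  (fun n => EFin \o f_ n) (EFin \o f) (EFin \o g).
- by move=> n; exact: mE.
- exact: mE.
- apply: filterS ff => x H Dx; apply: cvg_EFin; last exact: H.
  by near=> n.
- by [].
- by apply: filterS (ae_foralln fg) => x H n Dx /=; rewrite lee_fin; exact: H.
exact: (fine_cvg H).
Unshelve. all: by end_near. Qed.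

End RealIntegral.

(** * Measurability up to null sets for complete measures *)

Section CompleteMeasure.
Context d (T : measurableType d) (R : realType) (mu : {measure set T -> \bar R}).
Hypothesis cmu : measure_is_complete mu.
Variables (D : set T) (mD : measurable D).

Lemma ae_measurable_real (f g : T -> R) : measurable_fun D f ->
  {ae mu, forall x, D x -> f x = g x} -> measurable_fun D g.
Proof.
move=> mf fg; apply/measurable_EFinP.
apply: (@ae_measurable_fun _ _ _ mu cmu D (EFin \o f)); last exact/measurable_EFinP.
by apply: filterS fg => x H Dx /=; rewrite H.
Qed.

(** Set to 0 on a null set containing the bad points, the sequence converges everywhere on [D];
    completeness then allows [f] to be changed back on that set. *)
Lemma ae_measurable_lim (f_ : nat -> T -> R) (f : T -> R) :
  (forall n, measurable_fun D (f_ n)) ->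
  {ae mu, forall x, D x -> f_ ^~ x @ \oo --> f x} -> measurable_fun D f.
Proof.
move=> mf_ [N [mN N0 HN]].
have mDN : measurable (D `\` N) by exact: measurableD.
have DNE : D `&` (D `\` N) = D `\` N by rewrite setIidr//; exact: subDsetl.
apply: (@ae_measurable_real (f \_ (D `\` N))).
  apply: (@measurable_fun_cvg _ _ _ _ (fun n => f_ n \_ (D `\` N))).
    move=> n; apply/measurable_restrict => //; rewrite DNE.
    exact: measurable_funS (mf_ n).
  move=> x Dx; rewrite patchE; case: ifPn => [|xN].
    rewrite inE => -[_ Nx]; rewrite (_ : (fun n => _) = (f_ ^~ x)).
      by apply: contrapT => H; apply/Nx/HN => /= /(_ Dx).
    by apply/funext => n; rewrite patchE mem_set.
  rewrite (_ : (fun n => _) = cst 0); first exact: cvg_cst.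
  by apply/funext => n; rewrite patchE (negbTE xN).
exists N; split => // x /= H; apply: contrapT => Nx; apply: H => Dx.
by rewrite patchE mem_set.
Qed.

End CompleteMeasure.

(** * Fubini's theorem under slicewise domination *)

Section FubiniBox.
Context d1 d2 (T1 : measurableType d1) (T2 : measurableType d2) (R : realType).
Variables (m1 : {sigma_finite_measure set T1 -> \bar R})
  (m2 : {sigma_finite_measure set T2 -> \bar R}).
Variables (D1 : set T1) (D2 : set T2) (mD1 : measurable D1) (mD2 : measurable D2).
Hypothesis m1D1 : (m1 D1 < +oo)%E.
Variables (f : T1 -> T2 -> R) (G : T2 -> R).
Hypothesis mf : measurable_fun (D1 `*` D2) (fun p => f p.1 p.2).
Hypothesis iG : m2.-integrable D2 (EFin \o G).
Hypothesis fG : forall t, D1 t -> {ae m2, forall s, D2 s -> `|f t s| <= G s}.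

Let fr : T1 * T2 -> \bar R := (fun p => (f p.1 p.2)%:E) \_ (D1 `*` D2).

Let frE1 t : D1 t -> (fun s => fr (t, s)) = (EFin \o f t) \_ D2.
Proof.
move=> Dt; apply/funext => s; rewrite /fr !patchE.
by congr (if _ then _ else _); apply/idP/idP; rewrite !inE => //= -[].
Qed.

Let frE1' t : ~ D1 t -> (fun s => fr (t, s)) = cst 0%E.
Proof.
by move=> Dt; apply/funext => s; rewrite /fr patchE ifF//; apply/negP; rewrite inE => -[].
Qed.

Let frE2 s : D2 s -> (fun t => fr (t, s)) = (EFin \o (f ^~ s)) \_ D1.
Proof.
move=> Dt; apply/funext => t; rewrite /fr !patchE.
by congr (if _ then _ else _); apply/idP/idP; rewrite !inE => //= -[].
Qed.

Let frE2' s : ~ D2 s -> (fun t => fr (t, s)) = cst 0%E.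
Proof.
by move=> Dt; apply/funext => t; rewrite /fr patchE ifF//; apply/negP; rewrite inE => -[].
Qed.

Let mfr : measurable_fun setT fr.
Proof.
apply/measurable_restrict => //; first exact: measurableX.
by rewrite setTI; exact/measurable_EFinP.
Qed.

Lemma box_slice_integrable t : D1 t -> m2.-integrable D2 (EFin \o f t).
Proof.
move=> Dt; apply: (intb_le mD2 _ iG (fG Dt)).
have := measurableT_comp mfr (pair1_measurable t).
rewrite (_ : fr \o pair t = (EFin \o f t) \_ D2); last exact: frE1.
by move/(measurable_restrict _ mD2 measurableT); rewrite setTI => /measurable_EFinP.
Qed.

(** The exceptional null set of the domination depends on [t], so no dominating function on the
    product is at hand. Integrating in [s] first, each slice is bounded by the integral of |G|, and
    [m1 D1] is finite. *)
Let ifr : (m1 \x m2)%E.-integrable setT fr.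
Proof.
apply/(integrable12ltyP m1 m2 mfr).
pose C : \bar R := (\int[m2]_(s in D2) `|(G s)%:E|)%E.
have C0 : (0 <= C)%E by exact: integral_ge0.
have Cfin : (C < +oo)%E by have /integrableP[_] := iG.
apply: (@le_lt_trans _ _ (\int[m1]_t ((cst C) \_ D1) t)%E); last first.
  by rewrite -integral_mkcond integral_cst// lte_mul_pinfty// ge0_fin_numE.
apply: ge0_le_integral => //.
- by move=> t _; exact: integral_ge0.
- apply: (measurable_fun_fubini_tonelli_F (abse \o fr)).
    exact: measurableT_comp.
  by move=> x; exact: abse_ge0.
- by apply/measurable_restrict => //; exact: measurable_cst.
move=> t _; rewrite patchE; case: ifPn => [|]; rewrite ?inE ?notin_setE => Dt.
  rewrite (_ : (fun s => _) = (fun s => `|(f t s)%:E|%E) \_ D2); last first.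
    apply/funext => s; have /(congr1 (fun h => h s)) /= -> := frE1 Dt.
    by rewrite !patchE; case: ifP; rewrite ?abse0.
  rewrite -integral_mkcond; apply: ae_ge0_le_integral => //.
  + by apply: measurableT_comp => //; have /integrableP[] := box_slice_integrable Dt.
  + by apply: measurableT_comp => //; have /integrableP[] := iG.
  + apply: filterS (fG Dt) => s H Ds; rewrite /= lee_fin.
    by apply: le_trans (H Ds) (ler_norm _).
rewrite (_ : (fun s => _) = cst 0%E) ?integral0//.
apply/funext => s; have /(congr1 (fun h => h s)) /= -> := frE1' Dt.
by rewrite abse0.
Qed.

Lemma box_ae_integrable : {ae m2, forall s, D2 s -> m1.-integrable D1 (EFin \o (f ^~ s))}.
Proof.
apply: filterS (ae_integrable2 ifr) => s H Ds.
by move: H; rewrite (frE2 Ds) => /(integrable_mkcond _ mD1).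
Qed.

Let K s := Rintegral m1 D1 (f ^~ s).

Let GE : fubini_G m1 fr = (fun s => \int[m1]_(t in D1) (f t s)%:E)%E \_ D2.
Proof.
apply/funext => s; rewrite /fubini_G patchE; case: ifPn; rewrite ?inE ?notin_setE => Ds.
  by rewrite (frE2 Ds) -integral_mkcond.
by rewrite (frE2' Ds) integral0.
Qed.

Let mG0 : measurable_fun D2 (fun s => \int[m1]_(t in D1) (f t s)%:E)%E.
Proof.
have := measurable_fubini_G ifr; rewrite GE.
by move/(measurable_restrict _ mD2 measurableT); rewrite setTI.
Qed.

Let mK : measurable_fun D2 K.
Proof. exact: (measurable_comp (F := setT)) mG0. Qed.

Let KE : {ae m2, forall s, D2 s -> (K s)%:E = (\int[m1]_(t in D1) (f t s)%:E)%E}.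
Proof.
apply: filterS box_ae_integrable => s H Ds; rewrite fineK//.
exact: integrable_fin_num (H Ds).
Qed.

Lemma box_integral_integrable : m2.-integrable D2 (EFin \o K).
Proof.
apply/integrableP; split; first exact/measurable_EFinP.
have := (integrable21ltyP m1 m2 mfr).1 ifr; apply: le_lt_trans.
rewrite integral_mkcond; apply: ae_ge0_le_integral => //.
- by move=> s _; rewrite patchE; case: ifP.
- apply/measurable_restrict => //; rewrite setTI.
  by apply: measurableT_comp => //; exact/measurable_EFinP.
- by move=> s _; exact: integral_ge0.
- apply: (measurable_fun_fubini_tonelli_G (abse \o fr)).
    exact: measurableT_comp.
  by move=> x; exact: abse_ge0.
- apply: filterS KE => s H _; rewrite patchE; case: ifPn; rewrite ?inE ?notin_setE => Ds.
    rewrite -[leLHS]/(`|(K s)%:E|%E) (H Ds) -[X in (`|X| <= _)%E](_ : \int[m1]_t (fr (t, s)) = _)%E; last first.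
      by rewrite (frE2 Ds) -integral_mkcond.
    apply: le_abse_integral => //.
    exact: (measurableT_comp mfr (pair2_measurable s)).
  exact: integral_ge0.
Qed.

Lemma box_fubini :
  Rintegral m1 D1 (fun t => Rintegral m2 D2 (f t)) = Rintegral m2 D2 K.
Proof.
rewrite [RHS]/Rintegral (ae_eq_integral (fun s => \int[m1]_(t in D1) (f t s)%:E)%E)//;
  last exact/measurable_EFinP.
congr fine.
rewrite [RHS]integral_mkcond -GE integral21_prod_meas1// -integral12_prod_meas1//.
rewrite integral_mkcond; apply: eq_integral => t _; rewrite /fubini_F patchE.
case: ifPn; rewrite ?inE ?notin_setE => Dt.
  rewrite (frE1 Dt) -integral_mkcond fineK//.
  exact: integrable_fin_num (box_slice_integrable Dt).
by rewrite (frE1' Dt) integral0.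
Qed.

End FubiniBox.

(** * Continuous functions, histories and Stieltjes integrals *)

Section ContinuousOn.
Variables (R : realType) (D : set R).

Lemma within_continuousP (u : R -> R) : {within D, continuous u} <->
  forall t, D t -> forall e : R, 0 < e -> \forall s \near t, D s -> `|u t - u s| <= e.
Proof.
split=> [/subspace_continuousP H t Dt e e0|H].
  by have /cvgrPdist_le/(_ e e0) := H t Dt.
by apply/subspace_continuousP => t Dt; apply/cvgrPdist_le => e e0; exact: H.
Qed.

Hypothesis Dcomp : compact D.

Lemma within_continuous_bounded (u : R -> R) : {within D, continuous u} ->
  exists K : R, forall t, D t -> `|u t| <= K.
Proof.
move=> uc; have [M [_ HM]] := compact_bounded (continuous_compact uc Dcomp).
exists (M + 1) => t Dt; apply: (HM (M + 1)); first by rewrite ltrDl.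
by exists t.
Qed.

Lemma within_continuous_unif (u : R -> R) : {within D, continuous u} ->
  forall e : R, 0 < e -> exists2 d : R, 0 < d &
    forall s t, D s -> D t -> `|s - t| < d -> `|u s - u t| <= e.
Proof.
move=> /within_continuousP uc e e0; have e2 : 0 < e / 2 by lra.
pose P (d s : R) := forall t, D t -> `|s - t| < d -> `|u s - u t| <= e.
have [d [d0 dP]] : exists d : R, 0 < d /\ D `<=` P d.
  have H : \forall d \near (0 : R)^'+, D `<=` P d.
    move/compact_near_coveringP/near_covering_withinP : (Dcomp); apply => x Dx.
    have /nbhs_ballP[d /= d0 dP] := uc x Dx _ e2.
    have d2 : 0 < d / 2 by lra.
    exists (ball x (d / 2), [set y : R | y < d / 2]) => /=.
      by split; [exact: nbhsx_ballx|exact: nbhs_right_lt].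
    move=> [s y] /= [xs yd] Ds t Dt st; have {}yd : y < d / 2 by exact: yd.
    have xs' : `|x - s| < d / 2 by exact: xs.
    have A : `|u x - u s| <= e / 2.
      by apply: dP => //; rewrite /ball/=; apply: lt_trans xs' _; lra.
    have B : `|u x - u t| <= e / 2.
      apply: dP => //; rewrite /ball/=; have := ler_distD s x t; lra.
    by have := ler_distD (u x) (u s) (u t); rewrite (distrC (u s) (u x)); lra.
  near ((0 : R)^'+) => d; exists d; split; last by near: d.
  by near: d; exact: nbhs_right_gt.
by exists d => // s t Ds Dt; exact: dP.
Unshelve. all: by end_near. Qed.

End ContinuousOn.

Section History.
Variables (R : realType) (r : R).
Hypothesis r0 : 0 < r.

Lemma sup_norm_le (T : Type) (E : set T) (f : T -> R) M : E !=set0 ->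
  (forall t, E t -> `|f t| <= M) -> sup_norm E f <= M.
Proof. exact: sup_on_le. Qed.

Lemma sup_norm_ub (T : Type) (E : set T) (f : T -> R) t K :
  (forall s, E s -> `|f s| <= K) -> E t -> `|f t| <= sup_norm E f.
Proof. by move=> fK; exact: sup_on_ub fK. Qed.

Lemma delay_itv_ex : [set: delay_itv r] !=set0.
Proof.
have h : (0 : R) \in delay_itv r.
  by rewrite inE /delay_itv/= in_itv/= lexx oppr_le0 ltW.
by exists (exist _ 0 h).
Qed.

Lemma delay_valP (th : delay_itv r) : - r <= set_val th <= 0.
Proof. by have := set_valP th; rewrite /delay_itv/= in_itv. Qed.

Lemma delay_shift (t : R) (th : delay_itv r) : 0 <= t <= 1 ->
  `[- r, 1]%classic (t + set_val th).
Proof. by move=> /andP[? ?]; have /andP[? ?] := delay_valP th; rewrite /= in_itv/=; lra. Qed.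

Lemma history_continuous (u : R -> R) t : {within `[- r, 1], continuous u} ->
  0 <= t <= 1 -> continuous (@history R r u t).
Proof.
move=> /within_continuousP uc /andP[t0 t1].
have /subspace_sigL_continuousP : {within delay_itv r, continuous (fun x => u (t + x))}.
  apply/within_continuousP => x; rewrite /delay_itv/= in_itv/= => /andP[x1 x2] e e0.
  have tx : `[- r, 1]%classic (t + x) by rewrite /= in_itv/=; lra.
  have C : (fun y : R => t + y) @ x --> t + x by apply: cvgD; [exact: cvg_cst|exact: cvg_id].
  have N : \forall y \near x, `[- r, 1]%classic (t + y) -> `|u (t + x) - u (t + y)| <= e.
    exact: C _ (uc _ tx e e0).
  apply: filterS N => y H; rewrite /= in_itv/= => /andP[y1 y2].
  by apply: H; rewrite /= in_itv/=; lra.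
exact.
Qed.

Lemma history_close (u v : R -> R) s t (e : R) :
  (forall th : delay_itv r, `|u (s + set_val th) - v (t + set_val th)| <= e) ->
  sup_norm setT (@history R r u s \- history v t) <= e.
Proof. by move=> H; apply: sup_norm_le => [|th _]; [exact: delay_itv_ex|exact: H]. Qed.

Lemma history_norm (u : R -> R) t (e : R) : 0 <= t <= 1 ->
  (forall s, - r <= s <= 1 -> `|u s| <= e) ->
  sup_norm setT (@history R r u t) <= e.
Proof.
move=> t01 H; apply: sup_norm_le => [|th _]; first exact: delay_itv_ex.
by apply: H; have := delay_shift th t01; rewrite /= in_itv.
Qed.

End History.

Lemma intb_cst d (T : measurableType d) (R : realType) (mu : {measure set T -> \bar R})
  (D : set T) (K : R) : measurable D -> (mu D < +oo)%E ->
  mu.-integrable D (EFin \o (fun=> K)).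
Proof.
move=> mD Dfin; apply/integrableP; split; first exact/measurable_EFinP.
rewrite (_ : (fun x => _) = cst `|K%:E|%E)//.
by rewrite integral_cst// lte_mul_pinfty// ge0_fin_numE.
Qed.

(** * Linearity and continuity of the Stieltjes integral *)

Section StieltjesFacts.
Variables (R : realType) (A : R -> R) (hA : bounded_variation 0 1 A).

Definition stieltjes_pos : {sigma_finite_measure set (measurableTypeR R) -> \bar R} :=
  lebesgue_stieltjes_measure (right_reg_cumulative (pos_tv_nd hA)).
Definition stieltjes_neg : {sigma_finite_measure set (measurableTypeR R) -> \bar R} :=
  lebesgue_stieltjes_measure (right_reg_cumulative (neg_tv_nd hA)).

(** The half-open interval ]-1, 1] has finite measure and contains the possible atom at 0. *)
Lemma lebesgue_stieltjes_itv01_lty (f : cumulative R R) :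
  (lebesgue_stieltjes_measure f `[0%R, 1%R]%classic < +oo)%E.
Proof.
apply: (@le_lt_trans _ _ (lebesgue_stieltjes_measure f `](-1)%R, 1%R]%classic)).
  apply: le_measure; rewrite ?inE; [exact: measurable_itv|exact: measurable_itv|].
  by move=> x /=; rewrite !in_itv/= => /andP[? ->]; rewrite andbT; lra.
rewrite /lebesgue_stieltjes_measure /measure_extension/=.
rewrite measurable_mu_extE/=; last exact: is_ocitv.
by rewrite wlength_itv_bnd ?ltry//; lra.
Qed.

Definition stieltjes_regular (u : R -> R) :=
  measurable_fun (`[0%R, 1%R]%classic : set R) u /\
  exists K : R, forall t, 0 <= t <= 1 -> `|u t| <= K.

Lemma stieltjes_regular_int (f : cumulative R R) (u : R -> R) : stieltjes_regular u ->
  (lebesgue_stieltjes_measure f).-integrable `[0, 1]%classic (EFin \o u).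
Proof.
move=> [mu [K uK]]; apply: (@intb_le _ _ _ _ _ _ _ (fun=> K)) => //.
  by apply: intb_cst => //; exact: lebesgue_stieltjes_itv01_lty.
by apply: aeW => t; rewrite /= in_itv/=; exact: uK.
Qed.

Lemma stieltjes_regular_cont (r : R) (u : R -> R) : 0 < r ->
  {within `[- r, 1], continuous u} -> stieltjes_regular u.
Proof.
move=> r0 uc; have sub (t : R) : 0 <= t <= 1 -> - r <= t <= 1.
  by move=> /andP[t0 ->]; rewrite andbT (le_trans _ t0)// oppr_le0 ltW.
split; last first.
  have [K uK] := within_continuous_bounded (@segment_compact R _ _) uc.
  by exists K => t /sub t1; apply: uK; rewrite /= in_itv.
apply: (@measurable_funS _ _ _ _ `[- r, 1]%classic).
- exact: measurable_itv.
- by move=> t; rewrite /= !in_itv/=; exact: sub.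
- by apply: subspace_continuous_measurable_fun => //; exact: measurable_itv.
Qed.

Lemma stieltjesE u : stieltjes hA u =
  Rintegral stieltjes_pos `[0, 1]%classic u - Rintegral stieltjes_neg `[0, 1]%classic u.
Proof. by []. Qed.

Lemma stieltjes_eq u v : (forall t, 0 <= t <= 1 -> u t = v t) ->
  stieltjes hA u = stieltjes hA v.
Proof.
by move=> H; congr (_ - _); apply: eq_Rintegral => t; rewrite inE/= in_itv/=; exact: H.
Qed.

Lemma stieltjes_lin u v (l m : R) : stieltjes_regular u -> stieltjes_regular v ->
  stieltjes hA (fun t => l * u t + m * v t) = l * stieltjes hA u + m * stieltjes hA v.
Proof.
move=> hu hv.
have H (f : cumulative R R) : Rintegral (lebesgue_stieltjes_measure f) `[0, 1]%classic
    (fun t => l * u t + m * v t) =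
    l * Rintegral (lebesgue_stieltjes_measure f) `[0, 1]%classic u +
    m * Rintegral (lebesgue_stieltjes_measure f) `[0, 1]%classic v.
  have iu := stieltjes_regular_int f hu; have iv := stieltjes_regular_int f hv.
  by rewrite RintegralD//; [rewrite !RintegralZl|exact: intbZ|exact: intbZ].
have E1 := H (right_reg_cumulative (pos_tv_nd hA)).
have E2 := H (right_reg_cumulative (neg_tv_nd hA)).
transitivity ((l * Rintegral stieltjes_pos `[0, 1]%classic u +
    m * Rintegral stieltjes_pos `[0, 1]%classic v) -
  (l * Rintegral stieltjes_neg `[0, 1]%classic u +
    m * Rintegral stieltjes_neg `[0, 1]%classic v)).
  by congr (_ - _); [exact: E1|exact: E2].
by rewrite !stieltjesE !mulrBr opprD addrACA.
Qed.

Lemma stieltjes_close : exists2 V : R, 0 <= V & forall u v (e : R),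
  stieltjes_regular u -> stieltjes_regular v ->
  (forall t, 0 <= t <= 1 -> `|u t - v t| <= e) ->
  `|stieltjes hA u - stieltjes hA v| <= e * V.
Proof.
have H (f : cumulative R R) : exists2 V : R, 0 <= V & forall u v (e : R),
    stieltjes_regular u -> stieltjes_regular v ->
    (forall t, 0 <= t <= 1 -> `|u t - v t| <= e) ->
    `|Rintegral (lebesgue_stieltjes_measure f) `[0, 1]%classic u -
      Rintegral (lebesgue_stieltjes_measure f) `[0, 1]%classic v| <= e * V.
  exists (fine (lebesgue_stieltjes_measure f `[0, 1]%classic)).
    by apply: fine_ge0; exact: measure_ge0.
  move=> u v e hu hv uv.
  have iu := stieltjes_regular_int f hu; have iv := stieltjes_regular_int f hv.
  rewrite -RintegralB// -Rintegral_cst//.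
  apply: Rint_norm_le => //; first exact: intbB.
    apply: intb_cst => //; exact: lebesgue_stieltjes_itv01_lty.
  by apply: aeW => t; rewrite /= in_itv/=; exact: uv.
have [V1 V10 H1] := H (right_reg_cumulative (pos_tv_nd hA)).
have [V2 V20 H2] := H (right_reg_cumulative (neg_tv_nd hA)).
exists (V1 + V2); first exact: addr_ge0.
have sub4 (x y z w : R) : x - y - (z - w) = (x - z) + (w - y) by ring.
move=> u v e hu hv uv; rewrite !stieltjesE sub4 mulrDr.
apply: le_trans (ler_normD _ _) _; apply: lerD; first exact: H1.
by rewrite distrC; exact: H2.
Qed.

End StieltjesFacts.

(** * Lebesgue measurability along a continuous history *)

Section LebesgueMeasurability.
Variable R : realType.

Lemma lebesgue_measurable (B : set (measurableTypeR R)) :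
  measurable B -> measurable (B : set (lebesgueR R)).
Proof. exact: sub_caratheodory. Qed.

Lemma lebesgue_measurable_itv (i : interval R) :
  measurable ([set` i] : set (lebesgueR R)).
Proof. by apply: lebesgue_measurable; exact: measurable_itv. Qed.

Lemma lebesgue_complete : measure_is_complete (@lambda R).
Proof. exact: completed_lebesgue_measure_is_complete. Qed.

Lemma measurable_fun_index d (T : measurableType d) (D : set T) (c : T -> nat)
    (f : nat -> T -> R) : (forall i, measurable (D `&` c @^-1` [set i])) ->
  (forall i, measurable_fun D (f i)) -> measurable_fun D (fun s => f (c s) s).
Proof.
move=> mc mf mD Y mY.
rewrite (_ : _ `&` _ = \bigcup_i ((D `&` c @^-1` [set i]) `&` (D `&` f i @^-1` Y))).
  by apply: bigcup_measurable => i _; apply: measurableI => //; exact: mf.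
apply/seteqP; split=> [s [Ds Ys]|s [i _ [[Ds /= ci] [_ /= Ys]]]].
  by exists (c s).
by split => //=; rewrite ci.
Qed.

End LebesgueMeasurability.

Section AlmostEverywhereOn.
Variables (R : realType) (a b : R).
Implicit Types (P Q W : R -> Prop) (f g : R -> R).

#[local] Instance ae_lambda_filter : Filter (almost_everywhere (@lambda R)).
Proof. exact: ae_filter_ringOfSetsType. Qed.

Lemma ae_onW P : (forall s, a <= s <= b -> P s) -> ae_on a b P.
Proof. by move=> H; apply: aeW => s; rewrite /= in_itv/=; exact: H. Qed.

Lemma ae_onS P Q : (forall s, a <= s <= b -> P s -> Q s) -> ae_on a b P -> ae_on a b Q.
Proof.
move=> H; apply: (@filterS _ _ ae_lambda_filter) => s HP s01.
by apply: H; [move: s01; rewrite /= in_itv|exact: HP].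
Qed.

Lemma ae_onS2 P Q W : (forall s, a <= s <= b -> P s -> Q s -> W s) ->
  ae_on a b P -> ae_on a b Q -> ae_on a b W.
Proof.
move=> H; apply: (@filterS2 _ _ ae_lambda_filter) => s HP HQ s01.
by apply: H; [move: s01; rewrite /= in_itv|exact: HP|exact: HQ].
Qed.

Lemma ae_onS3 P Q W W' : (forall s, a <= s <= b -> P s -> Q s -> W s -> W' s) ->
  ae_on a b P -> ae_on a b Q -> ae_on a b W -> ae_on a b W'.
Proof.
move=> H HP HQ; apply: ae_onS2 (ae_onS2 (fun s _ => @conj _ _) HP HQ) => s s01 [HP' HQ'].
exact: H.
Qed.

Lemma ae_on_all (P : nat -> R -> Prop) : (forall n, ae_on a b (P n)) ->
  ae_on a b (fun s => forall n, P n s).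
Proof.
move=> /ae_foralln; apply: (@filterS _ _ ae_lambda_filter) => s H s01 n.
exact: H.
Qed.

Lemma ae_on_sub a' b' P : a <= a' -> b' <= b -> ae_on a b P -> ae_on a' b' P.
Proof.
move=> aa bb; apply: (@filterS _ _ ae_lambda_filter) => s H.
by rewrite /= in_itv/= => /andP[? ?]; apply: H; rewrite /= in_itv/=; lra.
Qed.

Definition integrable_on f := (@lambda R).-integrable `[a, b]%classic (EFin \o f).

Let mab : measurable (`[a, b]%classic : set (lebesgueR R)).
Proof. exact: lebesgue_measurable_itv. Qed.

Lemma integrable_on_meas f : integrable_on f -> lebesgue_measurable_fun `[a, b] f.
Proof. exact: intb_meas. Qed.

Lemma integrable_on_le f g : lebesgue_measurable_fun `[a, b] f -> integrable_on g ->
  ae_on a b (fun s => `|f s| <= g s) -> integrable_on f.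
Proof. exact: intb_le. Qed.

Lemma integrable_on_norm f : integrable_on f -> integrable_on (fun s => `|f s|).
Proof. exact: intb_norm. Qed.

Lemma integrable_onD f g : integrable_on f -> integrable_on g ->
  integrable_on (fun s => f s + g s).
Proof. exact: intbD. Qed.

Lemma integrable_onZ (l : R) f : integrable_on f -> integrable_on (fun s => l * f s).
Proof. exact: intbZ. Qed.

Lemma integrable_onM f h (M : R) : integrable_on f -> lebesgue_measurable_fun `[a, b] h ->
  ae_on a b (fun s => `|h s| <= M) -> integrable_on (fun s => f s * h s).
Proof. exact: intbM_bd. Qed.

Lemma integ_ae_eq f g : lebesgue_measurable_fun `[a, b] f ->
  lebesgue_measurable_fun `[a, b] g -> ae_on a b (fun s => f s = g s) ->
  integ a b f = integ a b g.
Proof. exact: Rint_ae_eq. Qed.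

Lemma integ_ae_le f g : integrable_on f -> integrable_on g ->
  ae_on a b (fun s => f s <= g s) -> integ a b f <= integ a b g.
Proof. exact: Rint_ae_le. Qed.

Lemma integ_ae_ge0 f : integrable_on f -> ae_on a b (fun s => 0 <= f s) ->
  0 <= integ a b f.
Proof. exact: Rint_ae_ge0. Qed.

Lemma integ_norm_le f g : integrable_on f -> integrable_on g ->
  ae_on a b (fun s => `|f s| <= g s) -> `|integ a b f| <= integ a b g.
Proof. exact: Rint_norm_le. Qed.

Lemma integD f g : integrable_on f -> integrable_on g ->
  integ a b (fun s => f s + g s) = integ a b f + integ a b g.
Proof. exact: RintegralD. Qed.

Lemma integB f g : integrable_on f -> integrable_on g ->
  integ a b (fun s => f s - g s) = integ a b f - integ a b g.
Proof. exact: RintegralB. Qed.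

Lemma integZ (l : R) f : integrable_on f ->
  integ a b (fun s => l * f s) = l * integ a b f.
Proof. exact: RintegralZl. Qed.

Lemma integ_dct (f_ : nat -> R -> R) f g :
  (forall n, lebesgue_measurable_fun `[a, b] (f_ n)) ->
  lebesgue_measurable_fun `[a, b] f -> integrable_on g ->
  ae_on a b (fun s => f_ ^~ s @ \oo --> f s) ->
  (forall n, ae_on a b (fun s => `|f_ n s| <= g s)) ->
  (fun n => integ a b (fun s => `|f_ n s - f s|)) @ \oo --> 0.
Proof. exact: Rint_dct. Qed.

Lemma integ_sub a' b' f : a <= a' -> b' <= b -> integrable_on f ->
  ae_on a b (fun s => 0 <= f s) -> integ a' b' f <= integ a b f.
Proof.
move=> aa bb If f0.
have sub : `[a', b']%classic `<=` (`[a, b]%classic : set R).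
  by move=> s; rewrite /= !in_itv/= => /andP[? ?]; lra.
have -> : integ a' b' f = integ a b (f \_ `[a', b']%classic).
  rewrite /integ Rintegral_mkcond [RHS]Rintegral_mkcond; congr (Rintegral _ _ _).
  apply/funext => s; rewrite !patchE; case: ifPn => s1; last by case: ifP.
  by rewrite mem_set//; apply: sub; rewrite inE in s1.
have mab' : measurable (`[a', b']%classic : set (lebesgueR R)).
  exact: lebesgue_measurable_itv.
have m' : lebesgue_measurable_fun `[a, b] (f \_ `[a', b']%classic).
  have H : @measurable_fun _ _ (lebesgueR R) R (`[a, b]%classic `&` `[a', b']%classic) f.
    by apply: measurable_funS (integrable_on_meas If) => // s [].
  have := (@measurable_restrict _ _ (lebesgueR R) R _ _ f mab' mab).1 H.
  exact.
apply: integ_ae_le => //.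
  apply: integrable_on_le m' (integrable_on_norm If) _; apply: ae_onW => s _.
  by rewrite patchE; case: ifP => // _; rewrite normr0.
by apply: ae_onS f0 => s _ fs; rewrite patchE; case: ifP.
Qed.

End AlmostEverywhereOn.

(** * The nonlinearity along the histories of a continuous function *)

Section DelayedNonlinearity.
Variables (R : realType) (r : R) (F : R -> (delay_itv r -> R) -> R).
Hypotheses (r0 : 0 < r) (C5 : hypC5 F).

Definition along (u : R -> R) (s : R) : R := F s (history u s).

(** The minimum keeps every node in [0, 1], so that histories at nodes make sense for all
    indices. *)
Let node (n i : nat) : R := Num.min 1 (i%:R / n.+1%:R).
Let cell (n : nat) (s : R) : nat := Num.truncn (n.+1%:R * s).

Let node01 n i : 0 <= node n i <= 1.
Proof. by rewrite /node le_min ler01 divr_ge0//= ge_min lexx. Qed.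

Let cell_node n s : 0 <= s <= 1 -> `|node n (cell n s) - s| <= n.+1%:R^-1.
Proof.
move=> /andP[s0 s1]; have n0 : (0 : R) < n.+1%:R by rewrite ltr0n.
have /truncn_itv/andP[c1 c2] : 0 <= n.+1%:R * s by rewrite mulr_ge0.
rewrite -/(cell n s) in c1 c2.
have d1 : (cell n s)%:R / n.+1%:R <= s by rewrite ler_pdivrMr// mulrC.
have d2 : s < (cell n s)%:R / n.+1%:R + n.+1%:R^-1.
  by rewrite -[X in _ + X]mul1r -mulrDl ltr_pdivlMr// natr1 [s * _]mulrC.
have -> : node n (cell n s) = (cell n s)%:R / n.+1%:R.
  by apply/min_idPr; exact: le_trans s1.
have i0 : (0 : R) < n.+1%:R^-1 by rewrite invr_gt0.
move: d1 d2 i0; set x := _ / _; set y := _^-1.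
by rewrite ler_norml => ? ? ?; apply/andP; split; lra.
Qed.

Let measurable_cell n i :
  measurable ((`[0, 1]%classic : set (lebesgueR R)) `&` cell n @^-1` [set i]).
Proof.
have n0 : (0 : R) < n.+1%:R by rewrite ltr0n.
rewrite (_ : _ `&` _ = (`[0, 1]%classic : set (lebesgueR R)) `&`
   `[(i%:R / n.+1%:R), (i.+1%:R / n.+1%:R)[%classic).
  by apply: measurableI; exact: lebesgue_measurable_itv.
apply/seteqP; split=> s [] s01; rewrite /= in_itv/= => H; split=> //;
  move: (s01); rewrite /= in_itv/= => /andP[s0 s1];
  have ns : 0 <= n.+1%:R * s by rewrite mulr_ge0.
  have /andP[c1 c2] := truncn_itv ns; rewrite -/(cell n s) H in c1 c2.
  by rewrite in_itv/= ler_pdivrMr// ltr_pdivlMr// [s * _]mulrC c1 c2.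
move: H => /andP[]; rewrite ler_pdivrMr// ltr_pdivlMr// [s * _]mulrC => c1 c2.
by apply/eqP; rewrite /cell truncn_eq// c1 c2.
Qed.

Lemma along_close (u : R -> R) : {within `[- r, 1], continuous u} ->
  forall (u_ : nat -> R -> R) (p_ : nat -> R) s, 0 <= s <= 1 ->
  (forall phi : delay_itv r -> R, continuous phi ->
     forall e : R, 0 < e -> exists2 d : R, 0 < d &
       forall phi' : delay_itv r -> R, continuous phi' ->
         sup_norm setT (phi' \- phi) < d -> `|F s phi' - F s phi| < e) ->
  (forall n, {within `[- r, 1], continuous (u_ n)}) ->
  (forall n, 0 <= p_ n <= 1) ->
  ucvg `[- r, 1] u_ u -> p_ @ \oo --> s ->
  (fun n => F s (history (u_ n) (p_ n))) @ \oo --> along u s.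
Proof.
move=> uc u_ p_ s s01 Fs uc_ p01 uu ps; apply/cvgrPdist_lt => e e0.
have [d d0 dP] := Fs _ (history_continuous uc s01) e e0.
have d4 : 0 < d / 4 by lra.
have [z z0 zP] := within_continuous_unif (@segment_compact R _ _) uc d4.
move/cvgrPdist_lt : ps => /(_ z z0) ps.
apply: filterS2 ps (uu _ d4) => n pn un; rewrite distrC.
apply: dP; first exact: history_continuous.
apply: (@le_lt_trans _ _ (d / 2)); last by lra.
apply: history_close => // th.
have D1 := delay_shift th (p01 n); have D2 := delay_shift th s01.
have A := un _ D1.
have B : `|u (p_ n + set_val th) - u (s + set_val th)| <= d / 4.
  apply: zP => //; rewrite (_ : _ - _ = p_ n - s); last ring.
  by rewrite distrC.
have := ler_distD (u (p_ n + set_val th)) (u_ n (p_ n + set_val th)) (u (s + set_val th)).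
lra.
Qed.

Let steps_cvg s : 0 <= s <= 1 -> (fun n => node n (cell n s)) @ \oo --> s.
Proof.
move=> s01; apply/cvgrPdist_le => e e0.
have := near_infty_natSinv_lt (PosNum e0); apply: filterS => n /= ne.
by rewrite distrC; apply: le_trans (cell_node n s01) (ltW ne).
Qed.

Let along_steps u : {within `[- r, 1], continuous u} ->
  ae_on 0 1 (fun s => (fun n => F s (history u (node n (cell n s)))) @ \oo --> along u s).
Proof.
move=> uc; have [_ _ + _] := C5; apply: ae_onS => s s01 H.
by apply: along_close => //; [exact: ucvg_cst|exact: steps_cvg].
Qed.

(** [F] is measurable in time for a fixed history only. The history is therefore frozen at the grid
    node of the current cell: this is measurable piece by piece, and it converges almost everywhere
    since histories vary continuously and [F] is continuous in them. *)
Lemma along_measurable u : {within `[- r, 1], continuous u} ->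
  lebesgue_measurable_fun `[0, 1] (along u).
Proof.
move=> uc; have [_ mF _ _] := C5.
apply: (ae_measurable_lim (@lebesgue_complete R) _ _ (along_steps uc)).
  exact: lebesgue_measurable_itv.
move=> n; apply: (@measurable_fun_index R _ (lebesgueR R) _ (cell n)
  (fun i s => F s (history u (node n i)))) => i; first exact: measurable_cell.
by apply: mF; exact: history_continuous.
Qed.

Lemma along_ge0 u s : {within `[- r, 1], continuous u} -> 0 <= s <= 1 ->
  0 <= along u s.
Proof.
by move=> uc s01; have [F0 _ _ _] := C5; apply: F0 => //; exact: history_continuous.
Qed.

(** The null set of the growth bound depends on the history, and [u] has uncountably many. The bound
    is used only for the countably many histories at nodes, then passed to the limit. *)
Lemma along_bounded (rho : R) : exists2 M : R, 0 <= M &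
  forall u, {within `[- r, 1], continuous u} ->
  (forall s, - r <= s <= 1 -> `|u s| <= rho) -> ae_on 0 1 (fun s => along u s <= M).
Proof.
have rho1 : 0 < `|rho| + 1 by rewrite ltr_wpDl.
have [_ _ _ /(_ _ rho1)[f [_ [M fM] fP]]] := C5.
exists `|M|; first exact: normr_ge0.
move=> u uc ub; have H : ae_on 0 1 (fun s => forall n i, F s (history u (node n i)) <= f s).
  apply: ae_on_all => n; apply: ae_on_all => i; apply: fP; first exact: history_continuous.
  apply: history_norm => // s /ub /le_trans; apply.
  by have := ler_norm rho; lra.
apply: ae_onS3 H fM (along_steps uc) => s _ H1 H2 H3.
apply: (cvgr_to_le H3); near=> n; apply: le_trans (H1 _ _) _.
apply: le_trans (ler_norm _) _; apply: le_trans H2 _; exact: ler_norm.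
Unshelve. all: by end_near. Qed.

Lemma along_cvg (u_ : nat -> R -> R) u : {within `[- r, 1], continuous u} ->
  (forall n, {within `[- r, 1], continuous (u_ n)}) -> ucvg `[- r, 1] u_ u ->
  ae_on 0 1 (fun s => (fun n => along (u_ n) s) @ \oo --> along u s).
Proof.
move=> uc uc_ uu; have [_ _ + _] := C5; apply: ae_onS => s s01 H.
by apply: (@along_close u uc u_ (fun=> s)) => //; exact: cvg_cst.
Qed.

End DelayedNonlinearity.

(** * The kernel *)

(** Bridges dominated convergence, which concerns sequences, and continuity in [t]. One good term
    per sequence is enough. *)
Lemma near_within_seq (R : realType) (D : set R) (Q : R -> Prop) (x : R) :
  (forall t_ : nat -> R, (forall n, D (t_ n)) -> t_ @ \oo --> x ->
    exists n, Q (t_ n)) -> \forall t \near x, D t -> Q t.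
Proof.
move=> H; apply: contrapT => nH.
have /choice[t_ tP] n : exists t, [/\ D t, `|x - t| < n.+1%:R^-1 & ~ Q t].
  apply: contrapT => nE; apply: nH; apply/nbhs_ballP.
  exists n.+1%:R^-1; first by rewrite /= invr_gt0.
  move=> t xt Dt; apply: contrapT => nQ; apply: nE; exists t; split=> //.
have [|n Qn] := H t_ (fun n => let: And3 Dt _ _ := tP n in Dt).
  apply/cvgrPdist_le => e e0; have := near_infty_natSinv_lt (PosNum e0).
  apply: filterS => n /= ne; have [_ xt _] := tP n.
  exact: ltW (lt_trans xt ne).
by have [] := tP n.
Qed.

Section KernelFubini.
Variables (R : realType) (r : R) (k : R -> R -> R) (A : R -> R).
Variable (hA : bounded_variation 0 1 A).
Hypotheses (r0 : 0 < r) (C2 : hypC2 r k).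

Lemma kernel_meas t : - r <= t <= 1 -> lebesgue_measurable_fun `[0, 1] (k t).
Proof.
move=> t1; have [mk _ _] := C2.
have mp : @measurable_fun _ _ (lebesgueR R) (measurableTypeR R * lebesgueR R)%type
    `[0, 1] (pair (t : measurableTypeR R)).
  apply: measurable_funS (pair1_measurable _) => //.
apply: (measurable_comp _ _ mk mp).
  by apply: measurableX; [exact: measurable_itv|exact: lebesgue_measurable_itv].
by move=> _ [s s01 <-]; split => //=; rewrite in_itv.
Qed.

Variables (q G : R -> R).
Hypotheses (mq : lebesgue_measurable_fun `[0, 1] q) (iG : integrable_on 0 1 G).
Hypothesis kqG : forall t, 0 <= t <= 1 -> ae_on 0 1 (fun s => `|k t s * q s| <= G s).

Let mkq : @measurable_fun _ _ (measurableTypeR R * lebesgueR R)%type R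
  (`[0, 1] `*` `[0, 1]) (fun p => k p.1 p.2 * q p.2).
Proof.
have [mk _ _] := C2.
have sub01 (x : R) : 0 <= x <= 1 -> - r <= x <= 1 by move=> /andP[x0 ->]; rewrite andbT (le_trans _ x0)// oppr_le0 ltW.
have m1 : measurable (`[0, 1]%classic : set (measurableTypeR R)) by exact: measurable_itv.
have mr : measurable (`[- r, 1]%classic : set (measurableTypeR R)) by exact: measurable_itv.
have m2 : measurable (`[0, 1]%classic : set (lebesgueR R)) by exact: lebesgue_measurable_itv.
apply: measurable_funM.
  apply: measurable_funS mk; first exact: measurableX.
  by move=> [t s] [/= t01 s01]; split => //=; move: t01; rewrite !in_itv/=; exact: sub01.
have msnd : @measurable_fun _ _ (measurableTypeR R * lebesgueR R)%type (lebesgueR R)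
    (`[0, 1] `*` `[0, 1]) snd by apply: measurable_funS measurable_snd.
apply: (@measurable_comp _ _ _ (measurableTypeR R * lebesgueR R)%type (lebesgueR R) R
  `[0, 1]%classic q _ snd m2 _ mq msnd).
by move=> _ [[t s] [_ /= s01] <-].
Qed.

Let kq_bd t : (`[0, 1]%classic : set R) t ->
  {ae (@lambda R), forall s, `[0, 1]%classic s -> `|k t s * q s| <= G s}.
Proof. by move=> t01; apply: kqG; move: t01; rewrite /= in_itv. Qed.

Let m01 : measurable (`[0, 1]%classic : set (measurableTypeR R)).
Proof. exact: measurable_itv. Qed.
Let l01 : measurable (`[0, 1]%classic : set (lebesgueR R)).
Proof. exact: lebesgue_measurable_itv. Qed.

Let lam : {sigma_finite_measure set (lebesgueR R) -> \bar R} := @lambda R.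

Let slice (f : cumulative R R) s :=
  Rintegral (lebesgue_stieltjes_measure f) `[0, 1]%classic (fun t => k t s * q s).

Let slice_int (f : cumulative R R) : integrable_on 0 1 (slice f).
Proof.
exact: (@box_integral_integrable _ _ (measurableTypeR R) (lebesgueR R) R
  (lebesgue_stieltjes_measure f) lam _ _ m01 l01 (lebesgue_stieltjes_itv01_lty f)
  (fun t s => k t s * q s) G mkq iG kq_bd).
Qed.

Let slice_fubini (f : cumulative R R) :
  Rintegral (lebesgue_stieltjes_measure f) `[0, 1]%classic
    (fun t => integ 0 1 (fun s => k t s * q s)) = integ 0 1 (slice f).
Proof.
exact: (@box_fubini _ _ (measurableTypeR R) (lebesgueR R) R
  (lebesgue_stieltjes_measure f) lam _ _ m01 l01 (lebesgue_stieltjes_itv01_lty f)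
  (fun t s => k t s * q s) G mkq iG kq_bd).
Qed.

Let sliceE (f : cumulative R R) : ae_on 0 1 (fun s => slice f s =
  Rintegral (lebesgue_stieltjes_measure f) `[0, 1]%classic (fun t => k t s) * q s).
Proof.
have H := @box_ae_integrable _ _ (measurableTypeR R) (lebesgueR R) R
  (lebesgue_stieltjes_measure f) lam _ _ m01 l01 (lebesgue_stieltjes_itv01_lty f)
  (fun t s => k t s * q s) G mkq iG kq_bd.
have {}H : ae_on 0 1 (fun s => (lebesgue_stieltjes_measure f).-integrable
  (`[0, 1]%classic : set (measurableTypeR R)) (EFin \o (fun t => k t s * q s))) by exact: H.
apply: ae_onS H => s _ H.
(* Only the product with [q s] is known to be integrable in [t]. Where [q s] is nonzero one divides
   by it; where it vanishes both sides are 0. *)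
have [q0|q0] := eqVneq (q s) 0.
  rewrite /slice q0 mulr0 (_ : (fun t => k t s * 0) = (fun=> 0)).
    by rewrite /Rintegral integral0.
  by apply/funext => t; rewrite mulr0.
rewrite /slice -RintegralZr//.
have := intbZ m01 (q s)^-1 H; congr (_.-integrable _ (EFin \o _)).
by apply/funext => t; rewrite mulrCA mulVf// mulr1.
Qed.

Let kernelAE : ae_on 0 1 (fun s =>
  slice (right_reg_cumulative (pos_tv_nd hA)) s -
  slice (right_reg_cumulative (neg_tv_nd hA)) s = kernelA k hA s * q s).
Proof.
apply: ae_onS2 (sliceE (right_reg_cumulative (pos_tv_nd hA)))
  (sliceE (right_reg_cumulative (neg_tv_nd hA))) => s _ -> ->.
by rewrite -mulrBl.
Qed.

Let slice_diff : integrable_on 0 1 (fun s =>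
  slice (right_reg_cumulative (pos_tv_nd hA)) s +
  (-1) * slice (right_reg_cumulative (neg_tv_nd hA)) s).
Proof. by apply: integrable_onD; [|apply: integrable_onZ]; exact: slice_int. Qed.

Let slice_diffE : ae_on 0 1 (fun s =>
  slice (right_reg_cumulative (pos_tv_nd hA)) s +
  (-1) * slice (right_reg_cumulative (neg_tv_nd hA)) s = kernelA k hA s * q s).
Proof. by apply: ae_onS kernelAE => s _ <-; rewrite mulN1r. Qed.

(** The product agrees almost everywhere with a measurable difference of slices, and the measure is
    complete; measurability of [kernelA] by itself is not claimed. *)
Let mKA : lebesgue_measurable_fun `[0, 1] (fun s => kernelA k hA s * q s).
Proof.
apply: (ae_measurable_real (@lebesgue_complete R) (integrable_on_meas slice_diff)).
exact: slice_diffE.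
Qed.

Lemma kernelA_integrable : integrable_on 0 1 (fun s => kernelA k hA s * q s).
Proof.
apply: integrable_on_le mKA (integrable_on_norm slice_diff) _.
by apply: ae_onS slice_diffE => s _ ->.
Qed.

Lemma stieltjes_kernel : stieltjes hA (fun t => integ 0 1 (fun s => k t s * q s)) =
  integ 0 1 (fun s => kernelA k hA s * q s).
Proof.
rewrite -(integ_ae_eq (integrable_on_meas slice_diff) mKA slice_diffE).
rewrite integD; [|exact: slice_int|apply: integrable_onZ; exact: slice_int].
rewrite integZ; last exact: slice_int.
rewrite mulN1r.
exact: (congr2 (fun x y => x - y) (slice_fubini (right_reg_cumulative (pos_tv_nd hA)))
  (slice_fubini (right_reg_cumulative (neg_tv_nd hA)))).
Qed.

End KernelFubini.

(** * The linear part of the equation *)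

Lemma subrDD (R : zmodType) (x y z w : R) : x + y - (z + w) = (x - z) + (y - w).
Proof. by rewrite opprD addrACA. Qed.

Section HammersteinOperator.
Variables (R : realType) (r : R) (k : R -> R -> R) (g : R -> R) (gamma : R -> R).
Variables (A : R -> R) (hA : bounded_variation 0 1 A).
Variables (Phi : R -> R) (a b c1 c2 : R).
Hypotheses (C2 : hypC2 r k) (C3 : hypC3 k Phi a b c1) (C4 : hypC4 g Phi a b).
Hypotheses (C6 : hypC6 k hA) (C7 : hypC7 r gamma hA a b c2) (C8 : hypC8 r a b).

Let al := stieltjes hA gamma.
Let r0 : 0 < r. Proof. by case/andP: C8. Qed.
Let al1 : 0 < 1 - al.
Proof. by have [_ _ /andP[_ ?] _ _] := C7; rewrite subr_gt0. Qed.
Let a0 : 0 < a. Proof. by have [[] ? ? ?] := C3. Qed.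
Let ab : a <= b. Proof. by have [[] ? ? ?] := C3. Qed.
Let b1 : b <= 1. Proof. by have [[] ? ? ?] := C3. Qed.
Let mg : lebesgue_measurable_fun `[0, 1] g. Proof. by case: C4. Qed.
Let g0 : ae_on 0 1 (fun s => 0 <= g s). Proof. by case: C4. Qed.
Let Phi0 : ae_on 0 1 (fun s => 0 <= Phi s). Proof. by case: C3 => _ []. Qed.
Let gamma_cont : {within `[- r, 1], continuous gamma}. Proof. by case: C7 => -[]. Qed.

Let in01 t : a <= t <= b -> 0 <= t <= 1.
Proof. by move=> /andP[? ?]; apply/andP; split; [apply: le_trans (ltW a0) _|apply: le_trans b1]. Qed.

Let inr1 t : 0 <= t <= 1 -> - r <= t <= 1.
Proof. by move=> /andP[t0 ->]; rewrite andbT (le_trans _ t0)// oppr_le0 ltW. Qed.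

Let igPhi : integrable_on 0 1 (fun s => g s * Phi s). Proof. by case: C4. Qed.

Let kg_le t : - r <= t <= 1 -> ae_on 0 1 (fun s => `|k t s * g s| <= g s * Phi s).
Proof.
move=> /andP[t1 t2]; have [t0|t0] := leP t 0.
  have [_ k0 _] := C2; have := k0 t; rewrite t1 t0 => /(_ isT) kt.
  apply: ae_onS3 kt g0 Phi0 => s _ -> gs Ps.
  by rewrite mul0r normr0 mulr_ge0.
have [_ _ _ kP _] := C3; have := kP t; rewrite (ltW t0) t2 => /(_ isT) kt.
apply: ae_onS2 kt g0 => s _ ks gs.
by rewrite normrM (ger0_norm gs) mulrC ler_wpM2l.
Qed.

Let ikg t : - r <= t <= 1 -> integrable_on 0 1 (fun s => k t s * g s).
Proof.
move=> t1; apply: integrable_on_le igPhi (kg_le t1).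
by apply: measurable_funM => //; exact: (kernel_meas C2).
Qed.

Let iKg : integrable_on 0 1 (fun s => kernelA k hA s * g s).
Proof. by apply: (kernelA_integrable hA r0 C2 mg igPhi) => t /inr1; exact: kg_le. Qed.

Let Kg0 : ae_on 0 1 (fun s => 0 <= kernelA k hA s * g s).
Proof. by apply: ae_onS2 C6 g0 => s _; exact: mulr_ge0. Qed.

(** [h] stands for the nonlinearity along a history, so that what follows is linear in [h]. *)
Definition admissible (M : R) (h : R -> R) :=
  lebesgue_measurable_fun `[0, 1] h /\ ae_on 0 1 (fun s => 0 <= h s <= M).

Definition lin_kernel (h : R -> R) (t : R) := integ 0 1 (fun s => k t s * g s * h s).
Definition lin_mass (h : R -> R) := integ 0 1 (fun s => kernelA k hA s * g s * h s).
Definition lin_op (h : R -> R) (t : R) :=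
  lin_kernel h t + gamma t / (1 - stieltjes hA gamma) * lin_mass h.

Definition modulus (t t' : R) := integ 0 1 (fun s => `|k t s * g s - k t' s * g s|).

Lemma modulus_int t t' : - r <= t <= 1 -> - r <= t' <= 1 ->
  integrable_on 0 1 (fun s => `|k t s * g s - k t' s * g s|).
Proof.
move=> ht ht'; apply: integrable_on_norm.
have := integrable_onD (ikg ht) (integrable_onZ (-1) (ikg ht')).
by congr (integrable_on _ _ _); apply/funext => s; rewrite mulN1r.
Qed.

Lemma modulus_ge0 t t' : 0 <= modulus t t'.
Proof. by apply: Rintegral_ge0 => s _. Qed.

(** Dominated convergence under [g * Phi]. Continuity of the kernel in [t] is given at times of
    [0, 1] only; around a negative time the kernel vanishes instead. *)
Lemma modulus_cont t : `[- r, 1]%classic t -> forall e : R, 0 < e ->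
  \forall s \near t, `[- r, 1]%classic s -> modulus t s <= e.
Proof.
rewrite /= in_itv/= => t1 e e0; apply: near_within_seq => t_ t_1 tt.
have {}t_1 n : - r <= t_ n <= 1 by have := t_1 n; rewrite /= in_itv.
have H : (fun n => integ 0 1 (fun s => `|k (t_ n) s * g s - k t s * g s|)) @ \oo --> 0.
  apply: integ_dct igPhi _ _.
  - by move=> n; exact/integrable_on_meas/ikg.
  - exact/integrable_on_meas/ikg.
  - have [t0|t0] := leP 0 t.
      have [_ _ kc] := C2; have := kc t; rewrite t0; case/andP: (t1) => _ -> /(_ isT).
      apply: ae_onS => s _ ks; apply: cvgMl.
      apply/cvgrPdist_le => d d0; have /cvgrPdist_le/(_ d d0) := ks.
      move=> N; have {}N : \forall n \near \oo, `[- r, 1]%classic (t_ n) ->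
          `|0 - `|k (t_ n) s - k t s| | <= d by exact: tt _ N.
      apply: filterS N => n /=; rewrite in_itv/= t_1 => /(_ isT).
      by rewrite sub0r normrN normr_id distrC.
    have [_ k0 _] := C2.
    have kt0 : ae_on 0 1 (fun s => k t s = 0) by apply: k0; case/andP: t1 => -> _; exact: ltW.
    have ktn : ae_on 0 1 (fun s => forall n, t_ n <= 0 -> k (t_ n) s = 0).
      apply: ae_on_all => n; have [tn|tn] := leP (t_ n) 0.
        have := k0 (t_ n); rewrite tn; case/andP: (t_1 n) => -> _ /(_ isT).
        by apply: ae_onS => s _ ->.
      by apply: ae_onW.
    apply: ae_onS2 kt0 ktn => s _ kt kn; rewrite kt mul0r.
    apply/cvgrPdist_le => d d0.
    have Nt : \forall n \near \oo, t_ n < 0.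
      have t0' : 0 < - t by rewrite oppr_gt0.
      have /cvgrPdist_lt/(_ _ t0') := tt; apply: filterS => n.
      by rewrite ltr_norml => /andP[]; lra.
    apply: filterS Nt => n tn.
    by rewrite (kn _ (ltW tn)) mul0r subr0 normr0 ltW.
  - by move=> n; exact: kg_le.
have /cvgrPdist_le/(_ e e0) [N _ /(_ N (leqnn _))] := H.
rewrite sub0r normrN ger0_norm; last by apply: Rintegral_ge0.
move=> HN; exists N; apply: le_trans HN; rewrite le_eqVlt; apply/orP; left; apply/eqP.
by rewrite /modulus; congr (integ _ _ _); apply/funext => s; rewrite distrC.
Qed.

Section Admissible.
Variables (M : R) (h : R -> R).
Hypothesis admh : admissible M h.

Let mh : lebesgue_measurable_fun `[0, 1] h. Proof. by case: admh. Qed.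
Let hM : ae_on 0 1 (fun s => `|h s| <= M).
Proof. by case: admh => _; apply: ae_onS => s _ /andP[h0 ?]; rewrite ger0_norm. Qed.
Let h0 : ae_on 0 1 (fun s => 0 <= h s).
Proof. by case: admh => _; apply: ae_onS => s _ /andP[]. Qed.

Lemma lin_kernel_int t : - r <= t <= 1 -> integrable_on 0 1 (fun s => k t s * g s * h s).
Proof. by move=> t1; apply: integrable_onM (ikg t1) mh hM. Qed.

Lemma lin_mass_int : integrable_on 0 1 (fun s => kernelA k hA s * g s * h s).
Proof. exact: integrable_onM iKg mh hM. Qed.

Lemma gPhih_int : integrable_on 0 1 (fun s => g s * Phi s * h s).
Proof. exact: integrable_onM igPhi mh hM. Qed.

Lemma lin_mass_ge0 : 0 <= lin_mass h.
Proof.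
apply: integ_ae_ge0; first exact: lin_mass_int.
by apply: ae_onS2 Kg0 h0 => s _; exact: mulr_ge0.
Qed.

Lemma lin_mass_le : lin_mass h <= M * integ 0 1 (fun s => kernelA k hA s * g s).
Proof.
rewrite -integZ//; apply: integ_ae_le; [exact: lin_mass_int|exact: integrable_onZ|].
apply: ae_onS3 Kg0 h0 hM => s _ Ks hs hsM.
by rewrite [leRHS]mulrC ler_wpM2l// -(ger0_norm hs).
Qed.

Lemma lin_kernel_le t : - r <= t <= 1 ->
  `|lin_kernel h t| <= integ 0 1 (fun s => g s * Phi s * h s).
Proof.
move=> t1; apply: integ_norm_le; [exact: lin_kernel_int|exact: gPhih_int|].
apply: ae_onS2 (kg_le t1) h0 => s _ ks hs.
by rewrite normrM (ger0_norm hs) ler_wpM2r.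
Qed.

Lemma lin_kernel_ge t : a <= t <= b ->
  c1 * integ 0 1 (fun s => g s * Phi s * h s) <= lin_kernel h t.
Proof.
move=> tab; rewrite -integZ; last exact: gPhih_int.
apply: integ_ae_le; [exact/integrable_onZ/gPhih_int|exact/lin_kernel_int/inr1/in01|].
have [_ _ _ _ /(_ t tab) kt] := C3.
apply: ae_onS3 kt g0 h0 => s _ ks gs hs.
rewrite mulrA ler_wpM2r// mulrCA [leRHS]mulrC; exact: ler_wpM2l.
Qed.

Lemma lin_op_zero t : - r <= t <= 0 -> lin_op h t = 0.
Proof.
move=> t0; have [_ gz _ _ _] := C7; have [_ kz _] := C2.
rewrite /lin_op gz// mul0r mul0r addr0 /lin_kernel.
have t1 : - r <= t <= 1 by case/andP: t0 => -> /= /le_trans; apply.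
rewrite (@integ_ae_eq _ _ _ _ (fun=> 0)).
- by rewrite /integ /Rintegral integral0.
- exact/integrable_on_meas/lin_kernel_int.
- exact: measurable_cst.
- by apply: ae_onS (kz _ t0) => s _ ->; rewrite !mul0r.
Qed.

Lemma lin_op_modulus t t' : - r <= t <= 1 -> - r <= t' <= 1 ->
  `|lin_op h t - lin_op h t'| <=
    M * modulus t t' + lin_mass h / (1 - al) * `|gamma t - gamma t'|.
Proof.
move=> ht ht'; rewrite /lin_op subrDD -mulrBl -mulrBl.
apply: le_trans (ler_normD _ _) _; apply: lerD; last first.
  rewrite !normrM (ger0_norm lin_mass_ge0) [ `|_^-1|]gtr0_norm ?invr_gt0//.
  by rewrite -mulrA mulrC [X in X * _]mulrC.
have <- : integ 0 1 (fun s => k t s * g s * h s - k t' s * g s * h s) =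
    lin_kernel h t - lin_kernel h t' by rewrite integB//; exact: lin_kernel_int.
rewrite -integZ; last exact: modulus_int.
apply: integ_norm_le; last 2 first.
- exact/integrable_onZ/modulus_int.
- apply: ae_onS hM => s _ hs; rewrite -mulrBl normrM mulrC.
  by rewrite ler_wpM2r.
- have := integrable_onD (lin_kernel_int ht) (integrable_onZ (-1) (lin_kernel_int ht')).
  by congr (integrable_on _ _ _); apply/funext => s; rewrite mulN1r.
Qed.

Lemma lin_op_continuous : {within `[- r, 1], continuous (lin_op h)}.
Proof.
have M0 : 0 <= `|M| by [].
apply/within_continuousP => t t1 e e0.
pose m := lin_mass h / (1 - al).
have m0 : 0 <= m by apply: divr_ge0; [exact: lin_mass_ge0|exact: ltW].
have Mp : 0 < `|M| + 1 by rewrite ltr_wpDl.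
have mp : 0 < m + 1 by rewrite ltr_wpDl.
have e2 : 0 < e / 2 by lra.
have /within_continuousP gc := gamma_cont.
apply: filterS2 (modulus_cont t1 (divr_gt0 e2 Mp)) (gc t t1 _ (divr_gt0 e2 mp)).
move=> s H1 H2 s1; have {}H1 := H1 s1; have {}H2 := H2 s1.
move: t1 s1; rewrite /= !in_itv/= => t1 s1.
apply: le_trans (lin_op_modulus t1 s1) _; rewrite [e]splitr; apply: lerD.
  rewrite -[leRHS](divfK (lt0r_neq0 Mp)) mulrC.
  apply: le_trans (ler_wpM2r _ H1); last by rewrite ltW.
  apply: ler_wpM2l; first exact: modulus_ge0.
  by have := ler_norm M; lra.
rewrite -[leRHS](divfK (lt0r_neq0 mp)) mulrC.
apply: le_trans (ler_wpM2r _ H2); last by rewrite ltW.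
by apply: ler_wpM2l => //; rewrite /m lerDl.
Qed.

(** By Fubini, alpha of the kernel part is [lin_mass h], and x + al x / (1 - al) = x / (1 - al). So
    the coefficient of [gamma] in [lin_op h] is exactly alpha of [lin_op h]. *)
Lemma lin_op_stieltjes : stieltjes hA (lin_op h) = lin_mass h / (1 - al).
Proof.
have mgh : lebesgue_measurable_fun `[0, 1] (fun s => g s * h s) by exact: measurable_funM.
have bd t : 0 <= t <= 1 -> ae_on 0 1 (fun s => `|k t s * (g s * h s)| <= g s * Phi s * h s).
  move=> /inr1 t1; apply: ae_onS2 (kg_le t1) h0 => s _ ks hs.
  by rewrite mulrA normrM (ger0_norm hs) ler_wpM2r.
have E := stieltjes_kernel hA r0 C2 mgh gPhih_int bd.
have E1 : stieltjes hA (lin_kernel h) = lin_mass h.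
  rewrite /lin_mass (_ : (fun s => kernelA k hA s * g s * h s) =
    (fun s => kernelA k hA s * (g s * h s))); last by apply/funext => s; rewrite mulrA.
  rewrite -E; apply: stieltjes_eq => t _; congr (integ _ _ _).
  by apply/funext => s; rewrite mulrA.
have reg u := @stieltjes_regular_cont R r u r0.
pose m := lin_mass h / (1 - al).
have rk : stieltjes_regular (lin_kernel h).
  have rL := reg _ lin_op_continuous; have rg := reg _ gamma_cont.
  (* Regularity of the kernel part is inherited from two functions already known to be
     continuous. *)
  have -> : lin_kernel h = (fun t => lin_op h t - m * gamma t).
    by apply/funext => t; rewrite /lin_op /m /al; ring.
  have [mL [K1 L1]] := rL; have [mG [K2 L2]] := rg; split.
    by apply: measurable_funB => //; apply: measurable_funM => //; exact: measurable_cst.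
  exists (K1 + `|m| * K2) => t t01; apply: le_trans (ler_normB _ _) _.
  by apply: lerD; [exact: L1|rewrite normrM ler_wpM2l// L2].
have -> : lin_op h = (fun t => 1 * lin_kernel h t + m * gamma t).
  by apply/funext => t; rewrite /lin_op /m /al; ring.
rewrite stieltjes_lin//; last exact: reg.
rewrite E1 -/al /m mul1r.
rewrite -{1}[lin_mass h](divfK (lt0r_neq0 al1)) -mulrDr.
by rewrite subrK mulr1.
Qed.

(** Each summand obeys the inequality. The integral of [g * Phi * h] bounds the kernel part at [t']
    from above and, times [c1], the one at [t] from below; the norm of [gamma] and [c2] do the same
    for the other summand. *)
Lemma lin_op_cone t t' : a <= t <= b -> 0 <= t' <= 1 ->
  cst_c c1 c2 * `|lin_op h t'| <= lin_op h t.
Proof.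
move=> tab t1'; have [_ _ /andP[c10 c11] _ _] := C3.
have [_ _ _ /andP[c20 c21] gab] := C7.
have c_gt0 : 0 < cst_c c1 c2 by rewrite lt_min c10.
have J0 := lin_mass_ge0.
have I0 : 0 <= integ 0 1 (fun s => g s * Phi s * h s).
  exact: le_trans (normr_ge0 _) (lin_kernel_le (inr1 t1')).
have gn : `|gamma t'| <= sup_norm `[0, 1] gamma.
  have [K gK] := within_continuous_bounded (@segment_compact R _ _) gamma_cont.
  apply: (@sup_on_ub _ _ `[0, 1]%classic (fun t => `|gamma t|) _ K).
    by move=> s; rewrite /= in_itv/= => /inr1 s1; apply: gK; rewrite /= in_itv.
  by rewrite /= in_itv.
have N0 := le_trans (normr_ge0 _) gn.
apply: (@le_trans _ _ (cst_c c1 c2 * integ 0 1 (fun s => g s * Phi s * h s) +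
   cst_c c1 c2 * sup_norm `[0, 1] gamma / (1 - al) * lin_mass h)).
  rewrite -mulrA -mulrA -mulrDr ler_pM2l//.
  apply: le_trans (ler_normD _ _) _; apply: lerD; first exact/lin_kernel_le/inr1.
  rewrite !normrM (ger0_norm J0) [ `|_^-1|]gtr0_norm ?invr_gt0// -mulrA.
  by apply: ler_wpM2r => //; rewrite mulr_ge0// invr_ge0 ltW.
apply: lerD.
  apply: le_trans (lin_kernel_ge tab); apply: ler_wpM2r => //.
  by rewrite ge_min lexx.
apply: ler_wpM2r => //; apply: ler_wpM2r; first by rewrite invr_ge0 ltW.
apply: le_trans (gab t tab); apply: ler_wpM2r => //.
by rewrite ge_min lexx orbT.
Qed.

Lemma lin_op_upper t : - r <= t <= 1 -> `|lin_op h t| <=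
  M * (integ 0 1 (fun s => `|k t s| * g s)
   + `|gamma t| / (1 - stieltjes hA gamma) * integ 0 1 (fun s => kernelA k hA s * g s)).
Proof.
move=> t1; rewrite mulrDr; apply: le_trans (ler_normD _ _) _.
have ikn : integrable_on 0 1 (fun s => `|k t s| * g s).
  apply: integrable_on_le (integrable_on_norm (ikg t1)) _.
    apply: measurable_funM; last exact: mg.
    exact: (measurableT_comp (@normr_measurable R setT) (kernel_meas C2 t1)).
  by apply: ae_onS g0 => s _ gs; rewrite !normrM normr_id.
apply: lerD.
  rewrite -integZ//; apply: integ_norm_le; [exact: lin_kernel_int|exact: integrable_onZ|].
  apply: ae_onS2 g0 hM => s _ gs hs; rewrite !normrM (ger0_norm gs) mulrC.
  by apply: ler_wpM2r => //; rewrite mulr_ge0.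
rewrite normrM (ger0_norm lin_mass_ge0) normrM [ `|_^-1|]gtr0_norm ?invr_gt0//.
rewrite mulrCA ler_wpM2l//; last exact: lin_mass_le.
by rewrite divr_ge0// ltW.
Qed.

(** For [t] in [a, b] the integrands over [0, 1] are nonnegative, so the part outside [a + r, b] may
    be dropped. *)
Lemma lin_op_lower t (m : R) : a <= t <= b -> 0 <= m ->
  ae_on (a + r) b (fun s => m <= h s) ->
  m * (integ (a + r) b (fun s => k t s * g s)
   + gamma t / (1 - stieltjes hA gamma) * integ (a + r) b (fun s => kernelA k hA s * g s))
  <= lin_op h t.
Proof.
move=> tab m0 mh'; have t01 := in01 tab; have tr := inr1 t01.
have [_ _ /andP[c10 _] _ /(_ t tab) kt] := C3.
have [_ _ _ /andP[c20 c21] gab] := C7.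
have gt0 : 0 <= gamma t.
  apply: le_trans (gab t tab); rewrite mulr_ge0 ?(ltW c20)//.
  have [K gK] := within_continuous_bounded (@segment_compact R _ _) gamma_cont.
  apply: le_trans (normr_ge0 (gamma 0)) _.
  apply: (@sup_on_ub _ _ `[0, 1]%classic (fun t => `|gamma t|) _ K).
    by move=> s; rewrite /= in_itv/= => /inr1 s1; apply: gK; rewrite /= in_itv.
  by rewrite /= in_itv/= lexx ler01.
have ar0 : 0 <= a + r by apply: addr_ge0; exact: ltW.
have kg0 : ae_on 0 1 (fun s => 0 <= k t s * g s).
  apply: ae_onS3 kt g0 Phi0 => s _ ks gs Ps; rewrite mulr_ge0//.
  by apply: le_trans ks; rewrite mulr_ge0// ltW.
have sub f : integrable_on 0 1 f -> ae_on 0 1 (fun s => 0 <= f s) ->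
    integrable_on 0 1 (fun s => f s * h s) ->
    m * integ (a + r) b f <= integ 0 1 (fun s => f s * h s).
  move=> If f0 Ifh.
  have S f' : integrable_on 0 1 f' -> integrable_on (a + r) b f'.
    apply: integrableS; [exact: lebesgue_measurable_itv|exact: lebesgue_measurable_itv|].
    by move=> s; rewrite /= !in_itv/= => /andP[? ?]; have := b1; lra.
  rewrite -integZ; last exact: S.
  apply: le_trans (_ : integ (a + r) b (fun s => f s * h s) <= _).
    apply: integ_ae_le; [exact/integrable_onZ/S|exact: S|].
    apply: ae_onS2 (ae_on_sub ar0 b1 f0) mh' => s _ fs ms.
    by rewrite mulrC ler_wpM2l.
  apply: integ_sub => //.
  by apply: ae_onS2 f0 h0 => s _; exact: mulr_ge0.
rewrite mulrDr; apply: lerD; first exact: sub (ikg tr) kg0 (lin_kernel_int tr).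
rewrite mulrCA ler_wpM2l//; last exact: sub iKg Kg0 lin_mass_int.
by rewrite divr_ge0// ltW.
Qed.

End Admissible.

(** [g * Phi] dominates the kernel for every [t], which gives the bound [e_], independent of [t],
    and so uniform convergence. *)
Lemma lin_op_cvg (M : R) (h_ : nat -> R -> R) h : (forall n, admissible M (h_ n)) ->
  admissible M h -> ae_on 0 1 (fun s => h_ ^~ s @ \oo --> h s) ->
  ucvg `[- r, 1] (fun n => lin_op (h_ n)) (lin_op h).
Proof.
move=> ah_ ah hh.
have dct f : integrable_on 0 1 f -> ae_on 0 1 (fun s => 0 <= f s) ->
    (fun n => integ 0 1 (fun s => `|f s * h_ n s - f s * h s|)) @ \oo --> 0.
  move=> If f0.
  have I h' : admissible M h' -> integrable_on 0 1 (fun s => f s * h' s).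
    move=> [mh' hM']; apply: (integrable_onM (M := M) If mh').
    by apply: ae_onS hM' => s _ /andP[h0 ?]; rewrite ger0_norm.
  apply: (integ_dct _ _ (integrable_onZ M If)).
  - by move=> n; exact/integrable_on_meas/I.
  - exact/integrable_on_meas/I.
  - by apply: ae_onS hh => s _ hs; apply: cvgM hs; exact: cvg_cst.
  - move=> n; have [_ hM'] := ah_ n; apply: ae_onS2 f0 hM' => s _ fs /andP[h0 hM].
    by rewrite normrM !ger0_norm// mulrC ler_wpM2r.
have gPhi0 : ae_on 0 1 (fun s => 0 <= g s * Phi s).
  by apply: ae_onS2 g0 Phi0 => s _; exact: mulr_ge0.
have Ig h' : admissible M h' -> integrable_on 0 1 (fun s => g s * Phi s * h' s).
  exact: gPhih_int.
have Id (f u v : R -> R) : integrable_on 0 1 (fun s => f s * u s) ->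
    integrable_on 0 1 (fun s => f s * v s) ->
    integrable_on 0 1 (fun s => f s * u s - f s * v s).
  move=> Iu Iv; have := integrable_onD Iu (integrable_onZ (-1) Iv).
  by congr (integrable_on _ _ _); apply/funext => s; rewrite mulN1r.
have [G gG] := within_continuous_bounded (@segment_compact R _ _) gamma_cont.
pose Q := G / (1 - al).
pose e_ n := integ 0 1 (fun s => `|g s * Phi s * h_ n s - g s * Phi s * h s|) +
  Q * integ 0 1 (fun s => `|kernelA k hA s * g s * h_ n s - kernelA k hA s * g s * h s|).
have e_cvg : e_ @ \oo --> 0.
  rewrite -[X in _ --> X](_ : 0 + Q * 0 = 0); last by rewrite mulr0 addr0.
  apply: cvgD; first exact: dct igPhi gPhi0.
  by apply: cvgM; [exact: cvg_cst|exact: dct iKg Kg0].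
move=> e e0; have /cvgrPdist_le/(_ e e0) := e_cvg; apply: filterS => n.
rewrite sub0r normrN => en t t1; apply: le_trans (le_trans (ler_norm _) en).
move: (t1); rewrite /= in_itv/= => t1'.
have ahn := ah_ n.
rewrite /lin_op subrDD -mulrBr.
apply: le_trans (ler_normD _ _) _; apply: lerD.
  rewrite /lin_kernel -integB; [|exact: lin_kernel_int ahn _ t1'|exact: lin_kernel_int ah _ t1'].
  apply: integ_norm_le.
  - by apply: Id; [exact: lin_kernel_int ahn _ t1'|exact: lin_kernel_int ah _ t1'].
  - by apply: integrable_on_norm; apply: Id; exact: Ig.
  - apply: ae_onS2 (kg_le t1') gPhi0 => s _ ks gs.
    by rewrite -!mulrBr normrM [leRHS]normrM [ `|g s * Phi s|]ger0_norm// ler_wpM2r.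
rewrite normrM; apply: ler_pM => //.
  rewrite normrM [ `|_^-1|]gtr0_norm ?invr_gt0//.
  by apply: ler_wpM2r; [rewrite invr_ge0 ltW|exact: gG].
rewrite /lin_mass -integB; [|exact: lin_mass_int ahn|exact: lin_mass_int ah].
apply: integ_norm_le.
- by apply: Id; [exact: lin_mass_int ahn|exact: lin_mass_int ah].
- by apply: integrable_on_norm; apply: Id; [exact: lin_mass_int ahn|exact: lin_mass_int ah].
- exact: ae_onW.
Qed.

(** At time [b] the kernel is at least [c1 * Phi]. Positivity of 1/m is what makes [I1] exclude an
    infinite [F_up]. *)
Lemma inv_m_term_gt0 : 0 < integ 0 1 (fun s => `|k b s| * g s)
   + `|gamma b| / (1 - stieltjes hA gamma) * integ 0 1 (fun s => kernelA k hA s * g s).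
Proof.
have bab : a <= b <= b by rewrite ab lexx.
have br := inr1 (in01 bab).
have [_ _ /andP[c10 _] _ /(_ b bab) kb] := C3; have [_ _ _ gPhi_gt0] := C4.
have gPhi0 : ae_on 0 1 (fun s => 0 <= g s * Phi s).
  by apply: ae_onS2 g0 Phi0 => s _; exact: mulr_ge0.
apply: ltr_wpDr.
  apply: mulr_ge0; last by apply: integ_ae_ge0 iKg Kg0.
  by rewrite divr_ge0// ltW.
have ikn : integrable_on 0 1 (fun s => `|k b s| * g s).
  apply: integrable_on_le (integrable_on_norm (ikg br)) _.
    apply: measurable_funM; last exact: mg.
    exact: (measurableT_comp (@normr_measurable R setT) (kernel_meas C2 br)).
  by apply: ae_onS g0 => s _ gs; rewrite !normrM normr_id.
have : c1 * integ 0 1 (fun s => g s * Phi s) <= integ 0 1 (fun s => `|k b s| * g s).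
  rewrite -integZ//; apply: integ_ae_le => //; first exact: integrable_onZ.
  apply: ae_onS2 kb g0 => s _ ks gs; rewrite mulrCA mulrC ler_wpM2r//.
  exact: le_trans ks (ler_norm _).
apply: lt_le_trans; rewrite mulr_gt0//; apply: (lt_le_trans gPhi_gt0).
have -> : (fun s => Phi s * g s) = (fun s => g s * Phi s).
  by apply/funext => s; rewrite mulrC.
by apply: integ_sub igPhi gPhi0 => //; exact: ltW.
Qed.

End HammersteinOperator.

(** * The delayed equation *)

Section DelayedHammerstein.
Variables (R : realType) (r : R) (psi : R -> R) (k : R -> R -> R) (g : R -> R).
Variables (F : R -> (delay_itv r -> R) -> R) (gamma : R -> R).
Variables (A : R -> R) (hA : bounded_variation 0 1 A).
Variables (Phi : R -> R) (a b c1 c2 : R).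
Hypotheses (C1 : hypC1 r psi) (C2 : hypC2 r k) (C3 : hypC3 k Phi a b c1).
Hypotheses (C4 : hypC4 g Phi a b) (C5 : hypC5 F) (C6 : hypC6 k hA).
Hypotheses (C7 : hypC7 r gamma hA a b c2) (C8 : hypC8 r a b).

Notation D := (`[- r, 1]%classic : set R).
Notation Q := (`[a, b]%classic : set R).
Notation c := (cst_c c1 c2).
Notation P := (K0 r hA a b c1 c2).

Let r0 : 0 < r. Proof. by case/andP: C8. Qed.
Let a0 : 0 < a. Proof. by have [[] ? ? ?] := C3. Qed.
Let ab : a <= b. Proof. by have [[] ? ? ?] := C3. Qed.
Let b1 : b <= 1. Proof. by have [[] ? ? ?] := C3. Qed.
Let c01 : 0 < c <= 1.
Proof.
have [_ _ /andP[c10 c11] _ _] := C3; have [_ _ _ /andP[c20 _] _] := C7.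
by rewrite lt_min c10 c20 ge_min c11.
Qed.
Let c0 : 0 < c. Proof. by case/andP: c01. Qed.
Let al1 : 0 < 1 - stieltjes hA gamma.
Proof. by have [_ _ /andP[_ ?] _ _] := C7; rewrite subr_gt0. Qed.

Let in01 t : a <= t <= b -> 0 <= t <= 1.
Proof. by move=> /andP[? ?]; apply/andP; split; [apply: le_trans (ltW a0) _|apply: le_trans b1]. Qed.

Let inr1 t : 0 <= t <= 1 -> - r <= t <= 1.
Proof. by move=> /andP[t0 ->]; rewrite andbT (le_trans _ t0)// oppr_le0 ltW. Qed.

Let Dcomp : compact D. Proof. exact: segment_compact. Qed.
Let QD : Q `<=` D. Proof. by move=> t; rewrite /= !in_itv/= => /in01/inr1. Qed.
Let Qa : Q a. Proof. by rewrite /= in_itv/= lexx. Qed.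

Let DE t : D t = (- r <= t <= 1 : Prop).
Proof. by rewrite /= in_itv. Qed.

Let Pcont u : P u -> {within D, continuous u}. Proof. by case. Qed.

Let Preg u : P u -> stieltjes_regular u.
Proof. by move=> /Pcont; exact: stieltjes_regular_cont. Qed.

Let Pbd u : P u -> exists K : R, forall t, D t -> `|u t| <= K.
Proof. by move=> /Pcont; exact: within_continuous_bounded. Qed.

Let Pc u t : P u -> Q t -> c * nrm D u <= u t.
Proof. by move=> [_ _ H _]; rewrite /= in_itv/=; exact: H. Qed.

Let Pcone u v (l m : R) : P u -> P v -> 0 <= l -> 0 <= m ->
  P (fun t => l * u t + m * v t).
Proof.
move=> Pu Pv l0 m0; have [uc uz ucn us] := Pu; have [vc vz vcn vs] := Pv; split.
- apply/subspace_continuousP => x Dx.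
  move/subspace_continuousP : uc => /(_ x Dx) uc.
  move/subspace_continuousP : vc => /(_ x Dx) vc.
  by apply: cvgD; [apply: cvgM uc|apply: cvgM vc]; exact: cvg_cst.
- by move=> t t0; rewrite uz// vz// !mulr0 addr0.
- move=> t tab; have [K uK] := Pbd Pu; have [K' vK] := Pbd Pv.
  apply: (@le_trans _ _ (l * (c * sup_norm D u) + m * (c * sup_norm D v))).
    rewrite !(mulrCA _ c) -mulrDr ler_pM2l//.
    apply: sup_on_le; first by exists a; exact: QD.
    move=> s Ds; apply: le_trans (ler_normD _ _) _; rewrite !normrM (ger0_norm l0) (ger0_norm m0).
    apply: lerD; apply: ler_wpM2l => //.
      exact: (sup_norm_ub uK).
    exact: (sup_norm_ub vK).
  by apply: lerD; apply: ler_wpM2l => //; [exact: ucn|exact: vcn].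
- rewrite stieltjes_lin; [|exact: Preg|exact: Preg].
  by apply: addr_ge0; exact: mulr_ge0.
Qed.

Let Pclosed v : (forall e : R, 0 < e -> exists2 u, P u & close_on D e u v) -> P v.
Proof.
move=> H.
have vc : {within D, continuous v}.
  apply/within_continuousP => t Dt e e0; have e3 : 0 < e / 3 by lra.
  have [u [/within_continuousP uc _ _ _] uv] := H _ e3.
  apply: filterS (uc t Dt _ e3) => s uts Ds; have {}uts := uts Ds.
  have A1 := uv t Dt; have A2 := uv s Ds; rewrite distrC in A1.
  have := ler_distD (u t) (v t) (v s); have := ler_distD (u s) (u t) (v s); lra.
have vr : stieltjes_regular v := stieltjes_regular_cont r0 vc.
have [K vK] := within_continuous_bounded Dcomp vc.
split=> //.
- move=> t /andP[t1 t2]; apply/eqP; rewrite -normr_le0; apply/ler_addgt0Pr => e e0.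
  have [u [_ uz _ _] uv] := H _ e0; rewrite add0r.
  have Dt : D t by rewrite /= in_itv/= t1 (le_trans t2).
  by have := uv t Dt; rewrite uz ?t1// sub0r normrN.
- move=> t tab; apply/ler_addgt0Pr => e e0; have e2 : 0 < e / 2 by lra.
  have [u Pu uv] := H _ e2; have [_ _ /(_ t tab) uc _] := Pu.
  have Dt : D t by apply: QD; rewrite /= in_itv.
  have [Ku uK] := Pbd Pu.
  have : sup_norm D v <= sup_norm D u + e / 2.
    apply: sup_on_le; first by exists t.
    move=> s Ds; have := uv s Ds; rewrite distrC.
    have := sup_norm_ub uK Ds.
    have := lerB_dist (v s) (u s); lra.
  move=> /(ler_wpM2l (ltW c0)); rewrite mulrDr => H1.
  have : c * (e / 2) <= 1 * (e / 2) by apply: ler_wpM2r; [lra|case/andP: c01].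
  have := uv t Dt; rewrite ler_norml => /andP[]; lra.
- have [V V0 VP] := stieltjes_close hA.
  apply/ler_addgt0Pr => e e0.
  have V1 : 0 < V + 1 by rewrite ltr_wpDl.
  have [u Pu uv] := H _ (divr_gt0 e0 V1); have [_ _ _ us] := Pu.
  have : `|stieltjes hA u - stieltjes hA v| <= e / (V + 1) * V.
    by apply: VP => //; [exact: Preg|move=> t /inr1 t1; apply: uv; rewrite /= in_itv].
  have : e / (V + 1) * V <= e.
    by rewrite mulrAC ler_pdivrMr// ler_pM2l// lerDl.
  move: us; move: (stieltjes hA u) (stieltjes hA v) (_ * V) => x y z.
  by rewrite ler_norml => ? ? /andP[]; lra.
Qed.

Let gamma_cont : {within D, continuous gamma}. Proof. by case: C7 => -[]. Qed.

(** This qualifies [gamma] as the direction of the pushes and of the perturbation. *)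
Let Pgamma : P gamma.
Proof.
have [[_ _] gz /andP[gs _] /andP[c20 _] gab] := C7; split => // t tab.
apply: le_trans (gab t tab); have [K gK] := within_continuous_bounded Dcomp gamma_cont.
have ub s : 0 <= s <= 1 -> `|gamma s| <= sup_norm `[0, 1] gamma.
  move=> s01; apply: (@sup_norm_ub _ _ `[0, 1]%classic gamma _ K).
    by move=> x; rewrite /= in_itv/= => /inr1 x1; apply: gK; rewrite /= in_itv.
  by rewrite /= in_itv.
have N0 : 0 <= sup_norm `[0, 1] gamma by apply: le_trans (ub t (in01 tab)).
apply: ler_pM => //; [exact: ltW| |by rewrite ge_min lexx orbT|].
  by apply: le_trans (sup_norm_ub gK (QD Qa)).
apply: sup_on_le; first by exists a; exact: QD.
move=> s; rewrite /= in_itv/= => /andP[s1 s2]; have [s0|s0] := leP s 0.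
  by rewrite gz ?s1// normr0.
by apply: ub; rewrite (ltW s0).
Qed.

Let gamma_gt0 : 0 < nrm D gamma.
Proof.
have [[_ [t t1 gt]] _ _ _ _] := C7.
have [K gK] := within_continuous_bounded Dcomp gamma_cont.
apply: lt_le_trans (_ : `|gamma t| <= _); first by rewrite normr_gt0.
by apply: (sup_norm_ub gK); rewrite /= in_itv.
Qed.

Let psi_bd t : - r <= t <= 0 -> `|psi t| <= norm_psi r psi.
Proof.
have [pc _] := C1; have [K pK] := within_continuous_bounded Dcomp pc.
move=> t0; apply: (@sup_norm_ub _ _ `[- r, 0]%classic psi t K).
  move=> s; rewrite /= in_itv/= => /andP[s1 s2]; apply: pK; rewrite /= in_itv/= s1/=.
  exact: le_trans s2 _.
by rewrite /= in_itv.
Qed.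

Let psiD_cont v : P v -> {within D, continuous (psi \+ v)}.
Proof.
have [/subspace_continuousP pc _] := C1; move=> /Pcont/subspace_continuousP vc.
by apply/subspace_continuousP => x Dx; apply: cvgD; [exact: pc|exact: vc].
Qed.

Let psiD_bd v t K : P v -> nrm D v <= K -> - r <= t <= 1 ->
  `|(psi \+ v) t| <= Num.max (norm_psi r psi) K.
Proof.
move=> Pv vK /andP[t1 t2]; have [_ psi0] := C1; have [_ vz _ _] := Pv.
have [Kv vKv] := Pbd Pv; rewrite /= le_max; have [t0|t0] := leP t 0.
  by rewrite vz ?t1// addr0 psi_bd ?t1.
rewrite psi0 ?(ltW t0)// add0r; apply/orP; right; apply: le_trans vK.
by apply: (sup_norm_ub vKv); rewrite /= in_itv/= t1.
Qed.

Definition response (v : R -> R) : R -> R := along F (psi \+ v).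
Definition hammerstein (v : R -> R) : R -> R := lin_op k g gamma hA (response v).
Notation S := hammerstein.

Let admissible_response K : exists2 M : R, 0 <= M & forall v, P v -> nrm D v <= K ->
  admissible M (response v).
Proof.
have [M M0 MP] := along_bounded r0 C5 (Num.max (norm_psi r psi) K).
exists M => // v Pv vK; split; first exact: (along_measurable r0 C5 (psiD_cont Pv)).
have H : ae_on 0 1 (fun s => response v s <= M).
  by apply: MP; [exact: psiD_cont|move=> s s1; exact: psiD_bd].
apply: ae_onS H => s s01 ->; rewrite andbT.
exact: (along_ge0 C5 (psiD_cont Pv) s01).
Qed.

Let admissible_ex v : P v -> exists M : R, admissible M (response v).
Proof.
by move=> Pv; have [M _ H] := admissible_response (nrm D v); exists M; exact: H.
Qed.

Let PS v : P v -> P (S v).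
Proof.
move=> Pv; have [M adm] := admissible_ex Pv; split.
- exact: (lin_op_continuous C2 C3 C4 C6 C7 C8 adm).
- by move=> t; exact: (lin_op_zero C2 C3 C4 C7 adm).
- move=> t tab; rewrite mulrC -ler_pdivlMr//.
  apply: sup_on_le; first by exists a; exact: QD.
  move=> s; rewrite /= in_itv/= => /andP[s1 s2].
  have cone s' : 0 <= s' <= 1 -> c * `|S v s'| <= S v t.
    exact: (lin_op_cone C2 C3 C4 C6 C7 C8 adm tab).
  rewrite ler_pdivlMr// mulrC; have [s0|s0] := leP s 0; last first.
    by apply: cone; rewrite (ltW s0).
  rewrite /S (lin_op_zero C2 C3 C4 C7 adm) ?s1// normr0 mulr0.
  by apply: le_trans (cone 0 _); [rewrite mulr_ge0// ltW|rewrite lexx ler01].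
- rewrite /S (lin_op_stieltjes C2 C3 C4 C6 C7 C8 adm).
  by apply: divr_ge0; [exact: (lin_mass_ge0 C2 C3 C4 C6 C8 adm)|exact: ltW].
Qed.

Let Scont (K : R) (u_ : nat -> R -> R) u :
  (forall n, P (u_ n) /\ nrm D (u_ n) <= K) -> P u -> ucvg D u_ u ->
  ucvg D (S \o u_) (S u).
Proof.
move=> Pu_ Pu uu; have [M M0 MP] := admissible_response (Num.max K (nrm D u)).
apply: (lin_op_cvg C2 C3 C4 C6 C7 C8 (M := M)).
- by move=> n; have [Pn nK] := Pu_ n; apply: MP => //; rewrite le_max nK.
- by apply: MP => //; rewrite le_max lexx orbT.
- apply: (along_cvg r0 C5 (psiD_cont Pu)) => [n|].
    by apply: psiD_cont; have [] := Pu_ n.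
  by apply: ucvgD => //; exact: ucvg_cst.
Qed.

Let Sequi (K : R) : exists w : R -> R -> R,
  [/\ forall t s, 0 <= w t s,
      (forall t, D t -> forall eps : R, 0 < eps -> \forall s \near t, D s -> w t s <= eps) &
      forall u, P u -> nrm D u <= K ->
        forall t s, D t -> D s -> `|S u t - S u s| <= w t s].
Proof.
have [M M0 MP] := admissible_response K.
pose J := integ 0 1 (fun s => kernelA k hA s * g s).
pose m := `|M * J| / (1 - stieltjes hA gamma).
have m0 : 0 <= m by apply: divr_ge0 => //; exact: ltW.
exists (fun t s => M * modulus k g t s + m * `|gamma t - gamma s|); split.
- by move=> t s; rewrite addr_ge0// mulr_ge0//; exact: modulus_ge0.
- move/within_continuousP : gamma_cont => gc.
  exact: (modulus_add gc M0 m0 (modulus_cont C2 C3 C4)).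
- move=> u Pu uK t s; rewrite !DE => t1 s1; have adm := MP u Pu uK.
  apply: le_trans (lin_op_modulus C2 C3 C4 C6 C7 C8 adm t1 s1) _.
  rewrite lerD2l; apply: ler_wpM2r => //; apply: ler_wpM2r; first by rewrite invr_ge0 ltW.
  apply: le_trans (ler_norm _).
  exact: (lin_mass_le C2 C3 C4 C6 C8 adm).
Qed.

(** [psi] vanishes on [0, 1], so alpha[psi + v] = alpha[v], and for v = S v this is the coefficient
    of [gamma] in S v. *)
Let fixed_solution v : P v -> 0 < nrm D v -> (forall t, D t -> v t = S v t) ->
  nontrivial_solution psi k g F gamma hA a b c1 c2 (psi \+ v).
Proof.
move=> Pv v0 vS; have [M adm] := admissible_ex Pv; have [_ psi0] := C1.
split; first by exists v.
- move=> t t1; have Dt : D t by rewrite /= in_itv.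
  have -> : stieltjes hA (psi \+ v) = lin_mass k g hA (response v) / (1 - stieltjes hA gamma).
    rewrite -(lin_op_stieltjes C2 C3 C4 C6 C7 C8 adm); apply: stieltjes_eq => s s01.
    by rewrite /= psi0// add0r vS// DE; exact: inr1.
  rewrite -addrA; congr (_ + _); rewrite vS// /S /lin_op; congr (_ + _).
  by rewrite -mulrA; congr (_ * _); rewrite mulrC.
- apply: contrapT => nd; move: v0; rewrite ltNge => /negP; apply.
  apply: sup_on_le; first by exists a; exact: QD.
  move=> t; rewrite DE => t1; rewrite normr_le0; apply/eqP; apply: contrapT => vt.
  apply: nd; exists t => //; apply/eqP => /= e; apply: vt.
  by apply: (addrI (psi t)); rewrite addr0.
Qed.

Let I1_inner rho : 0 < rho -> I1 psi k g F gamma hA rho -> inner_cond D P S rho.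
Proof.
move=> rho0 [psi_rho I].
pose x t := integ 0 1 (fun s => `|k t s| * g s)
   + `|gamma t| / (1 - stieltjes hA gamma) * integ 0 1 (fun s => kernelA k hA s * g s).
have x_le t : 0 <= t <= 1 -> ((x t)%:E <= inv_m k g gamma hA)%E.
  by move=> t01; apply: ereal_sup_ubound; exists t => //=; rewrite in_itv.
have b01 : 0 <= b <= 1 by apply: in01; rewrite ab lexx.
have m_gt0 : (0 < inv_m k g gamma hA)%E.
  by apply: lt_le_trans (x_le b b01); rewrite lte_fin (inv_m_term_gt0 C2 C3 C4 C6 C7 C8).
have f_ge0 : (0 <= F_up F rho)%E.
  have [F0 _ _ _] := C5.
  apply: le_trans (_ : (F 0 (cst 0) / rho)%:E <= _)%E.
    rewrite lee_fin; apply: divr_ge0; last exact: ltW.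
    by apply: F0; [rewrite lexx ler01|exact: cst_continuous].
  apply: ereal_sup_ubound; exists 0, (cst 0); split=> //; first by rewrite lexx ler01.
    exact: cst_continuous.
  apply: sup_norm_le; first exact: delay_itv_ex.
  by move=> t _; rewrite normr0 ltW.
have [f fE] : exists f : R, F_up F rho = f%:E.
  case: (F_up F rho) f_ge0 I => [f|_|//]; first by exists f.
  by rewrite gt0_mulye.
have f0 : 0 <= f by rewrite -lee_fin -fE.
have p_ge t : 0 <= t <= 1 -> ((f * x t)%:E <= F_up F rho * inv_m k g gamma hA)%E.
  by move=> t01; rewrite fE EFinM; apply: lee_wpmul2l; [rewrite lee_fin|exact: x_le].
have [p pE] : exists p : R, (F_up F rho * inv_m k g gamma hA)%E = p%:E.
  move: I (p_ge b b01); case: (F_up F rho * _)%E => [p _ _|//|_].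
    by exists p.
  by rewrite leNgt ltNyr.
have p1 : p < 1 by rewrite -lte_fin -pE.
(* [p] is F^(-rho,rho)/m, so the gap is the distance from [p] to 1, scaled by [rho]. *)
exists (rho * p); first by rewrite gtr_pMr.
move=> v Pv vrho; have [M [mh hM]] := admissible_ex Pv.
have adm : admissible (rho * f) (response v).
  split=> //; apply: ae_onW => s s01.
  rewrite (along_ge0 C5 (psiD_cont Pv))//= mulrC -ler_pdivrMr//.
  rewrite -lee_fin -fE; apply: ereal_sup_ubound.
  exists s, (history (psi \+ v) s); split=> //.
    exact: (history_continuous (psiD_cont Pv)).
  apply: history_norm => // t t1; apply: le_trans (psiD_bd Pv vrho t1) _.
  by rewrite ge_max lexx (ltW psi_rho).
have p_ge' t : 0 <= t <= 1 -> f * x t <= p by move=> /p_ge; rewrite pE lee_fin.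
apply: sup_on_le; first by exists a; exact: QD.
move=> t; rewrite DE => /andP[t1 t2]; have [t0|t0] := leP t 0.
  rewrite /S (lin_op_zero C2 C3 C4 C7 adm) ?t1// normr0 mulr_ge0 ?(ltW rho0)//.
  apply: le_trans (p_ge' b b01); rewrite mulr_ge0//.
  exact: ltW (inv_m_term_gt0 C2 C3 C4 C6 C7 C8).
have t01 : 0 <= t <= 1 by rewrite (ltW t0).
apply: le_trans (lin_op_upper C2 C3 C4 C6 C7 C8 adm (inr1 t01)) _.
rewrite -/(x t) -mulrA ler_pM2l//; exact: p_ge'.
Qed.

Let I0_outer rho : 0 < rho -> I0 k g F gamma hA a b c1 c2 rho -> outer_cond Q c P S rho.
Proof.
move=> rho0 I.
pose y t := integ (a + r) b (fun s => k t s * g s)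
   + gamma t / (1 - stieltjes hA gamma) * integ (a + r) b (fun s => kernelA k hA s * g s).
have y_ge t : a <= t <= b -> (inv_M r k g gamma hA a b <= (y t)%:E)%E.
  by move=> tab; apply: ereal_inf_lbound; exists t => //=; rewrite in_itv.
have aab : a <= a <= b by rewrite lexx ab.
have [F0 _ _ _] := C5.
have f_ge0 : (0 <= F_low F a b c1 c2 rho)%E.
  apply: le_ereal_inf_tmp => _ [t [phi [tab pc _ ->]]].
  by rewrite lee_fin divr_ge0 ?(ltW rho0)//; apply: F0 => //; exact: in01.
have f_le t (phi : delay_itv r -> R) : a <= t <= b -> continuous phi ->
    (forall th, rho <= phi th <= rho / c) ->
    (F_low F a b c1 c2 rho <= (F t phi / rho)%:E)%E.
  by move=> tab pc pb; apply: ereal_inf_lbound; exists t, phi.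
have [f fE] : exists f : R, F_low F a b c1 c2 rho = f%:E.
  have : (F_low F a b c1 c2 rho <= (F a (cst rho) / rho)%:E)%E.
    apply: f_le => //; first exact: cst_continuous.
    move=> _ /=; rewrite lexx ler_pdivlMr//=.
    by rewrite -[leRHS]mulr1 ler_pM2l//; case/andP: c01.
  case: (F_low _ _ _ _ _ _) f_ge0 => [f _ _|_|//]; first by exists f.
  by rewrite leye_eq.
have f0 : 0 <= f by rewrite -lee_fin -fE.
have [M ME] : exists M : R, inv_M r k g gamma hA a b = M%:E.
  move: I (y_ge a aab); rewrite /I0 fE; case: (inv_M _ _ _ _ _ _ _) => [M _ _|//|].
    by exists M.
  (* The infimum cannot be -oo: its product with the nonnegative [f] would be at most 0. *)
  move=> + _; rewrite ltNge => /negP[].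
  by apply: le_trans (_ : 0 <= _)%E; [apply: mule_ge0_le0; rewrite ?lee_fin|rewrite lee_fin].
have fM : 1 < f * M by move: I; rewrite /I0 fE ME -EFinM lte_fin.
exists (rho * (f * M)); first by rewrite ltr_pMr.
move=> v Pv vrho t Qt; have [K adm] := admissible_ex Pv.
have tab : a <= t <= b by move: Qt; rewrite /= in_itv.
have m0 : 0 <= rho * f by rewrite mulr_ge0// ltW.
have H : ae_on (a + r) b (fun s => rho * f <= response v s).
  apply: ae_onW => s /andP[s1 s2].
  have sab : a <= s <= b by rewrite s2 andbT (le_trans _ s1)// lerDl ltW.
  rewrite mulrC -ler_pdivlMr// -lee_fin -fE; apply: f_le => //.
    exact: (history_continuous (psiD_cont Pv) (in01 sab)).
  move=> th; have /andP[th1 th2] := delay_valP th.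
  have Qs : a <= s + set_val th <= b by apply/andP; split; lra.
  have [_ psi0] := C1; rewrite /history /= psi0 ?add0r; last exact: in01.
  by apply: vrho; rewrite /= in_itv.
apply: le_trans (lin_op_lower C2 C3 C4 C6 C7 C8 adm tab m0 H).
rewrite mulrA; apply: ler_wpM2l => //.
by rewrite -lee_fin -ME; exact: y_ge.
Qed.

Let nrm_gt0_low v rho : 0 < rho -> P v -> rho < low Q v -> 0 < nrm D v.
Proof.
move=> rho0 Pv lv; apply: lt_trans rho0 _; apply: lt_le_trans lv _.
exact: (low_nrm QD Qa c01 Pbd Pc).
Qed.

Notation soln v := (nontrivial_solution psi k g F gamma hA a b c1 c2 (psi \+ v)).

Lemma fixed_between_I0_I1 rho1 rho2 : 0 < rho1 -> rho1 / c < rho2 ->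
  I0 k g F gamma hA a b c1 c2 rho1 -> I1 psi k g F gamma hA rho2 ->
  exists v : R -> R, [/\ P v, soln v, rho1 < low Q v & nrm D v < rho2].
Proof.
move=> r1 r12 H0 H1.
have r2 : 0 < rho2 by apply: lt_trans r12; rewrite divr_gt0.
have gc := iffLR (within_continuousP D gamma) gamma_cont.
have [v Pv [vS lv nv]] := compression Dcomp QD Qa c01 Pcone Pclosed Pbd Pc Pgamma
  gamma_gt0 gc PS Scont Sequi r1 r12 (I0_outer r1 H0) (I1_inner r2 H1).
by exists v; split=> //; apply: fixed_solution => //; exact: nrm_gt0_low lv.
Qed.

Lemma fixed_between_I1_I0 rho1 rho2 : 0 < rho1 -> rho1 < rho2 ->
  I1 psi k g F gamma hA rho1 -> I0 k g F gamma hA a b c1 c2 rho2 ->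
  exists v : R -> R, [/\ P v, soln v, rho1 < nrm D v & low Q v < rho2].
Proof.
move=> r1 r12 H1 H0.
have gc := iffLR (within_continuousP D gamma) gamma_cont.
have [v Pv [vS nv lv]] := expansion Dcomp QD Qa c01 Pcone Pclosed Pbd Pc Pgamma
  gamma_gt0 gc PS Scont Sequi r1 r12 (I1_inner r1 H1) (I0_outer (lt_trans r1 r12) H0).
by exists v; split=> //; apply: fixed_solution => //; exact: lt_trans nv.
Qed.

Lemma cone_low_nrm v : P v -> low Q v <= nrm D v.
Proof. exact: (low_nrm QD Qa c01 Pbd Pc). Qed.

Lemma cone_nrm_low v : P v -> nrm D v <= low Q v / c.
Proof. by move=> Pv; rewrite ler_pdivlMr// mulrC; exact: (nrm_low Qa Pc). Qed.

Lemma differ_nrm u v : nrm D u < nrm D v -> differ r (psi \+ u) (psi \+ v).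
Proof.
move=> uv; apply: contrapT => nd; move: uv; rewrite (_ : nrm D v = nrm D u) ?ltxx//.
apply: nrm_eq => t; rewrite DE => t1; apply: contrapT => vt; apply: nd; exists t => //.
by apply/eqP => /= /addrI e; apply: vt.
Qed.

Lemma differ_low u v : low Q u < low Q v -> differ r (psi \+ u) (psi \+ v).
Proof.
move=> uv; apply: contrapT => nd; move: uv; rewrite (_ : low Q v = low Q u) ?ltxx//.
apply: (low_eq QD) => t; rewrite DE => t1; apply: contrapT => vt; apply: nd; exists t => //.
by apply/eqP => /= /addrI e; apply: vt.
Qed.

Lemma differ_sym u v : differ r u v -> differ r v u.
Proof. by case=> t t1 uv; exists t => //; rewrite eq_sym. Qed.

Lemma at_least_seq (s : seq (R -> R)) :
  (forall i, (i < size s)%N -> soln (nth psi s i)) ->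
  (forall i j, (i < j < size s)%N -> differ r (psi \+ nth psi s i) (psi \+ nth psi s j)) ->
  at_least_solutions psi k g F gamma hA a b c1 c2 (size s).
Proof.
move=> sol df; exists (fun i => psi \+ nth psi s i); split=> [i|i j].
  exact: sol.
rewrite neq_ltn => /orP[] ij; first by apply: df; rewrite ij /=.
by apply: differ_sym; apply: df; rewrite ij /=.
Qed.

Lemma one_solution :
  S1 psi k g F gamma hA a b c1 c2 \/ S2 psi k g F gamma hA a b c1 c2 ->
  at_least_solutions psi k g F gamma hA a b c1 c2 1.
Proof.
move=> H; suff [v sv] : exists v, soln v.
  by apply: (@at_least_seq [:: v]) => [[|]//|i [|j]]; rewrite ?ltn0 ?andbF.
case: H => [[x1 [x2 [[x10 _] _ x12 [H1 H2]]]]|[x1 [x2 [[x10 _] _ x12 [H1 H2]]]]].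
  by have [v [_ ? _ _]] := fixed_between_I0_I1 x10 x12 H1 H2; exists v.
by have [v [_ ? _ _]] := fixed_between_I1_I0 x10 x12 H1 H2; exists v.
Qed.

(** The solutions lie on opposite sides of the middle level, in norm if it is an [I1] level and in
    minimum over [a, b] if it is an [I0] level. *)
Lemma two_solutions :
  S3 psi k g F gamma hA a b c1 c2 \/ S4 psi k g F gamma hA a b c1 c2 ->
  at_least_solutions psi k g F gamma hA a b c1 c2 2.
Proof.
move=> H.
suff [v [w [sv sw vw]]] : exists v w, [/\ soln v, soln w & differ r (psi \+ v) (psi \+ w)].
  by apply: (@at_least_seq [:: v; w]) => [[|[|]]//|[|[|i]] [|[|j]] /andP[]].
case: H => [[x1 [x2 [x3 [[x10 x20 x30] _ [x12 x23] [H1 H2 H3]]]]]|].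
  have [v [_ sv _ v2]] := fixed_between_I0_I1 x10 x12 H1 H2.
  have [w [_ sw w2 _]] := fixed_between_I1_I0 x20 x23 H2 H3.
  by exists v, w; split=> //; apply: differ_nrm; exact: lt_trans w2.
move=> [x1 [x2 [x3 [[x10 x20 x30] [_ x12] x23 [H1 H2 H3]]]]].
have [v [_ sv _ v2]] := fixed_between_I1_I0 x10 x12 H1 H2.
have [w [_ sw w2 _]] := fixed_between_I0_I1 x20 x23 H2 H3.
by exists v, w; split=> //; apply: differ_low; exact: lt_trans w2.
Qed.

Lemma three_solutions :
  S5 psi k g F gamma hA a b c1 c2 \/ S6 psi k g F gamma hA a b c1 c2 ->
  at_least_solutions psi k g F gamma hA a b c1 c2 3.
Proof.
move=> H.
suff [v [w [z [[sv sw sz] vw wz vz]]]] : exists v w z, [/\ [/\ soln v, soln w & soln z],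
    differ r (psi \+ v) (psi \+ w), differ r (psi \+ w) (psi \+ z)
    & differ r (psi \+ v) (psi \+ z)].
  by apply: (@at_least_seq [:: v; w; z]) => [[|[|[|]]]//|[|[|[|i]]] [|[|[|j]]] /andP[]].
case: H => [[x1 [x2 [x3 [x4 [[x10 x20 x30 _] _ [x12 x23 x34] [H1 H2 H3 H4]]]]]]|].
  have [v [_ sv _ v2]] := fixed_between_I0_I1 x10 x12 H1 H2.
  have [w [_ sw w2 w3]] := fixed_between_I1_I0 x20 x23 H2 H3.
  have [z [Pz sz z3 _]] := fixed_between_I0_I1 x30 x34 H3 H4.
  exists v, w, z; split=> //.
  - by apply: differ_nrm; exact: lt_trans w2.
  - by apply: differ_low; exact: lt_trans z3.
  (* The outer two solutions share no level, but nrm v < rho2 < rho3 < low z <= nrm z. *)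
  - apply: differ_nrm; apply: (lt_trans v2); apply: (lt_trans x23).
    exact: lt_le_trans (cone_low_nrm Pz).
move=> [x1 [x2 [x3 [x4 [[x10 x20 x30 _] [_ x12] [x23 x34] [H1 H2 H3 H4]]]]]].
have [v [Pv sv _ v2]] := fixed_between_I1_I0 x10 x12 H1 H2.
have [w [_ sw w2 w3]] := fixed_between_I0_I1 x20 x23 H2 H3.
have [z [_ sz z3 _]] := fixed_between_I1_I0 x30 x34 H3 H4.
exists v, w, z; split=> //.
- by apply: differ_low; exact: lt_trans w2.
- by apply: differ_nrm; exact: lt_trans z3.
(* Here nrm v <= low v / c < rho2 / c < rho3 < nrm z. *)
- apply: differ_nrm; apply: le_lt_trans (cone_nrm_low Pv) _; apply: lt_trans z3.
  by apply: lt_trans x23; rewrite ltr_pM2r// invr_gt0.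
Qed.

End DelayedHammerstein.

Theorem theorem3p6 (R : realType) (r : R) (psi : R -> R) (k : R -> R -> R)
  (g : R -> R) (F : R -> (delay_itv r -> R) -> R) (gamma : R -> R)
  (A : R -> R) (hA : bounded_variation 0 1 A)
  (Phi : R -> R) (a b c1 c2 : R) :
  hypC1 r psi ->
  hypC2 r k ->
  hypC3 k Phi a b c1 ->
  hypC4 g Phi a b ->
  hypC5 F ->
  hypC6 k hA ->
  hypC7 r gamma hA a b c2 ->
  hypC8 r a b ->
  [/\ S1 psi k g F gamma hA a b c1 c2 \/ S2 psi k g F gamma hA a b c1 c2 ->
        at_least_solutions psi k g F gamma hA a b c1 c2 1,
      S3 psi k g F gamma hA a b c1 c2 \/ S4 psi k g F gamma hA a b c1 c2 ->
        at_least_solutions psi k g F gamma hA a b c1 c2 2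
    & S5 psi k g F gamma hA a b c1 c2 \/ S6 psi k g F gamma hA a b c1 c2 ->
        at_least_solutions psi k g F gamma hA a b c1 c2 3].
Proof.
move=> C1 C2 C3 C4 C5 C6 C7 C8; split.
- exact: (one_solution C1 C2 C3 C4 C5 C6 C7 C8).
- exact: (two_solutions C1 C2 C3 C4 C5 C6 C7 C8).
- exact: (three_solutions C1 C2 C3 C4 C5 C6 C7 C8).
Qed.
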